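(* Let $T$ be a complete first-order theory, $E$ a bounded, invariant equivalence relation refining $\equiv$ (the relation of having the same type over $\emptyset$), and $\bar\alpha\in\mathrm{dom}(E)$. Let $\bar h_E\colon u\mathcal{M}/H(u\mathcal{M})\to[\bar\alpha]_\equiv/E$ and $\ker(\bar h_E)$ be as defined in the context. Then $$\bar h_E[\mathrm{cl}_\tau(\ker(\bar h_E))]=\mathrm{cl}(\bar\alpha/E),$$ where the closure $\mathrm{cl}(\bar\alpha/E)$ is computed in $[\bar\alpha]_\equiv/E$ with the logic topology. This means that the map $\bar h_E$ restricted to $\mathrm{cl}_\tau(\ker(\bar h_E))$ induces a bijection between the set $\mathrm{cl}_\tau(\ker(\bar h_E))/\ker(\bar h_E)$ of left cosets of $\ker(\bar h_E)$ in $\mathrm{cl}_\tau(\ker(\bar h_E))$ and $\mathrm{cl}(\bar\alpha/E)$. Thus, $\mathrm{cl}(\bar\alpha/E)$ is naturally the quotient of a compact, Hausdorff group by a dense (not necessarily normal) subgroup.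
   Context: ''Compact'' does not include Hausdorff. A monster model is a model that is $\kappa$-saturated and strongly $\kappa$-homogeneous for a sufficiently large strong limit cardinal $\kappa$ (its degree of saturation); ''small'' means of cardinality less than the degree of saturation. $\mathfrak{C}$ is a monster model of $T$, $\bar c$ is a tuple enumerating all elements of $\mathfrak{C}$, and $\mathfrak{C}'\succ\mathfrak{C}$ is a bigger monster model whose degree of saturation is much bigger than $|\mathfrak{C}|$. Put $S_{\bar c}(\mathfrak{C})=\{\mathrm{tp}(\bar a/\mathfrak{C}) : \bar a\equiv\bar c\}$ ($\bar a$ from $\mathfrak{C}'$), a compact Hausdorff space on which $\mathrm{Aut}(\mathfrak{C})$ acts naturally. $EL$ is the Ellis semigroup of this action: the closure of $\mathrm{Aut}(\mathfrak{C})$ (each automorphism viewed as a map $S_{\bar c}(\mathfrak{C})\to S_{\bar c}(\mathfrak{C})$) in the product space $S_{\bar c}(\mathfrak{C})^{S_{\bar c}(\mathfrak{C})}$, with composition as semigroup operation; $\mathrm{Aut}(\mathfrak{C})$ is regarded as a subset of $EL$. $\mathcal{M}$ is any minimal left ideal of $EL$ and $u\in\mathcal{M}$ any idempotent; then $u\mathcal{M}$ is a group with identity $u$. For $A\subseteq EL$ and $p\in EL$, $p\circ A$ is the set of all $\eta\in EL$ for which there are nets $(\eta_i)$ in $A$ and $(g_i)$ in $\mathrm{Aut}(\mathfrak{C})$ with $\lim g_i=p$ and $\lim g_i\eta_i=\eta$. For $A\subseteq u\mathcal{M}$, $\mathrm{cl}_\tau(A)=(u\circ A)\cap u\mathcal{M}$;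 this is a closure operator which defines the $\tau$-topology on $u\mathcal{M}$. $H(u\mathcal{M})$ is the intersection of the sets $\mathrm{cl}_\tau(V)$ over all $\tau$-neighborhoods $V$ of $u$; it is a $\tau$-closed normal subgroup of $u\mathcal{M}$, and $u\mathcal{M}/H(u\mathcal{M})$ with the quotient topology (also called the $\tau$-topology; closures in it are also denoted $\mathrm{cl}_\tau$) is a compact Hausdorff group. $\mathrm{Autf}_L(\mathfrak{C}')$ is the (normal) subgroup of $\mathrm{Aut}(\mathfrak{C}')$ generated by all automorphisms fixing pointwise some small submodel; $\mathrm{Gal}_L(T)=\mathrm{Aut}(\mathfrak{C}')/\mathrm{Autf}_L(\mathfrak{C}')$. For $x\in EL$ let $\pi_0(x)=x(\mathrm{tp}(\bar c/\mathfrak{C}))$. The map $\hat f\colon EL\to\mathrm{Gal}_L(T)$, $\hat f(x)=\sigma'\,\mathrm{Autf}_L(\mathfrak{C}')$ for any $\sigma'\in\mathrm{Aut}(\mathfrak{C}')$ with $\sigma'(\bar c)\models\pi_0(x)$, is a well-defined semigroup epimorphism; its restriction to $u\mathcal{M}$ is a group epimorphism trivial on $H(u\mathcal{M})$, and $\bar f\colon u\mathcal{M}/H(u\mathcal{M})\to\mathrm{Gal}_L(T)$ is the induced epimorphism. $E$ lives on an $\mathrm{Aut}(\mathfrak{C}')$-invariant subset $\mathrm{dom}(E)$ of a product of a small number of sorts of $\mathfrak{C}'$, is $\mathrm{Aut}(\mathfrak{C}')$-invariant, and bounded means that it has a small number of classes. $[\bar\alpha]_\equiv$ is the set of realizations of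 $\mathrm{tp}(\bar\alpha/\emptyset)$. The logic topology on $[\bar\alpha]_\equiv/E$: a subset is closed iff its preimage in $[\bar\alpha]_\equiv$ is type-definable (over a small set of parameters). $\mathrm{Gal}_L(T)$ acts transitively on $[\bar\alpha]_\equiv/E$ by $\sigma'\mathrm{Autf}_L(\mathfrak{C}')\cdot(\bar\beta/E)=\sigma'(\bar\beta)/E$; put $g_E(\sigma'\mathrm{Autf}_L(\mathfrak{C}'))=\sigma'(\bar\alpha)/E$ and $\bar h_E=g_E\circ\bar f$. Thus $u\mathcal{M}/H(u\mathcal{M})$ acts on $[\bar\alpha]_\equiv/E$ via $\bar f$, and $\ker(\bar h_E)$ denotes the stabilizer of $\bar\alpha/E$, i.e. $\ker(\bar h_E)=\{x\in u\mathcal{M}/H(u\mathcal{M}): \bar h_E(x)=\bar\alpha/E\}$, a (not necessarily normal) subgroup. *)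

(* Defs.v *)
From HB Require Import structures.
From mathcomp Require Import all_boot all_order.
From mathcomp Require Import mathcomp_extra boolp classical_sets functions.
From mathcomp Require Import cardinality topology.

Set Implicit Arguments.
Unset Strict Implicit.
Unset Printing Implicit Defensive.

Local Open Scope classical_set_scope.
Local Open Scope card_scope.

(** * Many-sorted first-order logic *)

Record language := Language {
  lsort : Type;
  funsym : Type;
  farity : funsym -> nat;
  fdom : forall f, 'I_(farity f) -> lsort;
  fcod : funsym -> lsort;
  relsym : Type;
  rarity : relsym -> nat;
  rdom : forall r, 'I_(rarity r) -> lsort }.

Arguments fdom {l} f _.
Arguments rdom {l} r _.

(* A context of variables is an arbitrary (possibly infinite) index type [I]
   together with the sorts [x : I -> lsort L] of the variables; it also stands
   for the product of sorts in which the tuples indexed by [I] live.  In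
   [ext x s] the new variable, of sort [s], is [None]. *)

Section Syntax.
Variable L : language.

Definition ext I (x : I -> lsort L) (s : lsort L) : option I -> lsort L :=
  fun o => if o is Some i then x i else s.

Definition scat I J (x : I -> lsort L) (y : J -> lsort L) : I + J -> lsort L :=
  fun k => match k with inl i => x i | inr j => y j end.

Inductive term (I : Type) (x : I -> lsort L) : lsort L -> Type :=
| tvar (i : I) : term x (x i)
| tapp (f : funsym L) : (forall k, term x (fdom f k)) -> term x (fcod f).

Inductive formula (I : Type) (x : I -> lsort L) : Type :=
| fFalse
| fEq (s : lsort L) of term x s & term x s
| fRel (r : relsym L) of (forall k, term x (rdom r k))
| fImp of formula x & formula x
| fAll (s : lsort L) of formula (ext x s).

Fixpoint tsubst I J (x : I -> lsort L) (y : J -> lsort L)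
    (h : forall i, term y (x i)) s (t : term x s) : term y s :=
  match t with
  | tvar i => h i
  | tapp f a => tapp (fun k => tsubst h (a k))
  end.

Definition up I J (x : I -> lsort L) (y : J -> lsort L)
    (h : forall i, term y (x i)) s : forall o, term (ext y s) (ext x s o) :=
  fun o => match o with
  | Some i => tsubst (fun j => tvar (ext y s) (Some j)) (h i)
  | None => tvar (ext y s) None
  end.

Fixpoint fsubst I J (x : I -> lsort L) (y : J -> lsort L)
    (h : forall i, term y (x i)) (phi : formula x) : formula y :=
  match phi with
  | fFalse => fFalse y
  | fEq s t1 t2 => fEq (tsubst h t1) (tsubst h t2)
  | fRel r a => fRel (fun k => tsubst h (a k))
  | fImp p q => fImp (fsubst h p) (fsubst h q)
  | fAll s p => fAll (fsubst (up h s) p)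
  end.

Definition sentence := formula (of_void (lsort L)).

End Syntax.

Record structure (L : language) := Structure {
  carrier :> lsort L -> Type;
  fint : forall f : funsym L,
    (forall k, carrier (fdom f k)) -> carrier (fcod f);
  rint : forall r : relsym L, (forall k, carrier (rdom r k)) -> Prop }.

Arguments fint {L s} f _.
Arguments rint {L s} r _.

Section Semantics.
Variable L : language.
Implicit Types M N : structure L.

Definition tup M I (x : I -> lsort L) := forall i, M (x i).

Definition text M I (x : I -> lsort L) s (v : tup M x) (a : M s) :
    tup M (ext x s) :=
  fun o => match o with Some i => v i | None => a end.

Definition tcat M I J (x : I -> lsort L) (y : J -> lsort L)
    (v : tup M x) (w : tup M y) : tup M (scat x y) :=
  fun k => match k with inl i => v i | inr j => w j end.

Fixpoint teval M I (x : I -> lsort L) (v : tup M x) s (t : term x s) : M s :=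
  match t with
  | tvar i => v i
  | tapp f a => fint f (fun k => teval v (a k))
  end.

Fixpoint sat M I (x : I -> lsort L) (phi : formula x) : tup M x -> Prop :=
  match phi with
  | fFalse => fun=> False
  | fEq s t1 t2 => fun v => teval v t1 = teval v t2
  | fRel r a => fun v => rint r (fun k => teval v (a k))
  | fImp p q => fun v => sat p v -> sat q v
  | fAll s p => fun v => forall a : M s, sat p (text v a)
  end.

Definition holds M (phi : sentence L) : Prop :=
  forall v : tup M (of_void (lsort L)), sat phi v.

Definition models M (T : set (sentence L)) := forall phi, T phi -> holds M phi.

Definition entails (T : set (sentence L)) phi :=
  forall M, models M T -> holds M phi.

Definition complete_theory (T : set (sentence L)) :=
  (exists M, models M T) /\
  forall phi, entails T phi \/ entails T (fImp phi (fFalse _)).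

Definition same_type M I (x : I -> lsort L) (a b : tup M x) : Prop :=
  forall phi : formula x, sat phi a <-> sat phi b.

Definition smap M N := forall s, M s -> N s.

Definition tmap M N (h : smap M N) I (x : I -> lsort L) (v : tup M x) :
  tup N x := fun i => h _ (v i).

Definition elementary M N (h : smap M N) :=
  forall I (x : I -> lsort L) (phi : formula x) (v : tup M x),
    sat phi v <-> sat phi (tmap h v).

Definition sid M : smap M M := fun _ a => a.

Definition scomp M (g h : smap M M) : smap M M := fun s a => g s (h s a).

Definition Aut M : set (smap M M) := [set h : smap M M |
  [/\ forall s, bijective (h s),
      forall f (a : forall k, M (fdom f k)),
        h _ (fint f a) = fint f (fun k => h _ (a k)) &
      forall r (a : forall k, M (rdom r k)),
        rint r a <-> rint r (fun k => h _ (a k))]].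

Arguments Aut M _ : clear implicits.

Definition is_subgroup M (G : set (smap M M)) :=
  [/\ G `<=` Aut M, G (@sid M),
      forall g h, G g -> G h -> G (scomp g h) &
      forall g h, G g -> Aut M h -> scomp g h = @sid M -> G h].

End Semantics.

Arguments Aut {L} M _.

(** * Monster models; the cardinal kappa is given by a type [K] of that size *)

(* [A] has cardinality less than that of [K]. *)
Definition small (K : Type) T (A : set T) : Prop :=
  (A #<= [set: K]) /\ ~ ([set: K] #<= A).

Definition strong_limit (K : Type) :=
  small K [set: nat] /\
  forall A : Type, small K [set: A] -> small K [set: set A].

Definition small_language (K : Type) (L : language) :=
  [/\ small K [set: lsort L], small K [set: funsym L] & small K [set: relsym L]].

Section Monster.
Variables (L : language) (K : Type) (M : structure L).

Definition small_model (N : structure L) := small K [set: {s : lsort L & N s}].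

(* The set of parameters is the range of the tuple [a]. *)
Definition saturated :=
  forall (I : Type) (x : I -> lsort L) (a : tup M x) (s : lsort L)
    (p : set (formula (ext x s))),
  small K [set: I] ->
  (forall q : set (formula (ext x s)), finite_set q -> q `<=` p ->
     exists b : M s, forall phi, q phi -> sat phi (text a b)) ->
  exists b : M s, forall phi, p phi -> sat phi (text a b).

Definition strongly_homogeneous :=
  forall (I : Type) (x : I -> lsort L) (a b : tup M x),
  small K [set: I] -> same_type a b -> exists2 g, Aut M g & tmap g a = b.

Definition monster :=
  [/\ strong_limit K, small_language K L, saturated & strongly_homogeneous].

Definition AutfL : set (smap M M) :=
  smallest (@is_subgroup L M)
    [set g | Aut M g /\
       exists N (e : smap N M), [/\ small_model N, elementary e &
         forall s (a : N s), g s (e s a) = e s a]].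

(* The elements of [Gal_L(T)] are the sets [galcoset g], for [g] in [Aut M]. *)
Definition galcoset (g : smap M M) : set (smap M M) :=
  [set scomp g h | h in AutfL].

End Monster.

(** * Topologies given by a family of sets *)

(* The subset [X] of [T], with the topology generated by the traces on [X] of
   the members of [B]. *)
Definition generated_space T (X : set T) (B : set (set T)) : Type :=
  {t : T | X t}.

HB.instance Definition _ T (X : set T) B :=
  gen_eqMixin (@generated_space T X B).
HB.instance Definition _ T (X : set T) B :=
  gen_choiceMixin (@generated_space T X B).
HB.instance Definition _ T (X : set T) B :=
  @isSubBaseTopological.Build (@generated_space T X B)
    (set T) B (fun A => [set t | A (sval t)]).

(* If the traces on [X] of the members of [F] are the closed sets of a topology
   on [X], as is the case in all uses below, then this is that topology. *)
Definition closed_space T (X : set T) (F : set (set T)) :=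
  @generated_space T X [set ~` A | A in F].

Definition directed I (le : I -> I -> Prop) :=
  [/\ exists i : I, True, forall i, le i i,
      forall i j k, le i j -> le j k -> le i k &
      forall i j, exists k, le i k /\ le j k].

Definition net_lim (X : topologicalType) I (le : I -> I -> Prop)
    (f : I -> X) (l : X) :=
  forall U, nbhs l U -> exists i, forall j, le i j -> U (f j).

Definition topological_group (G : topologicalType)
    (mul : G -> G -> G) (one : G) (inv : G -> G) :=
  [/\ associative mul, left_id one mul, left_inverse one inv mul,
      continuous (fun xy : G * G => mul xy.1 xy.2) & continuous inv].

Definition subgroup G (mul : G -> G -> G) (one : G) (inv : G -> G) (A : set G) :=
  [/\ A one, forall x y, A x -> A y -> A (mul x y) & forall x, A x -> A (inv x)].

Definition left_coset G (mul : G -> G -> G) (A : set G) (x : G) : set G :=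
  [set mul x y | y in A].

Definition dense_in (G : topologicalType) (A B : set G) :=
  A `<=` B /\ B `<=` closure A.

(** * The Ellis semigroup of the action of [Aut(C)] on [S_cbar(C)] *)

Section Ellis.
Variables (L : language) (C C' : structure L) (j : smap C C').

(* The tuple enumerating [C] is indexed by the elements of [C] themselves. *)
Definition csort : {s : lsort L & C s} -> lsort L := @tag _ _.
Definition cbar : tup C csort := fun i => tagged i.
Definition jcbar : tup C' csort := tmap j cbar.

(* Formulas over [C] in variables [x]: the second summand of the context names
   the elements of [C]. *)
Definition formulaC I (x : I -> lsort L) := formula (scat x csort).

Definition satC I (x : I -> lsort L) (phi : formulaC x) (a : tup C' x) :=
  sat phi (tcat a jcbar).

Definition tpC I (x : I -> lsort L) (a : tup C' x) : set (formulaC x) :=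
  [set phi | satC phi a].

Definition Sc_set : set (set (formulaC csort)) :=
  [set tpC a | a in [set a : tup C' csort | same_type a jcbar]].

Definition Sc := generated_space Sc_set
  [set [set p : set (formulaC csort) | p phi] | phi in [set: formulaC csort]].

Lemma tp_cbar_subproof : Sc_set (tpC jcbar).
Proof. by exists jcbar. Qed.

Definition tp_cbar : Sc := exist _ (tpC jcbar) tp_cbar_subproof.

(* [phi(x, m)] becomes [phi(x, g m)]. *)
Definition move I (x : I -> lsort L) (g : smap C C) : formulaC x -> formulaC x :=
  fsubst (fun k => match k return term (scat x csort) (scat x csort k) with
    | inl i => tvar (scat x csort) (inl i)
    | inr m => tvar (scat x csort) (inr (existT _ (tag m) (g _ (tagged m))))
    end).

Definition ScSc : topologicalType := {ptws Sc -> Sc}.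

(* [Aut(C)] as a set of maps [Sc -> Sc]. *)
Definition AutEL : set ScSc :=
  [set F | exists2 g, Aut C g & forall p : Sc, sval (F p) = @move _ _ g @` sval p].

Definition EL : set ScSc := closure AutEL.

Definition ecomp (x y : ScSc) : ScSc := fun p => x (y p).

Definition left_ideal (A : set ScSc) :=
  [/\ A `<=` EL, A !=set0 & forall x y, EL x -> A y -> A (ecomp x y)].

Definition minimal_left_ideal (A : set ScSc) :=
  left_ideal A /\ forall B, left_ideal B -> B `<=` A -> B = A.

Definition circ (p : ScSc) (A : set ScSc) : set ScSc :=
  [set eta | EL eta /\
     exists (I : Type) (le : I -> I -> Prop) (a g : I -> ScSc),
       [/\ directed le, forall i, A (a i), forall i, AutEL (g i),
           net_lim le g p & net_lim le (fun i => ecomp (g i) (a i)) eta]].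

Section TauTopology.
Variables (MM : set ScSc) (u : ScSc).

Definition uM : set ScSc := [set ecomp u y | y in MM].

Definition cl_tau (A : set ScSc) : set ScSc := circ u A `&` uM.

Definition tau_closed (A : set ScSc) := A `<=` uM /\ cl_tau A = A.

Definition tau_nbhs (V : set ScSc) :=
  V `<=` uM /\ exists O, [/\ O `<=` V, O u & tau_closed (uM `\` O)].

Definition HuM : set ScSc := \bigcap_(V in tau_nbhs) cl_tau V.

Definition ecoset (x : ScSc) : set ScSc := [set ecomp x y | y in HuM].

(* [uM / H(uM)] with the quotient of the tau-topology *)
Definition uMH : topologicalType :=
  closed_space [set ecoset x | x in uM]
    [set F | tau_closed [set x | uM x /\ F (ecoset x)]].

End TauTopology.

(* In the next three definitions a function on (or into) a set of classes is
   given on a class as the union of the values obtained from its members; all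
   these values are equal when the function is well defined. *)

Definition fhat K' (x : ScSc) : set (smap C' C') :=
  \bigcup_(g in [set g | Aut C' g /\
                   forall phi, sval (x tp_cbar) phi -> satC phi (tmap g jcbar)])
    galcoset K' g.

Definition fbar K' MM u (X : uMH MM u) : set (smap C' C') :=
  \bigcup_(x in sval X) fhat K' x.

Definition gE J (y : J -> lsort L) (E : tup C' y -> set (tup C' y))
    (alpha : tup C' y) (G : set (smap C' C')) : set (tup C' y) :=
  \bigcup_(g in G) E (tmap g alpha).

Definition hbar K' MM u J (y : J -> lsort L) (E : tup C' y -> set (tup C' y))
    (alpha : tup C' y) (X : uMH MM u) : set (tup C' y) :=
  gE E alpha (fbar K' X).

Definition ker_hbar K' MM u J (y : J -> lsort L) (E : tup C' y -> set (tup C' y))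
    (alpha : tup C' y) : set (uMH MM u) :=
  [set X | hbar K' E alpha X = E alpha].

End Ellis.

(** * Bounded invariant equivalence relations and the logic topology *)

Section Relations.
Variables (L : language) (K : Type) (M : structure L).
Variables (J : Type) (y : J -> lsort L).

(* A relation on a subset [D] of a product of sorts is given by the map [E]
   that sends [a] to the set of all [b] related to it, so that [E a] is the
   class of [a] and [E @` D] is the set of classes. *)
Definition invariant_equivalence (D : set (tup M y))
    (E : tup M y -> set (tup M y)) :=
  [/\ forall a b, E a b -> D a /\ D b,
      [/\ forall a, D a -> E a a, forall a b, E a b -> E b a &
          forall a b c, E a b -> E b c -> E a c],
      forall g a, Aut M g -> D a -> D (tmap g a) &
      forall g a b, Aut M g -> E a b -> E (tmap g a) (tmap g b)].

Definition bounded (D : set (tup M y)) (E : tup M y -> set (tup M y)) :=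
  small K (E @` D).

Definition type_definable (X : set (tup M y)) :=
  exists (I : Type) (x : I -> lsort L) (m : tup M x) (p : set (formula (scat y x))),
    small K [set: I] /\ X = [set b | forall phi, p phi -> sat phi (tcat b m)].

(* [[alpha]_equiv / E] with the logic topology *)
Definition logic_space (E : tup M y -> set (tup M y)) (alpha : tup M y) :
    topologicalType :=
  closed_space [set E b | b in same_type alpha]
    [set F | type_definable [set b | same_type alpha b /\ F (E b)]].

End Relations.

(* Main.v *)
(**
The group [uM/H(uM)] is compact, Hausdorff and topological for this reason: being in [cl_tau A] is a closure condition on graphs of right translations of the
minimal ideal, so translations and inversion are continuous for the tau-topology,
and joint continuity modulo [H(uM)] follows from Ellis' theorem for compact
Hausdorff semitopological groups.

Any two automorphisms of the big model taking [C] to realizations of [x(tp(C/C))]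
act in the same way on [E]-classes, which gives a multiplicative map; it kills
[H(uM)] by compactness, and a limit argument shows that the orbit map [h] is
continuous, hence [h[cl(ker)]] is contained in [cl(alpha/E)].

For the converse one needs [h[cl(ker)]] to be closed, which reduces to the set
[{m in M : u m in A}] being closed, where [A] is the preimage of [cl(ker)] in [uM].
For a closed neighborhood [V] of the identity, the sets [{m in M : u m in b V A}]
are countable unions of closed sets (over the Lascar distance), and finitely many of
them cover [M]. By Baire's theorem one of them has interior in [M], and minimality
of [M] moves this interior to any point: near every [m0] all the products [u m] lie
in a single set [c V A]. If [m0] is a limit of points with [u m] in [A], it follows
that [u m0] is in [A V^-1 V A] for all [V], hence in [A].
*)

Require Import Defs.
From HB Require Import structures.
From mathcomp Require Import all_boot all_order finmap.
From mathcomp Require Import mathcomp_extra boolp classical_sets functions.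
From mathcomp Require Import cardinality topology wochoice.

Set Implicit Arguments.
Unset Strict Implicit.
Unset Printing Implicit Defensive.

Local Open Scope classical_set_scope.
Local Open Scope card_scope.

(** * Cardinalities *)

(** The class of [m] is not a continuous function on the ideal: [E] need not be type-definable, and
    left multiplication by [u] need not be continuous in the product topology. What survives is that
    [u], being idempotent, has trivial Lascar class, so [u m] and [m] are Lascar equivalent. Passing
    from [m] to [u m] costs finitely many [Theta]-steps, and for a fixed number of steps the
    condition is closed by compactness; hence the countable unions. Baire's theorem is applied to
    the ideal, which is compact in the product topology, while the group [uM] need not be closed
    there. The subgroup [A] contains everything Lascar equivalent to [u], which makes the sets
    [b V A] invariant under that equivalence. Defining formulas of type-definable conditions are not
    written out: a partial type is taken to be the set of all formulas implied by the situation, and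
    saturation of the big model recovers the situation from it. *)

Lemma card_le_injP A B :
  ([set: A] #<= [set: B]) <-> exists f : A -> B, injective f.
Proof.
split=> [/card_leP[f]|[f fI]].
  exists (fun x => val (f (to_setT x))) => x y /val_inj /(@inj _ _ _ f).
  by rewrite !in_setT => /(_ isT isT) /(congr1 val).
have [g] : $|{injfun [set: A] >-> [set: B]}|.
  by apply/injfunPex; exists f => // x y _ _; exact: fI.
exact: inj_card_le g.
Qed.

(** Zorn's lemma for partial bijections, coded as sets of pairs. A maximal one exhausts [A] or [B],
    since otherwise a pair of two missing points could be added. *)
Lemma card_le_total A B : ([set: A] #<= [set: B]) \/ ([set: B] #<= [set: A]).
Proof.
pose P (R : set (A * B)) :=
  forall p q, R p -> R q -> (p.1 = q.1 <-> p.2 = q.2).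
have [F FP Ftot|R [RP Rmax]] := @Zorn_bigcup _ P.
  move=> p q [X FX Xp] [Y FY Yq].
  have [XY|YX] := Ftot _ _ FX FY; first exact: (FP _ FY _ _ (XY _ Xp) Yq).
  exact: (FP _ FX _ _ Xp (YX _ Yq)).
have [tot|/existsNP[a aN]] := pselect (forall a, exists b, R (a, b)).
  left; apply/card_le_injP; have /choice[f fR] := tot; exists f => x y fxy.
  exact: (RP _ _ (fR x) (fR y)).2.
have [tot|/existsNP[b bN]] := pselect (forall b, exists a, R (a, b)).
  right; apply/card_le_injP; have /choice[f fR] := tot; exists f => x y fxy.
  exact: (RP _ _ (fR x) (fR y)).1.
exfalso; apply: (aN); exists b; apply: contrapT => nR.
apply: (Rmax (R `|` [set (a, b)])).
  split=> [|/(_ (a, b) (or_intror erefl))//]; exact: subsetUl.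
have Na p : R p -> p.1 = a <-> p.2 = b.
  case: p => x y /= Rxy; split=> e.
    by exfalso; apply: aN; exists y; rewrite -e.
  by exfalso; apply: bN; exists x; rewrite -e.
move=> p q [Rp|->] [Rq|->] //=; first exact: RP; first exact: Na.
by have [h1 h2] := Na _ Rq; split=> e; apply/esym; [apply: h1|apply: h2].
Qed.

Lemma card_set_sig T (X : set T) : [set: {x | X x}] #= X.
Proof.
have rX : range (@sval T X) = X.
  by apply/seteqP; split=> [_ [[x Xx] _ <-]//|x Xx]; exists (exist _ x Xx).
have := @inj_card_eq _ _ [set: {x | X x}] (@sval T X).
rewrite rX card_eq_sym; apply=> -[x Xx] [y Yy] _ _ /= xy.
by subst y; congr exist; exact: Prop_irrelevance.
Qed.

Section Small.
Variable K : Type.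

Lemma small_inj A B (f : A -> B) :
  injective f -> small K [set: B] -> small K [set: A].
Proof.
move=> fI [BK KB]; have AB : [set: A] #<= [set: B] by apply/card_le_injP; exists f.
split; first exact: card_le_trans AB BK.
by move=> KA; apply: KB; exact: card_le_trans KA AB.
Qed.

Lemma small_set_type T (X : set T) :
  small K X -> small K [set: {x | X x}].
Proof.
move=> [XK KX].
have e := card_set_sig X.
by split; [rewrite (card_le_eql e)|rewrite (card_le_eqr e)].
Qed.

Hypothesis K_lim : strong_limit K.

Lemma small_finite A : finite_set [set: A] -> small K [set: A].
Proof.
move=> Afin; have [[NK KN] _] := K_lim.
have AN : [set: A] #<= [set: nat].
  by have := finite_set_countable Afin; rewrite /countable.
split; first exact: card_le_trans AN NK.
by move=> KA; apply: KN; exact: card_le_trans KA AN.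
Qed.

Lemma small_powerset A : small K [set: A] -> small K [set: set A].
Proof. by have [_] := K_lim; apply. Qed.

Lemma small_sum A B :
  small K [set: A] -> small K [set: B] -> small K [set: A + B].
Proof.
wlog [f fI] : A B / exists f : A -> B, injective f.
  move=> wlg sA sB; have [/card_le_injP|/card_le_injP] := card_le_total A B.
    by move=> AB; exact: wlg.
  move=> BA; apply: (@small_inj _ (B + A) (fun c => match c with inl a => inr a | inr b => inl b end)).
    by move=> [x|x] [y|y] // [->].
  exact: wlg.
move=> _ sB.
(* The extra member [set0] marks the right summand; a strong limit allows both power sets. *)
apply: (@small_inj _ (set (set B))
  (fun c => match c with inl a => [set [set f a]] | inr b => [set [set b]; set0] end)).
  have N0 (b : B) : [set b] <> set0.
    by move=> e; have : [set b] b by []; rewrite e.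
  have S1 (a b : B) : [set a] = [set b] -> a = b.
    by move=> e; have : [set a] a by []; rewrite e.
  move=> [x|x] [y|y] /= e.
  - by have : [set [set f x]] [set f x] by []; rewrite e => /S1/fI->.
  - have h : ([set [set y]; set0] : set (set B)) set0 by right.
    by move: h; rewrite -e => /esym/N0.
  - have h : ([set [set x]; set0] : set (set B)) set0 by right.
    by move: h; rewrite e => /esym/N0.
  - have h : ([set [set x]; set0] : set (set B)) [set x] by left.
    by move: h; rewrite e => -[/S1->|/N0].
by do 2!apply: small_powerset.
Qed.

(** The tags of the disjoint sum let an unordered pair determine both coordinates. *)
Lemma small_prod A B :
  small K [set: A] -> small K [set: B] -> small K [set: A * B].
Proof.
move=> sA sB; apply: (@small_inj _ (set (A + B)) (fun p => [set inl p.1; inr p.2])).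
  move=> [a b] [a' b'] /= e; congr pair.
    have : [set inl a; inr b] (inl a : A + B) by left.
    by rewrite e => -[] // [].
  have : [set inl a; inr b] (inr b : A + B) by right.
  by rewrite e => -[] // [].
by apply: small_powerset; exact: small_sum.
Qed.

End Small.

(** * Formulas *)

Section Substitution.
Variable L : language.

Lemma tsubst_comp I J J' (x : I -> lsort L) (y : J -> lsort L) (z : J' -> lsort L)
    (h : forall i, term y (x i)) (g : forall j, term z (y j)) s (t : term x s) :
  tsubst g (tsubst h t) = tsubst (fun i => tsubst g (h i)) t.
Proof.
elim: t => //= f a IH; congr tapp.
by apply: functional_extensionality_dep => k; rewrite IH.
Qed.

Lemma tsubst_id I (x : I -> lsort L) s (t : term x s) : tsubst (tvar x) t = t.
Proof.
elim: t => //= f a IH; congr tapp.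
by apply: functional_extensionality_dep => k; rewrite IH.
Qed.

Lemma up_comp I J J' (x : I -> lsort L) (y : J -> lsort L) (z : J' -> lsort L)
    (h : forall i, term y (x i)) (g : forall j, term z (y j)) s :
  up (fun i => tsubst g (h i)) s = fun o => tsubst (up g s) (up h s o).
Proof.
apply: functional_extensionality_dep => -[i|] //=.
by rewrite !tsubst_comp.
Qed.

Lemma fsubst_comp I J J' (x : I -> lsort L) (y : J -> lsort L) (z : J' -> lsort L)
    (h : forall i, term y (x i)) (g : forall j, term z (y j)) (phi : formula x) :
  fsubst g (fsubst h phi) = fsubst (fun i => tsubst g (h i)) phi.
Proof.
elim: phi J J' y z h g => {x}I x //=.
- by move=> s t1 t2 J J' y z h g; rewrite !tsubst_comp.
- move=> r a J J' y z h g; congr fRel.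
  by apply: functional_extensionality_dep => k; rewrite tsubst_comp.
- by move=> p IHp q IHq J J' y z h g; rewrite IHp IHq.
- by move=> s p IHp J J' y z h g; rewrite IHp up_comp.
Qed.

Lemma fsubst_id I (x : I -> lsort L) (phi : formula x) : fsubst (tvar x) phi = phi.
Proof.
elim: phi => {x}I x //=.
- by move=> s t1 t2; rewrite !tsubst_id.
- move=> r a; congr fRel.
  by apply: functional_extensionality_dep => k; rewrite tsubst_id.
- by move=> p IHp q IHq; rewrite IHp IHq.
- move=> s p IHp; congr fAll; rewrite -[RHS]IHp; congr fsubst.
  by apply: functional_extensionality_dep => -[].
Qed.

Variable M : structure L.

Lemma teval_subst I J (x : I -> lsort L) (y : J -> lsort L)
    (h : forall i, term y (x i)) (v : tup M y) s (t : term x s) :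
  teval v (tsubst h t) = teval (fun i => teval v (h i)) t.
Proof.
elim: t => //= f a IH; congr fint.
by apply: functional_extensionality_dep => k; rewrite IH.
Qed.

Lemma sat_subst I J (x : I -> lsort L) (y : J -> lsort L)
    (h : forall i, term y (x i)) (v : tup M y) (phi : formula x) :
  sat (fsubst h phi) v <-> sat phi (fun i => teval v (h i)).
Proof.
elim: phi J y h v => {x}I x //=.
- by move=> s t1 t2 J y h v; rewrite !teval_subst.
- move=> r a J y h v.
  rewrite (_ : (fun k => _) = fun k => teval (fun i => teval v (h i)) (a k)) //.
  by apply: functional_extensionality_dep => k; rewrite teval_subst.
- by move=> p IHp q IHq J y h v; rewrite IHp IHq.
- move=> s p IHp J y h v.
  have e a : (fun o => teval (text v a) (up h s o)) = text (fun i => teval v (h i)) a.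
    by apply: functional_extensionality_dep => -[i|] //=; rewrite teval_subst.
  by split=> H a; have := H a; rewrite IHp e.
Qed.

End Substitution.

Section Connectives.
Variables (L : language) (I : Type) (x : I -> lsort L).

Definition fNot (phi : formula x) := fImp phi (fFalse x).

(** The conjunction is uniform in the structure, so it can be carried along elementary maps. *)
Lemma formula_conj (q : set (formula x)) : finite_set q ->
  exists phi : formula x, forall (M : structure L) (v : tup M x),
    sat phi v <-> forall psi, q psi -> sat psi v.
Proof.
move=> fq; have [s eq] := (@finite_seqP {classic formula x} q).1 fq.
rewrite eq {eq fq}; elim: s => [|psi s [phi phiP]]; first by exists (fNot (fFalse x)) => M v; split=> // _ psi.
exists (fNot (fImp psi (fNot phi))) => M v; split=> /= [H theta|H K].
  rewrite inE => /orP[/eqP->|ts].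
    by apply: contrapT => npsi; apply: H.
  by apply: (phiP M v).1 => //; apply: contrapT => nphi; apply: H.
apply: K; first by apply: H; rewrite inE eqxx.
by apply/phiP => theta ts; apply: H; rewrite inE ts orbT.
Qed.

End Connectives.

Section Support.
Variable L : language.

Definition restrict_ctx I (x : I -> lsort L) (S : set I) (i : {i | S i}) := x (sval i).

(** Being a substitution instance from the smaller context replaces a recursive computation of free
    variables under binders. *)
Definition term_over I (x : I -> lsort L) (S : set I) s (t : term x s) :=
  exists t' : term (restrict_ctx x (S := S)) s,
    t = tsubst (fun i => tvar x (sval i)) t'.

Definition formula_over I (x : I -> lsort L) (S : set I) (phi : formula x) :=
  exists psi : formula (restrict_ctx x (S := S)),
    phi = fsubst (fun i => tvar x (sval i)) psi.

Lemma term_over_sub I (x : I -> lsort L) (S S' : set I) s (t : term x s) :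
  S `<=` S' -> term_over S t -> term_over S' t.
Proof.
move=> SS' [t' ->].
pose h (i : {i | S i}) : term (restrict_ctx x (S := S')) (x (sval i)) :=
  tvar (restrict_ctx x (S := S')) (exist _ (sval i) (SS' _ (svalP i))).
by exists (tsubst h t'); rewrite tsubst_comp.
Qed.

Lemma formula_over_sub I (x : I -> lsort L) (S S' : set I) (phi : formula x) :
  S `<=` S' -> formula_over S phi -> formula_over S' phi.
Proof.
move=> SS' [psi ->].
pose h (i : {i | S i}) : term (restrict_ctx x (S := S')) (x (sval i)) :=
  tvar (restrict_ctx x (S := S')) (exist _ (sval i) (SS' _ (svalP i))).
by exists (fsubst h psi); rewrite fsubst_comp.
Qed.

Lemma term_support I (x : I -> lsort L) s (t : term x s) :
  exists S, finite_set S /\ term_over S t.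
Proof.
elim: t => [i|f a IH].
  exists [set i]; split; first exact: finite_set1.
  by exists (tvar (restrict_ctx x (S := [set i])) (exist _ i erefl)).
have [S SP] := choice IH.
have Sk k : term_over (\bigcup_k S k) (a k).
  by apply: term_over_sub (SP k).2; exact: bigcup_sup.
have Sk' k := cid (Sk k).
exists (\bigcup_k S k); split.
  by apply: bigcup_finite => [|k _]; [exact: finite_finset|exact: (SP k).1].
exists (tapp (fun k => sval (Sk' k))) => /=; congr tapp.
by apply: functional_extensionality_dep => k; exact: (svalP (Sk' k)).
Qed.

Lemma finite_preimage_some T (S : set (option T)) :
  finite_set S -> finite_set [set i | S (Some i)].
Proof.
move=> Sfin; have h : some @` [set i | S (Some i)] `<=` S by move=> _ [i Si <-].
by have := sub_finite_set h Sfin; rewrite (eq_finite_set card_some).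
Qed.

Lemma formula_support I (x : I -> lsort L) (phi : formula x) :
  exists S, finite_set S /\ formula_over S phi.
Proof.
elim: phi => {x}I x.
- exists set0; split; first exact: finite_set0.
  by exists (fFalse _).
- move=> s t1 t2; have [S1 [fS1 h1]] := term_support t1.
  have [S2 [fS2 h2]] := term_support t2.
  exists (S1 `|` S2); split; first by rewrite finite_setU.
  have [t1' ->] := term_over_sub (@subsetUl _ S1 S2) h1.
  have [t2' ->] := term_over_sub (@subsetUr _ S1 S2) h2.
  by exists (fEq t1' t2').
- move=> r a; have [S SP] := choice (fun k => term_support (a k)).
  have Sk k : term_over (\bigcup_k S k) (a k).
    by apply: term_over_sub (SP k).2; exact: bigcup_sup.
  have Sk' k := cid (Sk k).
  exists (\bigcup_k S k); split.
    by apply: bigcup_finite => [|k _]; [exact: finite_finset|exact: (SP k).1].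
  exists (fRel (fun k => sval (Sk' k))) => /=; congr fRel.
  by apply: functional_extensionality_dep => k; exact: (svalP (Sk' k)).
- move=> p [S1 [fS1 h1]] q [S2 [fS2 h2]].
  exists (S1 `|` S2); split; first by rewrite finite_setU.
  have [p' ->] := formula_over_sub (@subsetUl _ S1 S2) h1.
  have [q' ->] := formula_over_sub (@subsetUr _ S1 S2) h2.
  by exists (fImp p' q').
- move=> s p [S [fS [psi ->]]].
  pose S' := [set i | S (Some i)].
  exists S'; split; first exact: finite_preimage_some.
  pose y := restrict_ctx x (S := S').
  pose h (o : {o | S o}) : term (ext y s) (ext x s (sval o)) :=
    match o return term (ext y s) (ext x s (sval o)) with
    | exist (Some i) Si => tvar (ext y s) (Some (exist S' i Si))
    | exist None _ => tvar (ext y s) None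
    end.
  exists (fAll (fsubst h psi)) => /=; congr fAll; rewrite fsubst_comp.
  by congr fsubst; apply: functional_extensionality_dep => -[[i|] Si].
Qed.

Lemma sat_support I (x : I -> lsort L) (phi : formula x) :
  exists S, finite_set S /\ forall (M : structure L) (v w : tup M x),
    (forall i, S i -> v i = w i) -> sat phi v <-> sat phi w.
Proof.
have [S [fS [psi ->]]] := formula_support phi; exists S; split=> // M v w vw.
rewrite !sat_subst /= (_ : (fun i => v (sval i)) = fun i => w (sval i)) //.
by apply: functional_extensionality_dep => -[i Si] /=; exact: vw.
Qed.

Definition upd M I (x : I -> lsort L) (v : tup M x) (i : I) (a : M (x i)) : tup M x :=
  fun k => match pselect (i = k) with
           | left e => match e in _ = k return M (x k) with erefl => a end
           | right _ => v k
           end.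

Arguments upd {M I x} v i a.

Lemma upd_eq M I (x : I -> lsort L) (v : tup M x) i (a : M (x i)) : upd v i a i = a.
Proof.
rewrite /upd; case: pselect => // e; by rewrite (Prop_irrelevance e erefl).
Qed.

Lemma upd_neq M I (x : I -> lsort L) (v : tup M x) i (a : M (x i)) k :
  i <> k -> upd v i a k = v k.
Proof. by move=> ik; rewrite /upd; case: pselect. Qed.

Definition upd_subst I (x : I -> lsort L) (i k : I) : term (ext x (x i)) (x k) :=
  match pselect (i = k) with
  | left e => match e in _ = k return term (ext x (x i)) (x k) with
              | erefl => tvar (ext x (x i)) None end
  | right _ => tvar (ext x (x i)) (Some k)
  end.

Lemma sat_upd M I (x : I -> lsort L) (v : tup M x) i (a : M (x i)) (phi : formula x) :
  sat (fsubst (upd_subst x i) phi) (text v a) <-> sat phi (upd v i a).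
Proof.
rewrite sat_subst (_ : (fun k => _) = upd v i a) //.
apply: functional_extensionality_dep => k; rewrite /upd_subst /upd.
by case: pselect => // e; case: _ / e.
Qed.

Lemma formula_ex1 I (x : I -> lsort L) (phi : formula x) (i : I) :
  exists phi', forall M (v : tup M x),
    sat phi' v <-> exists a, sat phi (upd v i a).
Proof.
exists (fNot (fAll (fNot (fsubst (upd_subst x i) phi)))) => M v /=; split.
  move=> H; apply: contrapT => nE; apply: H => a /sat_upd pa.
  by apply: nE; exists a.
by move=> [a pa] H; apply: (H a); apply/sat_upd.
Qed.

(** [B] may be infinite, but [phi] depends on finitely many coordinates, so finitely many
    quantifiers suffice. *)
Lemma formula_ex I (x : I -> lsort L) (phi : formula x) (B : set I) :
  exists phi', forall M (v : tup M x),
    sat phi' v <-> exists w : tup M x, (forall i, ~ B i -> w i = v i) /\ sat phi w.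
Proof.
have [S [fS HS]] := sat_support phi.
have [s sP] : exists s : seq {classic I}, forall i, S i /\ B i <-> i \in s.
  have /finite_seqP[s es] : @finite_set {classic I} (S `&` B).
    exact: finite_setIl.
  exists s => i; have -> : (S i /\ B i) = (S `&` B) i by [].
  by rewrite es.
have [phi' phi'P] : exists phi' : formula x, forall M (v : tup M x),
    sat phi' v <->
    exists w : tup M x, (forall i : {classic I}, i \notin s -> w i = v i) /\ sat phi w.
  elim: s {sP} => [|i s [psi psiP]].
    exists phi => M v; split=> [pv|[w [wv]]]; first by exists v.
    by have -> : w = v by apply: functional_extensionality_dep => i; apply: wv.
  have [phi' phi'P] := formula_ex1 psi i.
  exists phi' => M v; rewrite phi'P; split.
    move=> [a /psiP[w [wv pw]]]; exists w; split=> // k.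
    rewrite inE negb_or => /andP[/eqP ki ks]; rewrite wv // upd_neq // => e.
    exact: ki.
  move=> [w [wv pw]]; exists (w i); apply/psiP; exists w; split=> // k ks.
  have [e|ik] := pselect (i = k); first by subst k; rewrite upd_eq.
  by rewrite upd_neq // wv // inE negb_or ks andbT; apply/eqP => e; exact: ik.
exists phi' => M v; rewrite phi'P; split=> -[w [wv pw]].
  exists w; split=> // i nBi; apply: wv.
  by apply/negP => /(sP i).2[].
(* Outside the support the witness is reset to [v], so that only quantified variables change. *)
pose w' : tup M x := fun i => if pselect (S i /\ B i) then w i else v i.
exists w'; split.
  move=> i is_; rewrite /w'; case: pselect => // h.
  by have := (sP i).1 h; rewrite (negbTE is_).
apply/(HS M w w') => // i Si; rewrite /w'.
by case: pselect => // nSB; apply: wv => Bi; apply: nSB.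
Qed.

End Support.

Lemma smap_ext (L : language) (M N : structure L) (g h : smap M N) :
  (forall s a, g s a = h s a) -> g = h.
Proof.
move=> gh; apply: functional_extensionality_dep => s.
by apply: functional_extensionality_dep => a.
Qed.

Lemma existT_pair2 I (P : I -> Type) (i : I) (a b : P i) :
  existT P i a = existT P i b -> a = b.
Proof. exact: (@existT_inj2 {classic I} P). Qed.

Lemma tup_ext (L : language) (M : structure L) I (x : I -> lsort L) (v w : tup M x) :
  (forall i, v i = w i) -> v = w.
Proof. exact: functional_extensionality_dep. Qed.

Lemma tmap_tcat (L : language) (M N : structure L) (g : smap M N) I J
    (x : I -> lsort L) (y : J -> lsort L) (v : tup M x) (w : tup M y) :
  tmap g (tcat v w) = tcat (tmap g v) (tmap g w).
Proof. by apply: tup_ext => -[]. Qed.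

Lemma tcat_inj (L : language) (M : structure L) I J (x : I -> lsort L)
    (y : J -> lsort L) (v v' : tup M x) (w w' : tup M y) :
  tcat v w = tcat v' w' -> v = v' /\ w = w'.
Proof.
move=> e; split; apply: tup_ext => i.
  exact: (congr1 (fun t : tup M (scat x y) => t (inl i)) e).
exact: (congr1 (fun t : tup M (scat x y) => t (inr i)) e).
Qed.

Section Automorphisms.
Variables (L : language) (M : structure L).
Implicit Types g h : smap M M.

Lemma Aut_teval g : Aut M g -> forall I (x : I -> lsort L) (v : tup M x) s (t : term x s),
  g _ (teval v t) = teval (tmap g v) t.
Proof.
move=> [_ gf _] I x v s t; elim: t => //= f a IH; rewrite gf; congr fint.
by apply: functional_extensionality_dep => k; rewrite IH.
Qed.

Lemma Aut_inv g : Aut M g ->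
  exists h, [/\ Aut M h, scomp g h = @sid L M & scomp h g = @sid L M].
Proof.
move=> [gb gf gr].
have gb' s : exists k, cancel (g s) k /\ cancel k (g s) by have [k] := gb s; exists k.
pose h s := sval (cid (gb' s)).
have hK s : cancel (g s) (h s) /\ cancel (h s) (g s).
  by rewrite /h; case: cid => k [].
exists h; split.
- split=> [s|f a|r a].
  + by exists (g s); [exact: (hK s).2|exact: (hK s).1].
  + apply: (can_inj (hK _).1); rewrite (hK _).2 gf; congr fint.
    by apply: functional_extensionality_dep => k; rewrite (hK _).2.
  + rewrite [X in _ <-> X]gr (_ : (fun k => g _ _) = a) //.
    by apply: functional_extensionality_dep => k; rewrite (hK _).2.
- by apply: smap_ext => s a; rewrite /scomp (hK _).2.
- by apply: smap_ext => s a; rewrite /scomp (hK _).1.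
Qed.

Lemma Aut_id : Aut M (@sid L M).
Proof. by split=> // s; exists id. Qed.

Lemma Aut_comp g h : Aut M g -> Aut M h -> Aut M (scomp g h).
Proof.
move=> [gb gf gr] [hb hf hr]; split=> [s|f a|r a].
- by apply: (@bij_comp _ _ _ (g s) (h s)).
- by rewrite /scomp hf gf.
- by rewrite hr gr.
Qed.

Lemma Aut_surj g : Aut M g -> forall s (a : M s), exists b, g s b = a.
Proof. by move=> [gb _ _] s a; have [h _ hK] := gb s; exists (h a). Qed.

Lemma Aut_inj g : Aut M g -> forall s, injective (g s).
Proof. by move=> [gb _ _] s; apply: bij_inj. Qed.

Lemma Aut_elementary g : Aut M g -> elementary g.
Proof.
move=> gA I x phi; have [_ _ gr] := gA; elim: phi => {x}I x //=.
- move=> s t1 t2 v; rewrite -!(Aut_teval gA); split=> [->//|]; exact: Aut_inj.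
- move=> r a v; rewrite gr (_ : (fun k => _) = fun k => teval (tmap g v) (a k)) //.
  by apply: functional_extensionality_dep => k; rewrite (Aut_teval gA).
- by move=> p IHp q IHq v; rewrite IHp IHq.
- move=> s p IHp v.
  have e a : tmap g (text v a) = text (tmap g v) (g _ a).
    by apply: functional_extensionality_dep => -[].
  split=> H a; last by rewrite IHp e.
  by have [b <-] := Aut_surj gA a; rewrite -e -IHp.
Qed.

End Automorphisms.

(** The Tarski-Vaught property for infinite blocks of variables. It is the source of finite
    satisfiability in a small model and in [C]. *)
Lemma elementary_ex (L : language) (M N : structure L) (h : smap M N) :
  elementary h -> forall I (x : I -> lsort L) (phi : formula x) (B : set I)
    (v : tup M x) (w : tup N x),
  (forall i, ~ B i -> w i = h _ (v i)) -> sat phi w ->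
  exists v' : tup M x, (forall i, ~ B i -> v' i = v i) /\ sat phi v'.
Proof.
move=> hE I x phi B v w wv pw; have [psi psiP] := formula_ex phi B.
by apply/psiP/hE/psiP; exists w.
Qed.

(** * Realizing types in small tuples of variables *)

Section Realize.
Variables (L : language) (K : Type) (M : structure L) (M_sat : saturated K M).
Variables (I : Type) (x : I -> lsort L) (I_small : small K [set: I]).

(** The members of the chain are graphs of partial functions, so their union has at most one value
    at each coordinate, and finitely many values are already present in one member. *)
Lemma chain_finite (F : set (set {i & M (x i)})) :
  total_on F subset -> F !=set0 ->
  (forall X, F X -> exists w : tup M x, forall k, X k -> w (tag k) = tagged k) ->
  forall S : set I, finite_set S ->
  exists X, F X /\ forall k, S (tag k) -> (\bigcup_(X in F) X) k -> X k.
Proof.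
move=> Ftot [X0 FX0] Ffun S fS.
have [s sS] : exists s : seq {classic I}, forall i, S i -> i \in s.
  by have [s ->] := (@finite_seqP {classic I} S).1 fS; exists s.
suff [X [FX h]] : exists X, F X /\
    forall k, (tag k : {classic I}) \in s -> (\bigcup_(X in F) X) k -> X k.
  by exists X; split=> [|k Sk Uk]; [exact: FX|exact: h k (sS _ Sk) Uk].
have big X Y : F X -> F Y -> exists Z, [/\ F Z, X `<=` Z & Y `<=` Z].
  by move=> FX FY; have [XY|YX] := Ftot _ _ FX FY; [exists Y; split|exists X; split].
elim: s {sS} => [|i s [X [FX h]]]; first by exists X0; split=> // k; rewrite in_nil.
have [[[j a] /= [ij [Y FY Yja]]]|nE] := pselect (exists k, tag k = i /\ (\bigcup_(X in F) X) k).
  have [Z [FZ XZ YZ]] := big _ _ FX FY; exists Z; split=> // k.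
  rewrite inE => /orP[/eqP ki|ks Uk]; last exact/XZ/h.
  move=> [W FW Wk]; have [V [FV WV YV]] := big _ _ FW FY.
  have [w wP] := Ffun _ FV; have wk := wP _ (WV _ Wk); have wj := wP _ (YV _ Yja).
  suff -> : k = existT _ j a by exact: YZ.
  case: k ki {Wk} wk => k b /= ki wk; rewrite -ij in ki; subst k.
  by move: wj => /= <-; rewrite -wk.
exists X; split=> // k; rewrite inE => /orP[/eqP ki Uk|]; last exact: h.
by exfalso; apply: nE; exists k.
Qed.

(** Saturation speaks of one variable. Zorn's lemma is applied to partial assignments under which
    [p] stays finitely satisfiable: a formula sees finitely many coordinates, so unions of chains
    are again such, and one-variable saturation extends a maximal one to any missing coordinate.
    Coordinates outside [B] act as parameters. *)
Lemma realize (B : set I) (v0 : tup M x) (p : set (formula x)) :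
  (forall q, finite_set q -> q `<=` p ->
    exists w : tup M x, (forall i, ~ B i -> w i = v0 i) /\ forall phi, q phi -> sat phi w) ->
  exists w : tup M x, (forall i, ~ B i -> w i = v0 i) /\ forall phi, p phi -> sat phi w.
Proof.
move=> pfin.
pose good (R : set {i & M (x i)}) (w : tup M x) :=
  (forall i, ~ B i -> w i = v0 i) /\ forall k, R k -> w (tag k) = tagged k.
pose P (R : set {i & M (x i)}) := forall q, finite_set q -> q `<=` p ->
  exists w, good R w /\ forall phi, q phi -> sat phi w.
have funP R : P R -> exists w : tup M x, forall k, R k -> w (tag k) = tagged k.
  by move=> /(_ set0 (finite_set0 _) (@sub0set _ _)) [w [[_ wR] _]]; exists w.
have [F FP Ftot|R [RP Rmax]] := @Zorn_bigcup _ P.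
  have [->|F0] := eqVneq F set0.
    rewrite bigcup_set0 => q fq qp; have [w [wv wq]] := pfin _ fq qp.
    by exists w.
  move/set0P: F0 => F0.
  have Ffun X (FX : F X) := funP X (FP _ FX).
  have [wF wFP] : exists w : tup M x, forall k, (\bigcup_(X in F) X) k -> w (tag k) = tagged k.
    have [w0 _] : exists w0 : tup M x, True.
      by have [X FX] := F0; have [w _] := Ffun _ FX; exists w.
    have h i : exists a, forall k, (\bigcup_(X in F) X) k -> tag k = i ->
        k = existT _ i a.
      have [[[j a] /= [ij [Y FY Yja]]]|nE] :=
          pselect (exists k, tag k = i /\ (\bigcup_(X in F) X) k).
        subst j; exists a => -[j b] /= Uk ji; subst j; congr existT.
        have [X [FX hX]] := chain_finite Ftot F0 Ffun (finite_set1 i).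
        have [w wX] := Ffun _ FX.
        have /= <- := wX _ (hX (existT _ i b) erefl Uk).
        by have /= <- // := wX _ (hX (existT _ i a) erefl _); exists Y.
      by exists (w0 i) => k Uk ki; exfalso; apply: nE; exists k.
    exists (fun i => sval (cid (h i))) => k Uk.
    case: k Uk => i a Uk /=; case: cid => b /= bP.
    by rewrite (existT_pair2 (bP _ Uk erefl)).
  move=> q fq qp; have [phi phiP] := formula_conj fq.
  have [S [fS HS]] := sat_support phi.
  have [X [FX hX]] := chain_finite Ftot F0 Ffun fS.
  have [w [[wv wX] wq]] := FP _ FX _ fq qp.
  (* One member of the chain settles the finitely many coordinates seen by [phi]; the values of the
     whole union can be imposed elsewhere. *)
  pose w' : tup M x := fun i =>
    if pselect (exists a, (\bigcup_(X in F) X) (existT _ i a)) then wF i else w i.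
  exists w'; split; last first.
    apply/phiP/(HS M w w'); last exact/phiP.
    move=> i Si; rewrite /w'; case: pselect => // h; have [a Ua] := h.
    by rewrite (wFP _ Ua) (wX _ (hX (existT _ i a) Si Ua)).
  split=> [i nBi|[i a] Uk]; last first.
    rewrite /w' /=; case: pselect => [h|h]; first exact: (wFP _ Uk).
    by exfalso; apply: h; exists a.
  rewrite /w'; case: pselect => [h|h]; last exact: wv.
  have [a [Y FY Ya]] := h.
  have [w1 [[w1v w1Y] _]] := FP _ FY _ (finite_set0 _) (@sub0set _ _).
  have /= -> : wF i = a by apply: (wFP (existT _ i a)); exists Y.
  by have /= <- := w1Y _ Ya; exact: w1v.
have Rtot i : exists a, R (existT _ i a).
  apply: contrapT => nR.
  suff [a Pa] : exists a, P (R `|` [set existT _ i a]).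
    apply: (Rmax _ _ Pa); split; first exact: subsetUl.
    by move=> /(_ _ (or_intror erefl)) Ra; apply: nR; exists a.
  have [v [[vv vR] _]] := RP _ (finite_set0 _) (@sub0set _ _).
  have [Bi|nBi] := pselect (B i); last first.
    (* A frozen coordinate has the same value in all good assignments. *)
    exists (v i) => q fq qp; have [w [[wv wR] wq]] := RP _ fq qp.
    exists w; split=> //; split=> // k [/wR//|->] /=.
    by rewrite vv // wv.
  (* The admissible values at [i] form a one-variable type over [v]: each finite part of [p]
     contributes the formula saying that the undecided coordinates can be filled in. *)
  pose Ptype (theta : formula (ext x (x i))) := exists q, [/\ finite_set q, q `<=` p &
    forall b, sat theta (text v b) <->
      exists w, [/\ good R w, w i = b & forall phi, q phi -> sat phi w]].
  have [b bP] : exists b, forall phi, Ptype phi -> sat phi (text v b).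
    apply: M_sat => // Q fQ QP.
    have hq theta : exists q, Q theta -> [/\ finite_set q, q `<=` p &
      forall b, sat theta (text v b) <->
      exists w, [/\ good R w, w i = b & forall phi, q phi -> sat phi w]].
      have [Qt|nQt] := pselect (Q theta); last by exists set0 => /nQt.
      by have [q qP] := QP _ Qt; exists q.
    have [qf qfP] := choice hq.
    have [||w [wR wq]] := RP (\bigcup_(theta in Q) qf theta).
    - by apply: bigcup_finite => // theta /qfP[].
    - by move=> phi [theta /qfP[_ qp _] /qp].
    exists (w i) => theta Qt; have [_ _ ->] := qfP _ Qt.
    by exists w; split=> // phi qphi; apply: wq; exists theta.
  exists b => q fq qp; have [phi phiP] := formula_conj fq.
  pose B' : set I := [set k | [/\ B k, i <> k & forall a, ~ R (existT _ k a)]].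
  have [psi psiP] := formula_ex phi B'.
  have psiE c : sat (fsubst (upd_subst x i) psi) (text v c) <->
      exists w, [/\ good R w, w i = c & forall phi, q phi -> sat phi w].
    rewrite sat_upd psiP; split=> -[w].
      move=> [wB /phiP wq]; exists w; split=> //; last first.
        by rewrite wB ?upd_eq // => -[].
      split=> [k nBk|[k a] Rk] /=.
        rewrite wB; last by case.
        by rewrite upd_neq ?vv // => ik; subst k.
      rewrite wB; last by move=> [_ _ /(_ a)].
      rewrite upd_neq; last by move=> ik; subst k; apply: nR; exists a.
      by have /= -> := vR _ Rk.
    move=> [[wv wR] wi /phiP wq]; exists w; split=> // k nB'k.
    have [ik|ik] := pselect (i = k); first by subst k; rewrite upd_eq.
    rewrite upd_neq //; have [Bk|nBk] := pselect (B k); last by rewrite wv ?vv.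
    have [[a Ra]|nRk] := pselect (exists a, R (existT _ k a)).
      by have /= -> := wR _ Ra; have /= -> := vR _ Ra.
    by exfalso; apply: nB'k; split=> // a Ra; apply: nRk; exists a.
  have [|w [[wv wR] wi wq]] := (psiE b).1; first by apply: bP; exists q.
  exists w; split=> //; split=> // k [/wR//|->] /=; exact: wi.
pose w i := sval (cid (Rtot i)).
have wE w' : good R w' -> w' = w.
  move=> [_ w'R]; apply: functional_extensionality_dep => i.
  exact: (w'R _ (svalP (cid (Rtot i)))).
exists w; split=> [i|phi pphi].
  have [w' [w'R _]] := RP _ (finite_set0 _) (@sub0set _ _).
  by rewrite -(wE _ w'R); have [w'v _] := w'R; exact: w'v.
have [|w' [w'R w'phi]] := RP _ (finite_set1 phi); first by move=> _ ->.
by rewrite -(wE _ w'R); exact: w'phi.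
Qed.

End Realize.

(** * Bounded relations are coarser than Lascar equivalence *)

Lemma filter_forall_finite (T U : Type) (F : set_system U) (q : set T)
    (P : T -> set U) : Filter F -> finite_set q ->
  (forall t, q t -> F (P t)) -> F [set x | forall t, q t -> P t x].
Proof.
move=> FF fq; have [s eq] := (@finite_seqP {classic T} q).1 fq.
rewrite {fq}eq; elim: s => [|t s IH] h.
  by apply: filterS filterT => x _ t.
have ht : F (P t) by apply: h; rewrite /= inE eqxx.
have hs : F [set x | forall t, [set` s] t -> P t x].
  by apply: IH => t' t's; apply: h; rewrite /= inE t's orbT.
apply: filterS (filterI ht hs) => x [Ptx Psx] t' /=.
by rewrite inE => /orP[/eqP->|]; [|exact: Psx].
Qed.

(** Finite sets of indices will be sorted, which requires a boolean order; a well-ordering provides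
    one. *)
Lemma linear_order_exists (T : Type) : exists R : {classic T} -> {classic T} -> bool,
  [/\ transitive R, antisymmetric R & total R].
Proof.
have [R Rwo] := well_ordering_principle {classic T}.
have min (s : seq {classic T}) x : x \in s ->
    exists2 m, m \in s & forall z, z \in s -> R m z.
  by move=> xs; have [|m [[ms mP] _]] := Rwo [mem s]; [exists x|exists m].
have Rtot : total R.
  move=> x y; have [|m] := min [:: x; y] x; first by rewrite inE eqxx.
  rewrite !inE => /orP[/eqP->|/eqP->] h; apply/orP; [left|right];
    by apply: h; rewrite !inE eqxx ?orbT.
have Ranti : antisymmetric R.
  move=> x y /andP[xy yx]; have Rxx z : R z z by have := Rtot z z; rewrite orbb.
  have [|m [[ms mP] mU]] := Rwo [mem [:: x; y]]; first by exists x; rewrite inE eqxx.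
  transitivity m; [symmetry|]; apply: mU; split; rewrite ?inE ?eqxx ?orbT //;
    by move=> z; rewrite !inE => /orP[]/eqP->.
exists R; split=> // y x z xy yz.
have [|m] := min [:: x; y; z] x; first by rewrite inE eqxx.
rewrite !inE => /or3P[]/eqP-> h.
- by apply: h; rewrite !inE eqxx !orbT.
- have yx : R y x by apply: h; rewrite !inE eqxx.
  by rewrite (Ranti x y) ?xy ?yx.
- have zy : R z y by apply: h; rewrite !inE eqxx orbT.
  by rewrite (Ranti z y) ?zy ?yz.
Qed.

Lemma elementary_inhabited (L : language) (M N : structure L) (h : smap M N) :
  elementary h -> forall s, N s -> exists a : M s, True.
Proof.
move=> hE s b; apply: contrapT => nM.
have v : tup M (of_void (lsort L)) by case.
have := hE _ _ (fAll (s := s) (fFalse _)) v.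
by case=> /= + _; apply => // a; apply: nM; exists a.
Qed.

Section Coheir.
Variables (L : language) (K : Type) (M : structure L).
Hypotheses (K_lim : strong_limit K) (M_sat : saturated K M).
Variables (N : structure L) (e : smap N M).
Hypotheses (e_elem : elementary e) (N_small : small_model K N).
Variables (J : Type) (y : J -> lsort L) (J_small : small K [set: J]).

Definition param : tup M (@csort L N) := tmap e (@cbar L N).

Definition name_params (n : tup N y) (k : J + J) :
    term (scat y (@csort L N)) (scat y y k) :=
  match k return term (scat y (@csort L N)) (scat y y k) with
  | inl i => tvar (scat y (@csort L N)) (inl i)
  | inr i => tvar (scat y (@csort L N)) (inr (existT _ (y i) (n i)))
  end.

Lemma sat_name_params (n : tup N y) (theta : formula (scat y y)) (a : tup M y) :
  sat (fsubst (name_params n) theta) (tcat a param) <-> sat theta (tcat a (tmap e n)).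
Proof.
rewrite sat_subst (_ : (fun k => _) = tcat a (tmap e n)) //.
by apply: tup_ext => -[].
Qed.

Variables (a b : tup M y).
Hypothesis ab : same_type (tcat a param) (tcat b param).

Let F : set_system (tup N y) := filter_from
  [set phi : formula (scat y (@csort L N)) | sat phi (tcat a param)]
  (fun phi => [set n | sat phi (tcat (tmap e n) param)]).

(** Properness is the finite satisfiability of tp(a/N) in [N]: a formula over [N] true of [a] has a
    solution in the elementary submodel. *)
Let F_proper : ProperFilter F.
Proof.
apply: filter_from_proper; first apply: filter_from_filter.
- by exists (fNot (fFalse _)).
- move=> phi psi pa qa; have [chi chiP] := formula_conj (finite_set2 phi psi).
  exists chi; first by apply/chiP => _ [->|->].
  by move=> n /chiP h; split; apply: h; [left|right].
move=> phi pa.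
have Nex i : exists n : N (y i), True.
  by have [n _] := elementary_inhabited e_elem (a i); exists n.
pose v0 : tup N (scat y (@csort L N)) :=
  tcat (x := y) (fun i => sval (cid (Nex i))) (@cbar L N).
have [||v [vv pv]] := @elementary_ex _ _ _ _ e_elem _ _ phi (range inl) v0 (tcat a param).
- by move=> [i|k] // []; exists i.
- exact: pa.
exists (fun i => v (inl i)) => /=.
rewrite (_ : tcat _ _ = tmap e v); first exact/e_elem.
by apply: tup_ext => -[i //|k]; rewrite /= /tmap vv // => -[].
Qed.

(** The average type of an ultrafilter on tuples of [N] is a global coheir of tp(a/N). Over tuples
    of [N] the elements [a] and [b] cannot be distinguished. *)
Lemma coheir_type : exists (U : set_system (tup N y)),
  [/\ UltraFilter U,
    forall phi : formula y, sat phi a -> U [set n | sat phi (tmap e n)],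
    forall theta : formula (scat y y), forall n : tup N y,
      (sat theta (tcat a (tmap e n)) <-> sat theta (tcat b (tmap e n))) &
    forall theta : formula (scat y y), forall n : tup N y,
      sat theta (tcat a (tmap e n)) ->
      U [set m | sat theta (tcat (tmap e m) (tmap e n))]].
Proof.
have [U [UU FU]] := ultraFilterLemma F_proper; exists U; split=> // [phi pa|theta n|theta n].
- apply: FU; exists (fsubst (fun i => tvar (scat y (@csort L N)) (inl i)) phi) => /=.
    by apply/sat_subst.
  by move=> n /sat_subst.
- by rewrite -!sat_name_params; exact: ab.
- move=> /sat_name_params h; apply: FU; exists (fsubst (name_params n) theta) => // m.
  by move=> /sat_name_params.
Qed.

Definition var13 (k : J + J) : term (scat (scat y y) y) (scat y y k) :=
  match k return term (scat (scat y y) y) (scat y y k) with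
  | inl i => tvar (scat (scat y y) y) (inl (inl i))
  | inr i => tvar (scat (scat y y) y) (inr i)
  end.

Definition var23 (k : J + J) : term (scat (scat y y) y) (scat y y k) :=
  match k return term (scat (scat y y) y) (scat y y k) with
  | inl i => tvar (scat (scat y y) y) (inl (inr i))
  | inr i => tvar (scat (scat y y) y) (inr i)
  end.

Definition seq_ctx (W : Type) : W * J -> lsort L := fun k => y k.2.

Definition var_seq (W : Type) (v w : W) (k : J + J) : term (@seq_ctx W) (scat y y k) :=
  match k return term (@seq_ctx W) (scat y y k) with
  | inl i => tvar (@seq_ctx W) (v, i)
  | inr i => tvar (@seq_ctx W) (w, i)
  end.

Lemma sat_var13 (theta : formula (scat y y)) (a1 a2 a3 : tup M y) :
  sat (fsubst var13 theta) (tcat (tcat a1 a2) a3) <-> sat theta (tcat a1 a3).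
Proof.
rewrite sat_subst (_ : (fun k => _) = tcat a1 a3) //.
by apply: tup_ext => -[].
Qed.

Lemma sat_var23 (theta : formula (scat y y)) (a1 a2 a3 : tup M y) :
  sat (fsubst var23 theta) (tcat (tcat a1 a2) a3) <-> sat theta (tcat a2 a3).
Proof.
rewrite sat_subst (_ : (fun k => _) = tcat a2 a3) //.
by apply: tup_ext => -[].
Qed.

Lemma sat_var_seq (W : Type) (v w : W) (theta : formula (scat y y))
    (f : tup M (@seq_ctx W)) :
  sat (fsubst (var_seq v w) theta) f <->
  sat theta (tcat (fun i => f (v, i)) (fun i => f (w, i))).
Proof.
rewrite sat_subst (_ : (fun k => _) =
  tcat (x := y) (y := y) (fun i => f (v, i)) (fun i => f (w, i))) //.
by apply: tup_ext => -[].
Qed.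

(* The sequence realizes the type of pairs [q(x) * q(y)] of a coheir [q] of
   [tp(a/N)]; a finite part of it is found inside [N], last members first. *)
Lemma coheir_sequence (W : Type) : small K [set: W] ->
  exists (c : tup M y) (d : W -> tup M y) (lt : W -> W -> Prop),
    [/\ same_type a c, same_type (tcat a c) (tcat b c),
       forall v w, v <> w -> lt v w \/ lt w v &
       forall v w, lt v w -> same_type (tcat (d v) (d w)) (tcat a c)].
Proof.
move=> W_small; have [U [UU atU abU aU]] := coheir_type.
have [R [Rtr Ranti Rtot]] := linear_order_exists W.
pose r := [set theta : formula (scat y y) | U [set n | sat theta (tcat a (tmap e n))]].
have rN theta : ~ r theta -> r (fNot theta).
  move=> nr; have [h|h] := in_ultra_setVsetC [set n | sat theta (tcat a (tmap e n))] UU.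
    by case: nr.
  exact: h.
have [n0 _] : exists n0 : tup N y, True by have [n _] := filter_ex (@filterT _ U _); exists n.
(* [c] realizes the average type over [a] and [b] jointly. Since [a] and [b] satisfy the same
   formulas over each tuple of [N], [c] forms pairs of the same type with both. *)
have [c cr] : exists c, forall theta, r theta -> sat theta (tcat a c) /\ sat theta (tcat b c).
  pose p := [set phi | exists2 theta, r theta &
    phi = fsubst var13 theta \/ phi = fsubst var23 theta].
  have s3 : small K [set: J + J + J] by do 2![apply: (small_sum K_lim) => //].
  have [q fq qp|w [wv wp]] := realize M_sat s3 (B := range inr)
      (v0 := tcat (tcat a b) a) (p := p).
    have [n nq] : exists n, forall phi, q phi -> sat phi (tcat (tcat a b) (tmap e n)).
      apply: (@filter_ex _ U); apply: (filter_forall_finite (F := U)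
        (P := fun phi => [set n | sat phi (tcat (tcat a b) (tmap e n))])) => // phi /qp.
      move=> [theta rt [->|->]]; apply: filterS rt => n.
        by move=> ?; apply/sat_var13.
      by move=> ?; apply/sat_var23/abU.
    exists (tcat (tcat a b) (tmap e n)); split=> // -[//|i] [].
    by exists i.
  exists (fun i => w (inr i)) => theta rt.
  have ew : w = tcat (tcat a b) (fun i => w (inr i)).
    by apply: tup_ext => -[[i|i]|i] //=; rewrite wv //= => -[].
  split.
    by apply/(sat_var13 _ a b); rewrite -ew; apply: wp; exists theta => //; left.
  by apply/(sat_var23 _ a b); rewrite -ew; apply: wp; exists theta => //; right.
have crI theta : sat theta (tcat a c) -> r theta.
  by move=> h; apply: contrapT => /rN/cr[h' _]; exact: h'.
pose lt v w := v <> w /\ R v w.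
pose p := [set phi | exists v w theta, [/\ lt v w, r theta & phi = fsubst (var_seq v w) theta]].
have sWJ : small K [set: W * J] by exact: (small_prod K_lim).
have [q fq qp|f [_ fp]] := realize M_sat sWJ (B := setT) (v0 := fun k => a k.2) (p := p).
  have [s [Theta [fT Tr qsT]]] : exists (s : seq {classic W}) (Theta : set (formula (scat y y))),
      [/\ finite_set Theta, Theta `<=` r & forall phi, q phi ->
        exists v w theta, [/\ (v \in s) && (w \in s), lt v w, Theta theta &
          phi = fsubst (var_seq v w) theta]].
    have [l ql] := (@finite_seqP {classic _} q).1 fq.
    rewrite ql in qp *; clear q fq ql; elim: l qp => [|phi l IH] lp.
      by exists [::], set0; split; [exact: finite_set0|exact: sub0set|move=> phi].
    have [|s [Theta [fT Tr lT]]] := IH; first by move=> psi h; apply: lp; rewrite /= inE h orbT.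
    have [|v [w [theta [vw rt phiE]]]] := lp phi; first by rewrite /= inE eqxx.
    exists [:: (v : {classic W}), (w : {classic W}) & s], (theta |` Theta); split.
    - by rewrite finite_setU; split=> //; exact: finite_set1.
    - by move=> t [->//|]; exact: Tr.
    - move=> psi /=; rewrite inE => /orP[/eqP->|/lT[v' [w' [theta' [/andP[v's w's] ? ? ?]]]]].
        by exists v, w, theta; split=> //; [rewrite !inE !eqxx orbT|left].
      exists v', w', theta'; split=> //; last by right.
      by rewrite !inE v's w's !orbT.
  suff [g [_ gP]] : exists g : {classic W} -> tup N y,
      (forall w, w \in s -> forall theta, Theta theta -> sat theta (tcat a (tmap e (g w)))) /\
      (forall v w, v \in s -> w \in s -> lt v w ->
        forall theta, Theta theta -> sat theta (tcat (tmap e (g v)) (tmap e (g w)))).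
    exists (fun k => tmap e (g k.1) k.2); split=> [k []//|phi].
    move=> /qsT[v [w [theta [/andP[vs ws] vw Tt ->]]]].
    by apply/sat_var_seq; exact: gP.
  suff {qsT} key : forall l : seq {classic W}, uniq l -> pairwise R l ->
    exists g : {classic W} -> tup N y,
      (forall w, w \in l -> forall theta, Theta theta -> sat theta (tcat a (tmap e (g w)))) /\
      (forall v w, v \in l -> w \in l -> lt v w ->
        forall theta, Theta theta -> sat theta (tcat (tmap e (g v)) (tmap e (g w)))).
    have [||g [g1 g2]] := key (sort R (undup s)).
    - by rewrite sort_uniq undup_uniq.
    - rewrite -sorted_pairwise //; exact: sort_sorted.
    exists g; split=> [w ws|v w vs ws]; first by apply: g1; rewrite mem_sort mem_undup.
    by apply: g2; rewrite mem_sort mem_undup.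
  elim=> [|v l IH] /=; first by exists (fun=> n0).
  move=> /andP[vl ul] /andP[/allP vRl pl]; have [g [g1 g2]] := IH ul pl.
  have [n [na nl]] : exists n, (forall theta, Theta theta -> sat theta (tcat a (tmap e n))) /\
      forall w, w \in l -> forall theta, Theta theta ->
        sat theta (tcat (tmap e n) (tmap e (g w))).
    apply: (@filter_ex _ U); apply: filterI.
      apply: (filter_forall_finite (F := U)
        (P := fun theta => [set n | sat theta (tcat a (tmap e n))])) => //.
    apply: (filter_forall_finite (F := U) (T := {classic W}) (q := [set` l])
      (P := fun w => [set n | forall theta, Theta theta ->
        sat theta (tcat (tmap e n) (tmap e (g w)))])) => [|w wl].
      exact: finite_seq.
    apply: (filter_forall_finite (F := U)
      (P := fun theta => [set n | sat theta (tcat (tmap e n) (tmap e (g w)))])) => // theta Tt.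
    by apply: aU; apply: g1.
  exists (fun w => if w == v then n else g w); split.
    by move=> w; rewrite inE; case: eqP => //= _; exact: g1.
  move=> v1 w1; rewrite !inE; case: eqP => [->|_] /=; case: eqP => [->|_] //=.
  - by move=> _ _ [].
  - by move=> _ wl _; exact: nl.
  - move=> v1l _ [v1v Rv1v]; exfalso; apply: v1v; apply: Ranti.
    by rewrite Rv1v vRl.
  - exact: g2.
exists c, (fun w i => f (w, i)), lt; split.
- have ac phi : sat phi a -> sat phi c.
    move=> pa; have [|] := cr (fsubst (fun i => tvar (scat y y) (inr i)) phi).
      by apply: filterS (atU _ pa) => n pn; apply/sat_subst.
    by move=> /sat_subst.
  move=> phi; split; first exact: ac.
  by move=> pc; apply: contrapT => npa; have := ac (fNot phi) npa; apply.
- move=> theta; split=> [/crI/cr[]//|bt]; apply: contrapT => nat_.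
  have : r (fNot theta) by apply: crI.
  by move=> /cr[_]; apply.
- move=> v w vw; have /orP[h|h] := Rtot v w; [left|right]; split=> // e'.
  exact: vw.
- have h v w theta : lt v w -> sat theta (tcat a c) ->
      sat theta (tcat (fun i => f (v, i)) (fun i => f (w, i))).
    move=> vw /crI rt; apply/sat_var_seq; apply: fp.
    by exists v, w, theta.
  move=> v w vw theta; split; last exact: h.
  move=> ft; apply: contrapT => nt.
  by have := h v w (fNot theta) vw nt; apply.
Qed.

End Coheir.

Lemma cantor A : ~ ([set: set A] #<= [set: A]).
Proof.
move=> /card_le_injP[f fI].
pose B := [set a | exists S, f S = a /\ ~ S a].
have nB : ~ B (f B) by move=> BB; have [S [/fI SB]] := BB; rewrite SB.
by apply: (nB); exists B.
Qed.

Section BoundedEquivalence.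
Variables (L : language) (K : Type) (M : structure L).
Hypotheses (K_lim : strong_limit K) (M_sat : saturated K M).
Hypothesis M_hom : strongly_homogeneous K M.
Variables (J : Type) (y : J -> lsort L) (J_small : small K [set: J]).
Variables (D : set (tup M y)) (E : tup M y -> set (tup M y)).
Hypotheses (E_equiv : invariant_equivalence D E) (E_bounded : bounded K D E).

Lemma E_same_type2 (v w v' w' : tup M y) :
  same_type (tcat v w) (tcat v' w') -> E v w -> E v' w'.
Proof.
move=> st Evw; have [_ _ _ Einv] := E_equiv.
have [g gA] := M_hom (small_sum K_lim J_small J_small) st.
by rewrite tmap_tcat => /tcat_inj[<- <-]; exact: Einv.
Qed.

(* If [a] and [c] were inequivalent, a sequence of length [2^2^(number of classes)]
   whose pairs look like [(a, c)] would consist of pairwise inequivalent tuples. *)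
Lemma E_over_model (N : structure L) (e : smap N M) (a b : tup M y) :
  elementary e -> small_model K N ->
  same_type (tcat a (param e)) (tcat b (param e)) -> D a -> E a b.
Proof.
move=> eE sN ab Da; have [ED [Er Es Et] Dinv Einv] := E_equiv.
pose A := {X | (E @` D) X}.
(* The sequence is indexed by [set A], which by Cantor's theorem does not inject into the set [A] of
   classes. *)
have sW : small K [set: set A] by apply: (small_powerset K_lim); exact: small_set_type.
have [c [d [lt [ac abc lt_tot ltP]]]] :=
  coheir_sequence K_lim M_sat eE J_small ab sW.
have D_type v w : same_type v w -> D v -> D w.
  by move=> /(M_hom J_small)[g gA <-]; exact: Dinv.
suff Eac : E a c.
  by apply: (Et _ _ _ Eac); apply: Es; exact: (E_same_type2 abc Eac).
apply: contrapT => nE.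
have nEd v w : v <> w -> ~ E (d v) (d w).
  move=> vw Edvw; have [l|l] := lt_tot _ _ vw.
    by apply: nE; apply: (E_same_type2 (ltP _ _ l)).
  by apply: nE; apply: (E_same_type2 (ltP _ _ l)); exact: Es.
have Dd w : D (d w).
  (* Comparison with a second index, here the complement of [w], puts [d w] into a pair of the type
     of [(a, c)] and so into [D]. *)
  have [v wv] : exists v : set A, w <> v.
    exists [set t | ~ w t] => e1.
    have t : A by exists (E a); exists a.
    have : w t = (~ w t) by rewrite {1}e1.
    by case: (pselect (w t)) => h e2; move: (h); rewrite e2.
  have left_type v' w' : lt v' w' -> D (d v').
    move=> /ltP st; apply: D_type Da => phi.
    have := st (fsubst (fun i => tvar (scat y y) (inl i)) phi).
    by rewrite !sat_subst => h; split=> /h.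
  have right_type v' w' : lt v' w' -> D (d w').
    move=> /ltP st; apply: D_type (D_type _ _ ac Da) => phi.
    have := st (fsubst (fun i => tvar (scat y y) (inr i)) phi).
    by rewrite !sat_subst => h; split=> /h.
  by have [/left_type|/right_type] := lt_tot _ _ wv.
apply: (@cantor A); apply/card_le_injP.
have DX w : (E @` D) (E (d w)) by exists (d w).
exists (fun w => exist _ (E (d w)) (DX w) : A) => v w [] EE.
apply: contrapT => /nEd; apply; rewrite EE; exact: Er.
Qed.

Definition E_fixing : set (smap M M) :=
  [set g | Aut M g /\ forall a, D a -> E a (tmap g a)].

(** The automorphisms preserving every class form a subgroup, and [E_over_model] shows that it
    contains the generators. *)
Lemma AutfL_E_fixing : @AutfL L K M `<=` E_fixing.
Proof.
have [ED [Er Es Et] Dinv Einv] := E_equiv.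
move=> g gL; apply: (gL E_fixing); split; last first.
  move=> h [hA [N [e [sN eE eh]]]]; split=> // a Da.
  apply: (E_over_model eE sN) => // phi; rewrite (Aut_elementary hA).
  rewrite (_ : tmap h _ = tcat (tmap h a) (param e)) //.
  by apply: tup_ext => -[i //|k] /=; rewrite /tmap /= /param /tmap eh.
split=> [k []//| | |].
- by split; [exact: Aut_id|move=> a Da; exact: Er].
- move=> k h [kA kE] [hA hE]; split; first exact: Aut_comp.
  by move=> a Da; apply: (Et _ _ _ (hE _ Da)); apply: kE; exact: Dinv.
- move=> k h [kA kE] hA kh; split=> // a Da.
  have Dh : D (tmap h a) by exact: Dinv.
  have := kE _ Dh; rewrite (_ : tmap k _ = a); first exact: Es.
  by apply: tup_ext => i; have : scomp k h (a i) = a i by rewrite kh.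
Qed.

End BoundedEquivalence.

(** * The space of types and the Ellis semigroup *)

Lemma generated_open T (X : set T) B A : B A ->
  open ([set t | A (sval t)] : set (@generated_space T X B)).
Proof.
move=> BA; exists [set [set t : generated_space X B | A (sval t)]].
  move=> _ ->; exists [fset (A : {classic set T})]%fset.
    by move=> A' /fset1P->; rewrite inE.
  apply/seteqP; split=> t /=.
    by move=> /(_ A); apply; exact: fset11.
  by move=> At A' /fset1P->.
by rewrite bigcup_set1.
Qed.

Lemma generated_nbhs T (X : set T) B (t : @generated_space T X B) U : nbhs t U ->
  exists Q : set (set T), [/\ finite_set Q, Q `<=` B, forall A, Q A -> A (sval t) &
    forall s : @generated_space T X B, (forall A, Q A -> A (sval s)) -> U s].
Proof.
rewrite nbhsE => -[V [[D' sD' <-] [A D'A At]] VU].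
have [Q QB QA] := sD' _ D'A; exists [set` Q]; split.
- exact: finite_fset.
- by move=> A' /= /QB; rewrite inE.
- move=> A' QA'; have {}At : A t by exact: At.
  by move: At; rewrite -QA => /(_ _ QA').
- move=> s Qs; apply: VU; exists A => //; suff : A s by [].
  by rewrite -QA => A' QA'; exact: Qs.
Qed.

Lemma generated_continuous (Y : topologicalType) T (X : set T) B
    (f : Y -> @generated_space T X B) :
  (forall A, B A -> open [set y | A (sval (f y))]) -> continuous f.
Proof.
move=> fB y U /generated_nbhs[Q [fQ QB Qy QU]].
have : nbhs y [set z | forall A, Q A -> A (sval (f z))].
  apply: (filter_forall_finite (F := nbhs y) (P := fun A => [set z | A (sval (f z))])) => //.
  move=> A QA; apply: open_nbhs_nbhs; split; [exact/fB/QB|exact: Qy].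
by apply: filterS => z Qz; exact: QU.
Qed.

Lemma ptws_continuous (Y : topologicalType) (U : Type) (V : topologicalType)
    (f : Y -> {ptws U -> V}) :
  (forall u, continuous (fun y => f y u)) -> continuous f.
Proof.
move=> fc y; apply/cvg_sup => u; apply/cvg_image.
  apply/seteqP; split=> // v _; exists (fun=> v) => //.
move=> W /= Wfy; have := fc u y W Wfy => h.
exists [set g | W (g u)]; first exact: h.
by apply/seteqP; split=> [_ [g Wg <-]//|v Wv]; exists (fun=> v).
Qed.

Lemma ptws_eval_continuous (U : Type) (V : topologicalType) (u : U) :
  continuous (fun f : {ptws U -> V} => f u).
Proof. exact: (@proj_continuous {classic U} (fun=> V) u). Qed.

Lemma ptws_hausdorff (U : Type) (V : topologicalType) :
  hausdorff_space V -> hausdorff_space {ptws U -> V}.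
Proof. by move=> VH; exact: (@hausdorff_product {classic U} (fun=> V)). Qed.

Lemma ptws_compact (U : Type) (V : topologicalType) :
  compact [set: V] -> compact [set: {ptws U -> V}].
Proof.
move=> Vc; have := @tychonoff {classic U} (fun=> V) (fun=> setT) (fun=> Vc).
by congr compact; apply/seteqP; split.
Qed.

Section TypeSpace.
Variables (L : language) (C C' : structure L) (j : smap C C').
Variables (K K' : Type).
Hypotheses (C_monster : monster K C) (C'_monster : monster K' C').
Hypotheses (j_elem : elementary j) (C_small : small_model K' C).

Local Notation cs := (@csort L C).
Local Notation jc := (jcbar j).
Local Notation fC := (formulaC C cs).

Lemma csort_small : small K' [set: {s & C s}].
Proof. exact: C_small. Qed.

Lemma extend_tuple_aut J (y : J -> lsort L) (a b : tup C' y) :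
  small K' [set: J] -> same_type a b -> exists2 g, Aut C' g & tmap g a = b.
Proof. by have [_ _ _ hom] := C'_monster; exact: hom. Qed.

Lemma jcbar_aut (g : smap C C) : Aut C g -> same_type jc (tmap j (tmap g (@cbar L C))).
Proof.
move=> gA phi; rewrite /jcbar -!j_elem; exact: Aut_elementary.
Qed.

Lemma extend_aut (g : smap C C) : Aut C g ->
  exists2 g', Aut C' g' & forall s (m : C s), g' s (j m) = j (g s m).
Proof.
move=> gA; have [g' g'A g'j] := extend_tuple_aut csort_small (jcbar_aut gA).
exists g' => // s m.
exact: (congr1 (fun t : tup C' cs => t (existT _ s m)) g'j).
Qed.

Lemma Sc_rep (p : Sc j) : exists a, same_type a jc /\ sval p = tpC j a.
Proof. by have [a st <-] := svalP p; exists a. Qed.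

Lemma Sc_rep_aut (p : Sc j) : exists2 g, Aut C' g & sval p = tpC j (tmap g jc).
Proof.
have [a [st ->]] := Sc_rep p.
have st' : same_type jc a by move=> phi; split=> /st.
by have [g gA <-] := extend_tuple_aut csort_small st'; exists g.
Qed.

Definition Sc_of (a : tup C' cs) (st : same_type a jc) : Sc j :=
  exist _ (tpC j a) (ex_intro2 _ _ a st erefl).

Lemma Sc_ext (p q : Sc j) : sval p = sval q -> p = q.
Proof.
case: p q => [p Hp] [q Hq] /= e; subst q; congr exist; exact: Prop_irrelevance.
Qed.

Lemma Sc_not (p : Sc j) (phi : fC) : ~ sval p phi <-> sval p (fNot phi).
Proof. by have [a [_ ->]] := Sc_rep p; split. Qed.

Lemma Sc_conj (q : set fC) : finite_set q ->
  exists phi, forall p : Sc j, sval p phi <-> forall psi, q psi -> sval p psi.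
Proof.
move=> /formula_conj[phi phiP]; exists phi => p.
by have [a [_ ->]] := Sc_rep p; exact: phiP.
Qed.

Lemma Sc_open (phi : fC) : open [set p : Sc j | sval p phi].
Proof. by apply: (@generated_open _ _ _ [set p : set fC | p phi]); exists phi. Qed.

Lemma Sc_nbhs (p : Sc j) U : nbhs p U ->
  exists phi, sval p phi /\ forall q : Sc j, sval q phi -> U q.
Proof.
move=> /generated_nbhs[Q [fQ QB Qp QU]].
have /choice[f fP] A : exists phi, Q A -> A = [set p : set fC | p phi].
  have [QA|nQA] := pselect (Q A); last by exists (fFalse _).
  by have [phi _ <-] := QB _ QA; exists phi.
have [phi phiP] := Sc_conj (finite_image f fQ).
exists phi; split.
  by apply/phiP => _ [A QA <-]; have := Qp _ QA; rewrite {1}(fP _ QA).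
move=> q /phiP h; apply: QU => A QA; rewrite (fP _ QA); apply: h.
by exists A.
Qed.

Lemma Sc_hausdorff : hausdorff_space (Sc j).
Proof.
rewrite open_hausdorff => p q pq.
have [phi [pphi qphi]] : exists phi, sval p phi /\ ~ sval q phi.
  apply: contrapT => nE; move/eqP: pq; apply; apply: Sc_ext.
  apply/seteqP; split=> phi h; apply: contrapT => n; apply: nE; first by exists phi.
  by exists (fNot phi); split; [apply/Sc_not|move=> /Sc_not].
exists ([set p : Sc j | sval p phi], [set p : Sc j | sval p (fNot phi)]) => /=.
  by rewrite !inE /=; split=> //; apply/Sc_not.
split; [exact: Sc_open|exact: Sc_open|].
by apply/eqP/seteqP; split=> // r /= [h /Sc_not].
Qed.

Definition weaken I (x : I -> lsort L) : formula x -> formulaC C x :=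
  fsubst (fun i => tvar (scat x cs) (inl i)).

Lemma sat_weaken I (x : I -> lsort L) (phi : formula x) (a : tup C' x) :
  satC j (weaken phi) a <-> sat phi a.
Proof. by rewrite /satC /weaken sat_subst. Qed.

(** The elements of [C] enter [realize] as extra variables frozen at [jcbar]. *)
Lemma realize_over_C I (x : I -> lsort L) (p : set (formulaC C x)) :
  small K' [set: I] ->
  (forall q, finite_set q -> q `<=` p ->
    exists a : tup C' x, forall phi, q phi -> satC j phi a) ->
  exists a : tup C' x, forall phi, p phi -> satC j phi a.
Proof.
move=> sI pfin; have [K'_lim _ C'_sat _] := C'_monster.
have [a0 _] := pfin _ (finite_set0 _) (@sub0set _ _).
have sIC := small_sum K'_lim sI csort_small.
have wE (w : tup C' (scat x cs)) : (forall i, ~ range inl i -> w i = tcat a0 jc i) ->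
    w = tcat (fun i => w (inl i)) jc.
  by move=> h; apply: tup_ext => -[//|k]; rewrite h // => -[].
have [q fq qp|w [wv wp]] := realize C'_sat sIC (B := range inl) (v0 := tcat a0 jc) (p := p).
  have [a aq] := pfin q fq qp; exists (tcat a jc); split=> // -[i|//] [].
  by exists i.
by exists (fun i => w (inl i)) => phi /wp; rewrite {1}(wE _ wv).
Qed.

(** The limit of an ultrafilter is its average type, realized in [C'] by saturation. The realization
    has the type of [jcbar] because parameter-free formulas have the same truth value in all points
    of the space. *)
Lemma Sc_compact : compact [set: Sc j].
Proof.
rewrite compact_ultra => F FU _.
pose p := [set phi : fC | F [set q | sval q phi]].
have pN phi : ~ p phi -> p (fNot phi).
  have [h|h] := in_ultra_setVsetC [set q : Sc j | sval q phi] FU; first by move=> [].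
  by move=> _; apply: filterS h => q /Sc_not.
have [a ap] : exists a : tup C' cs, forall phi, p phi -> satC j phi a.
  apply: (realize_over_C csort_small) => q fq qp.
  have [r rq] : exists r : Sc j, forall phi, q phi -> sval r phi.
    apply: (@filter_ex _ F); apply: (filter_forall_finite (F := F)
      (P := fun phi => [set r : Sc j | sval r phi])) => // phi /qp; exact.
  have [a [_ ra]] := Sc_rep r; exists a => phi /rq; by rewrite ra.
have pa phi : satC j phi a -> p phi.
  by move=> h; apply: contrapT => /pN/ap; apply.
have st : same_type a jc.
  have key phi : sat phi jc -> sat phi a.
    move=> h; apply/sat_weaken/ap; apply: filterS filterT => q _ /=.
    by have [b [st ->]] := Sc_rep q; apply/sat_weaken/st.
  move=> phi; split; last exact: key.
  by move=> h; apply: contrapT => n; apply: (key (fNot phi) n).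
exists (Sc_of st); split=> // U /Sc_nbhs[phi [sphi phiU]].
by apply: filterS (pa _ sphi) => q; exact: phiU.
Qed.

End TypeSpace.

(** * Automorphisms of the monster model acting on types, and their limits *)

Section EllisSemigroup.
Variables (L : language) (C C' : structure L) (j : smap C C').
Variables (K K' : Type).
Hypotheses (C_monster : monster K C) (C'_monster : monster K' C').
Hypotheses (j_elem : elementary j) (C_small : small_model K' C).

Local Notation cs := (@csort L C).
Local Notation jc := (jcbar j).
Local Notation fC := (formulaC C cs).
Local Notation AutC := (@AutEL L C C' j).
Local Notation ELC := (@EL L C C' j).
Local Notation p0 := (tp_cbar j).

Lemma move_comp I (x : I -> lsort L) (g h : smap C C) (phi : formulaC C x) :
  move g (move h phi) = move (scomp g h) phi.
Proof.
rewrite /move fsubst_comp; congr fsubst.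
by apply: functional_extensionality_dep => -[].
Qed.

Lemma move_id I (x : I -> lsort L) (phi : formulaC C x) : move (@sid L C) phi = phi.
Proof.
rewrite -[RHS]fsubst_id; congr fsubst.
by apply: functional_extensionality_dep => -[//|[]].
Qed.

Definition extends_aut (g : smap C C) (g' : smap C' C') :=
  forall s (m : C s), g' s (j m) = j (g s m).

Lemma satC_move g g' I (x : I -> lsort L) (phi : formulaC C x) (a : tup C' x) :
  Aut C' g' -> extends_aut g g' -> satC j (move g phi) (tmap g' a) <-> satC j phi a.
Proof.
move=> g'A gg'; rewrite /satC /move sat_subst [X in _ <-> X](Aut_elementary g'A).
rewrite (_ : (fun k => _) = tmap g' (tcat a jc)) //.
by apply: functional_extensionality_dep => -[i //|k] /=; rewrite /tmap /= /jcbar /tmap gg'.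
Qed.

Lemma tpC_move g g' I (x : I -> lsort L) (a : tup C' x) :
  Aut C g -> Aut C' g' -> extends_aut g g' ->
  @move L C I x g @` tpC j a = tpC j (tmap g' a).
Proof.
move=> gA g'A gg'; apply/seteqP; split=> [_ [phi ha <-]|phi ha].
  exact/(satC_move _ _ g'A gg').
have [h [hA gh hg]] := Aut_inv gA; exists (move h phi).
  by apply/(satC_move _ _ g'A gg'); rewrite move_comp gh move_id.
by rewrite move_comp gh move_id.
Qed.

Lemma same_type_aut (g : smap C' C') (a : tup C' cs) :
  Aut C' g -> same_type a jc -> same_type (tmap g a) jc.
Proof. by move=> gA st phi; rewrite -(Aut_elementary gA). Qed.

(** By strong homogeneity of [C'] the automorphism extends to [C'], and the action on types is then
    the action on realizations. *)
Lemma AutEL_ext (F : ScSc j) : AutC F -> exists g g',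
  [/\ Aut C g, Aut C' g', extends_aut g g',
      forall p phi, sval (F p) (move g phi) <-> sval p phi &
      forall p a, sval p = tpC j a -> sval (F p) = tpC j (tmap g' a)].
Proof.
move=> [g gA Fg]; have [g' g'A gg'] := extend_aut C'_monster j_elem C_small gA.
have Fp p a : sval p = tpC j a -> sval (F p) = tpC j (tmap g' a).
  by move=> pa; rewrite Fg pa (tpC_move _ gA g'A gg').
exists g, g'; split=> // p phi; have [a [_ pa]] := Sc_rep p.
by rewrite (Fp _ _ pa) pa; apply: satC_move.
Qed.

Lemma AutEL_of g : Aut C g ->
  exists2 F : ScSc j, AutC F & forall p, sval (F p) = @move _ _ _ _ g @` sval p.
Proof.
move=> gA; have [g' g'A gg'] := extend_aut C'_monster j_elem C_small gA.
have h (p : Sc j) : Sc_set j (@move _ _ _ _ g @` sval p).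
  have [a [st ->]] := Sc_rep p; rewrite (tpC_move _ gA g'A gg').
  by exists (tmap g' a) => //; exact: same_type_aut.
exists (fun p => exist _ _ (h p)) => //; exists g => //.
Qed.

Lemma AutEL_id : AutC id.
Proof.
exists (@sid L C); first exact: Aut_id.
move=> p; apply/seteqP; split=> [phi h|_ [phi h <-]]; last by rewrite move_id.
by exists phi => //; rewrite move_id.
Qed.

Lemma AutEL_comp (F G : ScSc j) : AutC F -> AutC G -> AutC (ecomp F G).
Proof.
move=> [g gA Fg] [h hA Gh]; exists (scomp g h); first exact: Aut_comp.
move=> p; rewrite Fg Gh; apply/seteqP; split=> [_ [_ [phi pp <-] <-]|_ [phi pp <-]].
  by exists phi => //; rewrite move_comp.
by rewrite -move_comp; exists (move h phi) => //; exists phi.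
Qed.

Lemma AutEL_inv (F : ScSc j) : AutC F ->
  exists2 G : ScSc j, AutC G & ecomp F G = id /\ ecomp G F = id.
Proof.
move=> [g gA Fg]; have [h [hA gh hg]] := Aut_inv gA.
have [G GA Gh] := AutEL_of hA; exists G => //.
have key (F1 F2 : ScSc j) g1 g2 : (forall p, sval (F1 p) = @move _ _ _ _ g1 @` sval p) ->
    (forall p, sval (F2 p) = @move _ _ _ _ g2 @` sval p) ->
    scomp g1 g2 = @sid L C -> ecomp F1 F2 = id.
  move=> F1g F2g gg; apply: funext => p; apply: Sc_ext; rewrite F1g F2g.
  apply/seteqP; split=> [_ [_ [phi pp <-] <-]|phi pp]; first by rewrite move_comp gg move_id.
  by exists (move g2 phi); [exists phi|rewrite move_comp gg move_id].
by split; [exact: key Fg Gh gh|exact: key Gh Fg hg].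
Qed.

Lemma AutEL_continuous (F : ScSc j) : AutC F -> continuous (F : Sc j -> Sc j).
Proof.
move=> FA; have [G GA [FG GF]] := AutEL_inv FA; have [g [g' [gA g'A gg' _ Gp]]] := AutEL_ext GA.
have [h [h' [hA h'A hh' Fphi _]]] := AutEL_ext FA.
move=> p U /Sc_nbhs[phi [Fpphi phiU]].
have [k [kA hk kh]] := Aut_inv hA.
have : nbhs p [set q : Sc j | sval q (move k phi)].
  apply: open_nbhs_nbhs; split; first exact: Sc_open.
  by apply/Fphi; rewrite move_comp hk move_id.
apply: filterS => q /Fphi; rewrite move_comp hk move_id; exact: phiU.
Qed.

Lemma ecomp_continuousl (F : ScSc j) :
  continuous (F : Sc j -> Sc j) -> continuous (fun z : ScSc j => ecomp F z : ScSc j).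
Proof.
move=> Fc; apply: ptws_continuous => p z.
apply: (@continuous_comp _ _ _ (fun z : ScSc j => z p) (F : Sc j -> Sc j)); last exact: Fc.
exact: ptws_eval_continuous.
Qed.

Lemma ecomp_continuousr (x : ScSc j) : continuous (fun z : ScSc j => ecomp z x : ScSc j).
Proof.
apply: ptws_continuous => p z.
exact: (@ptws_eval_continuous _ _ (x p) z).
Qed.

Lemma ScSc_hausdorff : hausdorff_space (ScSc j).
Proof. apply: ptws_hausdorff; exact: Sc_hausdorff. Qed.

Lemma EL_closed : closed ELC.
Proof. exact: closed_closure. Qed.

Lemma ScSc_closed_compact (A : set (ScSc j)) : closed A -> compact A.
Proof.
move=> Ac; apply: (subclosed_compact Ac _ (@subsetT _ A)); apply: ptws_compact.
exact: (Sc_compact C'_monster C_small).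
Qed.

Lemma AutEL_EL : AutC `<=` ELC.
Proof. exact: subset_closure. Qed.

Lemma continuous_closure (X Y : topologicalType) (f : X -> Y) (A : set X) (B : set Y) (x : X) :
  continuous f -> closed B -> (forall a, A a -> B (f a)) -> closure A x -> B (f x).
Proof.
move=> fc Bc AB xA; suff : closure (f @^-1` B) x.
  by have /closure_id <- : closed (f @^-1` B) by apply: closed_comp => // y _; exact: fc.
by apply: closure_subset xA => a; exact: AB.
Qed.

(** Left multiplication is known to be continuous only for automorphisms, so [x] is approximated
    before [y]. The same order of limits is used for the graphs below. *)
Lemma EL_comp (x y : ScSc j) : ELC x -> ELC y -> ELC (ecomp x y).
Proof.
move=> xE yE; apply: (continuous_closure (@ecomp_continuousr y) EL_closed _ xE) => F FA.
apply: (continuous_closure (ecomp_continuousl (AutEL_continuous FA)) EL_closed _ yE) => G GA.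
by apply: AutEL_EL; exact: AutEL_comp.
Qed.

(** Density of the orbit of tp(cbar/C). Only finitely many coordinates and parameters occur in
    [phi]; the corresponding finite part of [a] is copied into [C] by saturation, and homogeneity of
    [C] moves the enumerated elements onto the copy. *)
Lemma AutEL_dense (a : tup C' cs) (phi : fC) : same_type a jc -> satC j phi a ->
  exists2 g, Aut C g & satC j phi (tmap j (tmap g (@cbar L C))).
Proof.
move=> st pa; have [K_lim _ C_sat C_hom] := C_monster.
have [S [fS [psi psiE]]] := formula_support phi.
pose S1 := [set k | S (inl k)]; pose S2 := [set k | S (inr k)].
pose x1 := restrict_ctx cs (S := S1); pose x2 := restrict_ctx cs (S := S2).
have fS1 : small K [set: {k | S1 k}].
  apply: (small_finite K_lim); rewrite (eq_finite_set (card_set_sig S1)).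
  apply: sub_finite_set (finite_image (fun k => match k with inl i | inr i => i end) fS).
  by move=> k Sk; exists (inl k).
have fS2 : small K [set: {k | S2 k}].
  apply: (small_finite K_lim); rewrite (eq_finite_set (card_set_sig S2)).
  apply: sub_finite_set (finite_image (fun k => match k with inl i | inr i => i end) fS).
  by move=> k Sk; exists (inr k).
pose eta (k : {k | S k}) : term (scat x1 x2) (restrict_ctx (scat cs cs) k) :=
  match k return term (scat x1 x2) (restrict_ctx (scat cs cs) k) with
  | exist (inl i) Si => tvar (scat x1 x2) (inl (exist S1 i Si))
  | exist (inr i) Si => tvar (scat x1 x2) (inr (exist S2 i Si))
  end.
pose rs (M : structure L) (S : set {s : lsort L & C s}) (v : tup M cs) :
  tup M (restrict_ctx cs (S := S)) := fun k => v (sval k).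
have chiP (M : structure L) (v w : tup M cs) :
    sat (fsubst eta psi) (tcat (rs M S1 v) (rs M S2 w)) <-> sat phi (tcat v w).
  rewrite psiE !sat_subst; set f := (X in sat psi X); set f' := (X in _ <-> sat psi X).
  suff -> : f = f' by [].
  by apply: functional_extensionality_dep => -[[i|i] Si].
pose c1 := rs C S1 (@cbar L C); pose c2 := rs C S2 (@cbar L C).
pose lift (theta : formula x1) : formula (scat x1 x2) :=
  fsubst (fun i => tvar (scat x1 x2) (inl i)) theta.
pose p := [set theta | theta = fsubst eta psi \/
  exists2 theta', sat theta' c1 & theta = lift theta'].
(* The type to realize consists of the type of [c1] together with [phi] over [c2]; its finite parts
   hold of [a] in [C'], hence have solutions in [C]. *)
have [q fq qp|w [wv wp]] := realize C_sat (small_sum K_lim fS1 fS2)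
    (B := range inl) (v0 := tcat c1 c2) (p := p).
  have [theta thetaP] := formula_conj fq.
  have [||w [wv /thetaP wq]] := @elementary_ex _ _ _ _ j_elem _ _ theta (range inl)
    (tcat c1 c2) (tcat (rs C' S1 a) (rs C' S2 jc)); last by exists w.
    by move=> [i|i] // []; exists i.
  apply/thetaP => _ /qp[->|[theta' c1t ->]]; first exact/chiP.
  rewrite sat_subst -/(rs C' S1 a).
  have := (st (fsubst (fun k : {k | S1 k} => tvar cs (sval k)) theta')).2.
  rewrite !sat_subst; apply; exact/j_elem.
pose d : tup C x1 := fun i => w (inl i).
have ew : w = tcat d c2.
  by apply: tup_ext => -[//|i]; rewrite wv // => -[].
have cd : same_type c1 d.
  have key theta : sat theta c1 -> sat theta d.
    move=> h; have : sat (lift theta) w by apply: wp; right; exists theta.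
    by rewrite sat_subst.
  move=> theta; split; first exact: key.
  by move=> h; apply: contrapT => n; apply: (key (fNot theta) n).
have [g gA gd] := C_hom _ _ _ _ fS1 cd; exists g => //.
rewrite /satC (_ : tcat _ jc = tmap j (tcat (tmap g (@cbar L C)) (@cbar L C))).
  apply/j_elem/chiP; rewrite (_ : rs _ _ _ = d); last exact: gd.
  by rewrite -ew; apply: wp; left.
by apply: tup_ext => -[].
Qed.

(** The image of the compact semigroup under evaluation at [p0] is closed, and it contains a dense
    orbit. *)
Lemma EL_transitive (q : Sc j) : exists2 z, ELC z & z p0 = q.
Proof.
pose ev (z : ScSc j) : Sc j := z p0.
have evc : continuous ev by exact: ptws_eval_continuous.
have cl : closed (ev @` ELC).
  apply: compact_closed; first exact: Sc_hausdorff.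
  apply: continuous_compact; first by apply: continuous_subspaceT => z; exact: evc.
  exact/ScSc_closed_compact/EL_closed.
suff : closure (ev @` ELC) q.
  by rewrite -((closure_id _).1 cl) => -[z zE zq]; exists z.
move=> U /Sc_nbhs[phi [qphi phiU]].
have [a [st qa]] := Sc_rep q; rewrite qa in qphi.
have [g gA gphi] := AutEL_dense st qphi; have [F FA Fg] := AutEL_of gA.
exists (F p0); split; first by exists F => //; exact: AutEL_EL.
apply: phiU; have [g' g'A gg'] := extend_aut C'_monster j_elem C_small gA.
rewrite Fg (tpC_move _ gA g'A gg') (_ : tmap g' jc = tmap j (tmap g (@cbar L C))) //.
by apply: tup_ext => k; exact: gg'.
Qed.

End EllisSemigroup.

(** * Compact semitopological groups and Baire's theorem *)

Section JointContinuity.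
Variables (G : topologicalType) (mul : G -> G -> G) (one : G) (inv : G -> G).
Hypotheses (mulA : associative mul) (mul1 : left_id one mul) (mulV : left_inverse one inv mul).
Hypotheses (mul_l : forall a, continuous (mul a)) (mul_r : forall a, continuous (mul^~ a)).
Hypotheses (GH : hausdorff_space G) (Gc : compact [set: G]).

Lemma semitop_mulVr x : mul x (inv x) = one.
Proof.
by rewrite -[LHS]mul1 -{1}(mulV (inv x)) -mulA (mulA (inv x)) mulV mul1 mulV.
Qed.

Lemma semitop_mul1r x : mul x one = x.
Proof. by rewrite -(mulV x) mulA semitop_mulVr mul1. Qed.

Lemma semitop_regular (x : G) (U : set G) : open U -> U x ->
  exists V, [/\ open V, V x & closure V `<=` U].
Proof.
move=> oU Ux; have reg : {for x, regular_space G}.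
  by apply: (compact_regular GH Gc); exact: filterT.
have [V Vx VU] := reg U (open_nbhs_nbhs (conj oU Ux)).
exists V°; split; [exact: open_interior|exact: Vx|].
by apply: subset_trans VU; apply: closure_subset; exact: interior_subset.
Qed.

Lemma cluster_seq_closed (f : nat -> G) (p : G) (B : set G) N :
  cluster (f @ \oo) p -> closed B -> (forall n, (N <= n)%N -> B (f n)) -> B p.
Proof.
move=> fp Bc fB; rewrite ((closure_id B).1 Bc) => U Up.
have FB : (f @ \oo) B by exists N.
by have [q] := fp _ _ FB Up; exists q.
Qed.

(* Otherwise there are [x_n] in [Q] and [y_n] with [x_k y_n] in [Q] for [k < n] and
   [x_n y_k] outside [P] for [k <= n]; take cluster points of both sequences. *)
Lemma semitop_near_one (P Q : set G) : closed P -> open Q -> Q one -> closure Q `<=` P° ->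
  exists U V, [/\ open U, U !=set0, U `<=` Q, nbhs one V &
    forall x v, U x -> V v -> P (mul x v)].
Proof.
move=> Pc oQ Q1 QP; apply: contrapT => nE.
have key U V : open U -> U !=set0 -> U `<=` Q -> nbhs one V ->
    exists x v, [/\ U x, V v & ~ P (mul x v)].
  move=> oU U0 UQ V1; apply: contrapT => h; apply: nE; exists U, V; split=> // x v Ux Vv.
  by apply: contrapT => nP; apply: h; exists x, v.
(* A state holds an open set for the future choices of [x], the list of the [x] chosen so far, and
   the latest [y]. *)
pose st := (set G * seq G * G)%type.
pose Inv (t : st) := [/\ open t.1.1, t.1.1 !=set0, t.1.1 `<=` Q & forall x, x \in t.1.2 -> Q x].
pose R (t t' : {t | Inv t}) := exists x, [/\ (sval t).1.1 x, (sval t').1.2 = x :: (sval t).1.2,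
  closure (sval t').1.1 `<=` (sval t).1.1 `&` [set z | ~ P (mul z (sval t').2)] &
  forall z, z \in (sval t').1.2 -> Q (mul z (sval t').2)].
have step t : {t' | R t t'}.
  apply: cid; case: t => [[[U s] y0] /= [oU U0 UQ sQ]].
  have [x0 Ux0] := U0.
  have sQ' x : x \in x0 :: s -> Q x.
    by rewrite inE => /orP[/eqP->|/sQ //]; exact: UQ.
  have V1 : nbhs one [set v | forall z, z \in (x0 :: s) -> Q (mul z v)].
    elim: (x0 :: s) sQ' => [|z l IH] lQ; first by apply: filterS filterT.
    have Qz : nbhs one [set v | Q (mul z v)].
      apply: (@mul_l z one); apply: open_nbhs_nbhs; split=> //.
      by rewrite semitop_mul1r; apply: lQ; rewrite inE eqxx.
    have Ql := IH (fun t tl => lQ t (mem_behead (s := z :: l) tl)).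
    by apply: filterS (filterI Qz Ql) => v [? h] t; rewrite inE => /orP[/eqP->//|/h].
  have [x [v [Ux Vv nP]]] := key _ _ oU U0 UQ V1.
  have oU' : open (U `&` [set z | ~ P (mul z v)]).
    apply: openI => //; rewrite (_ : mkset _ = mul^~ v @^-1` (~` P)) //.
    by apply: open_comp; [move=> z _; exact: mul_r|rewrite openC].
  have [U' [oU'' U'x U'U]] := semitop_regular oU' (conj Ux nP).
  have It : Inv (U', x0 :: s, v).
    split=> //=; first by exists x.
    by move=> z /subset_closure/U'U[/UQ].
  by exists (exist _ _ It), x0; split.
have I0 : Inv (Q, [::], one) by split=> //; exists one.
have [f [f0 fR]] := dependent_choice step (exist _ _ I0).
pose U n := (sval (f n)).1.1; pose s n := (sval (f n)).1.2; pose y n := (sval (f n)).2.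
have [x xP] := choice fR.
have Usub n m : U (n + m)%N `<=` U n.
  elim: m => [|m IH]; first by rewrite addn0.
  rewrite addnS; apply: subset_trans IH => z /subset_closure Uz.
  by have [_ _ /(_ z Uz)[]] := xP (n + m)%N.
have sx n m : (x n) \in (s (n + m).+1).
  have e k : s k.+1 = x k :: s k by have [] := xP k.
  by elim: m => [|m IH]; rewrite ?addn0 ?addnS e inE ?eqxx // IH orbT.
have [xc [_ xcc]] := Gc (F := x @ \oo) _ filterT.
have [yc [_ ycc]] := Gc (F := (fun n => y n.+1) @ \oo) _ filterT.
(* By separate continuity both iterated limits equal [mul xc yc]. Taking the limit in [x] first
   keeps it outside the interior of [P]; taking the limit in [y] first puts it into [closure Q]. *)
have nPxy : ~ P° (mul xc yc).
  apply: (cluster_seq_closed (B := [set v | ~ P° (mul xc v)]) (N := 0) ycc).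
    rewrite -openC; rewrite (_ : ~` _ = mul xc @^-1` P°).
      by apply: open_comp; [move=> z _; exact: mul_l|exact: open_interior].
    by apply/seteqP; split=> v /=; [move/contrapT|move=> h; apply].
  move=> n _ /interior_subset; suff : closure (U n.+1) xc.
    by have [_ _ h _] := xP n; move=> /h[_ nP] Pp; exact: nP.
  apply: (cluster_seq_closed (N := n.+1) xcc); first exact: closed_closure.
  move=> m nm; apply: subset_closure; rewrite -(subnKC nm); apply: (Usub n.+1 (m - n.+1)%N).
  by have [] := xP (n.+1 + (m - n.+1))%N.
apply: nPxy; apply: QP.
apply: (cluster_seq_closed (B := [set w | closure Q (mul w yc)]) (N := 0) xcc).
  rewrite (_ : mkset _ = mul^~ yc @^-1` closure Q) //.
  by apply: closed_comp; [move=> z _; exact: mul_r|exact: closed_closure].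
move=> k _; apply: (cluster_seq_closed (B := [set v | closure Q (mul (x k) v)]) (N := k) ycc).
  rewrite (_ : mkset _ = mul (x k) @^-1` closure Q) //.
  by apply: closed_comp; [move=> z _; exact: mul_l|exact: closed_closure].
move=> n kn; apply: subset_closure; have [_ _ _ h] := xP n; apply: h.
by rewrite -(subnKC kn); exact: sx.
Qed.

(** If this failed, products of elements arbitrarily near one and outside [N0] would cluster at some
    [z] outside the interior of [N0]; such a [z] can be separated from one. *)
Lemma semitop_continuous_one : forall N, nbhs one N ->
  exists W, nbhs one W /\ forall x y, W x -> W y -> N (mul x y).
Proof.
move=> N0 N1; apply: contrapT => nE.
pose F : set_system G := filter_from (nbhs one)
  (fun W => [set z | exists x y, [/\ W x, W y, z = mul x y & ~ N0 z]]).
have FF : ProperFilter F.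
  apply: filter_from_proper; first apply: filter_from_filter.
  - by exists setT; exact: filterT.
  - move=> W W' W1 W'1; exists (W `&` W'); first exact: filterI.
    by move=> z [x [y [[Wx W'x] [Wy W'y] -> nN]]]; split; exists x, y.
  - move=> W W1; apply: contrapT => h; apply: nE; exists W; split=> // x y Wx Wy.
    by apply: contrapT => nN; apply: h; exists (mul x y), x, y.
have [z [_ zF]] := Gc FF filterT.
have zW W : nbhs one W -> closure [set z | exists x y, [/\ W x, W y & z = mul x y]] z.
  move=> W1 U Uz; have FW : F [set z | exists x y, [/\ W x, W y, z = mul x y & ~ N0 z]].
    by exists W.
  by have [t [[x [y [Wx Wy -> _]]] Ut]] := zF _ _ FW Uz; exists (mul x y); split=> //; exists x, y.
have z1 : ~ N0° z.
  move=> zN; have FT : F (~` N0).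
    by exists setT; [exact: filterT|move=> t [x [y [_ _ _]]]].
  by have [t [nt Nt]] := zF _ _ FT zN; exact: nt.
have [P' [oP' P'1 P'N]] := semitop_regular (open_interior N0) N1.
have [Q0 [oQ0 Q01 Q0P]] := semitop_regular oP' P'1.
(* [Q] includes the condition that [a z] avoids [P]. For [a] in the open set [U] found below,
   however, [a z] is a limit of products of [a x] in [U] and [y] in [V], all lying in [P]. *)
pose P := closure P'; pose Q := Q0 `&` [set a | ~ P (mul a z)].
have Pc : closed P by exact: closed_closure.
have oQ : open Q.
  apply: openI => //; rewrite (_ : mkset _ = mul^~ z @^-1` (~` P)) //.
  by apply: open_comp; [move=> t _; exact: mul_r|rewrite openC].
have Q1 : Q one by split=> //=; rewrite mul1 => /P'N.
have QP : closure Q `<=` P°.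
  apply: subset_trans (closure_subset (@subIsetl _ _ _)) _.
  apply: subset_trans Q0P _; rewrite -open_subsetE //; exact: subset_closure.
have [U [V [oU [a Ua] UQ V1 UV]]] := semitop_near_one Pc oQ Q1 QP.
have [_ aP] := UQ _ Ua; apply: aP.
have W1 : nbhs one ([set x | U (mul a x)] `&` V).
  apply: filterI => //; apply: (@mul_l a one); apply: open_nbhs_nbhs; split=> //.
  by rewrite semitop_mul1r.
rewrite ((closure_id P).1 Pc) => B Baz.
have [t [[x [y [[Ux _] [_ Vy] ->]]] tB]] := zW _ W1 _ (@mul_l a z _ Baz).
by exists (mul a (mul x y)); split=> //; rewrite mulA; exact: UV.
Qed.

Lemma semitop_mul_continuous : continuous (fun xy : G * G => mul xy.1 xy.2).
Proof.
move=> [x y] N Nxy.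
have N1 : nbhs one [set z | N (mul (mul x z) y)].
  by apply: (@mul_l x one [set t | N (mul t y)]); rewrite semitop_mul1r; exact: (@mul_r y x N).
have [W [W1 WN]] := semitop_continuous_one N1.
exists ([set z | W (mul (inv x) z)], [set z | W (mul z (inv y))]) => /=.
  split; first by apply: (@mul_l (inv x) x W); rewrite mulV.
  by apply: (@mul_r (inv y) y W); rewrite semitop_mulVr.
move=> [a b] [/= Wa Wb]; have := WN _ _ Wa Wb => /=.
by rewrite !mulA semitop_mulVr mul1 -!mulA mulV semitop_mul1r.
Qed.

(** The preimage of a closed set is the projection of a closed, hence compact, part of the relation
    [mul x y = one]. *)
Lemma semitop_inv_continuous : continuous inv.
Proof.
apply/continuous_closedP => B Bc.
pose Z := [set t : G * G | mul t.1 t.2 = one] `&` [set t | B t.2].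
have Zc : closed Z.
  apply: closedI.
    rewrite (_ : mkset _ = (fun t => mul t.1 t.2) @^-1` [set one]) //.
    apply: closed_comp; first by move=> t _; exact: semitop_mul_continuous.
    exact: accessible_closed_set1 (hausdorff_accessible GH) _.
  rewrite (_ : mkset _ = snd @^-1` B) //.
  by apply: closed_comp => // t _; exact: cvg_snd.
have Zcpt : compact Z.
  apply: (subclosed_compact Zc _ (@subsetT _ Z)).
  by have := compact_setX Gc Gc; rewrite setXTT.
rewrite (_ : inv @^-1` B = fst @` Z).
  apply: compact_closed => //; apply: continuous_compact => //.
  by apply: continuous_subspaceT => t; exact: cvg_fst.
apply/seteqP; split=> [x Bx|_ [[x y] /= [xy By] <-]].
  by exists (x, inv x) => //; split=> //=; exact: semitop_mulVr.
by rewrite /= -[inv x]semitop_mul1r -xy mulA mulV mul1.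
Qed.

Lemma semitop_topological_group : topological_group mul one inv.
Proof. by split=> //; [exact: semitop_mul_continuous|exact: semitop_inv_continuous]. Qed.

End JointContinuity.

(** Nested open sets meeting [M] have closures that successively avoid the [Z n]; points chosen in
    them and in [M] have a cluster point in all these closures. *)
Lemma compact_baire (X : topologicalType) (M : set X) (Z : nat -> set X) :
  hausdorff_space X -> compact [set: X] -> closed M -> M !=set0 ->
  (forall n, closed (Z n)) -> M `<=` \bigcup_n Z n ->
  exists n O, [/\ open O, O `&` M !=set0 & O `&` M `<=` Z n].
Proof.
move=> XH Xc Mc [m0 Mm0] Zc MZ; apply: contrapT => nE.
(* The counter in a state tells which [Z n] is to be avoided next. *)
pose st := {t : nat * set X | open t.2 /\ t.2 `&` M !=set0}.
pose R (t t' : st) := (sval t').1 = (sval t).1.+1 /\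
  closure (sval t').2 `<=` (sval t).2 `&` ~` Z (sval t).1.
have step t : {t' | R t t'}.
  apply: cid; case: t => -[n O] /= [oO [m [Om Mm]]].
  have [m' [[Om' Mm'] nZ]] : exists m', (O `&` M) m' /\ ~ Z n m'.
    apply: contrapT => h; apply: nE; exists n, O; split=> //; first by exists m.
    by move=> t Ot; apply: contrapT => nZ; apply: h; exists t.
  have oU : open (O `&` ~` Z n) by apply: openI => //; rewrite openC.
  have [V [oV Vm VU]] := semitop_regular XH Xc oU (conj Om' nZ).
  have h : open (n.+1, V).2 /\ (n.+1, V).2 `&` M !=set0 by split=> //; exists m'.
  by exists (exist _ (n.+1, V) h).
have h0 : open (0, [set: X]).2 /\ (0, [set: X]).2 `&` M !=set0.
  by split; [exact: openT|exists m0].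
have [f [f0 fR]] := dependent_choice step (exist _ (0, [set: X]) h0).
have f1 n : (sval (f n)).1 = n by elim: n => [|n IH]; [rewrite f0|have [-> _] := fR n; rewrite IH].
have fsub n k : (sval (f (n + k))).2 `<=` (sval (f n)).2.
  elim: k => [|k IH]; first by rewrite addn0.
  rewrite addnS; apply: subset_trans IH => t /subset_closure ft.
  by have [_ /(_ _ ft)[]] := fR (n + k).
have /choice[x xP] n : exists x, ((sval (f n)).2 `&` M) x by have [_ [x fx]] := svalP (f n); exists x.
have [xc [_ xcc]] := Xc (x @ \oo) _ filterT.
have Mxc : M xc by apply: (cluster_seq_closed (N := 0) xcc Mc) => n _; have [] := xP n.
have [n _ Zn] := MZ _ Mxc.
have : closure (sval (f n.+1)).2 xc.
  apply: (cluster_seq_closed (N := n.+1) xcc); first exact: closed_closure.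
  move=> k nk; apply: subset_closure; apply: (fsub n.+1 (k - n.+1)).
  by rewrite subnKC //; have [] := xP k.
by have [_ h] := fR n; move=> /h[_]; rewrite f1; apply.
Qed.

(** * The tau-topology on the ideal group *)

Lemma pair_continuous (X Y Z : topologicalType) (f : X -> Y) (g : X -> Z) :
  continuous f -> continuous g -> continuous (fun x => (f x, g x)).
Proof. by move=> fc gc t; apply: (cvg_pair (fc t) (gc t)). Qed.

Lemma comp_continuous (X Y Z : topologicalType) (f : X -> Y) (g : Y -> Z) :
  continuous f -> continuous g -> continuous (fun x => g (f x)).
Proof. by move=> fc gc t; apply: continuous_comp; [exact: fc|exact: gc]. Qed.

Lemma fst_continuous (X Y : topologicalType) : continuous (@fst X Y).
Proof. by move=> t; exact: cvg_fst. Qed.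

Lemma snd_continuous (X Y : topologicalType) : continuous (@snd X Y).
Proof. by move=> t; exact: cvg_snd. Qed.

Section EllisGroup.
Variables (L : language) (C C' : structure L) (j : smap C C').
Variables (K K' : Type).
Hypotheses (C_monster : monster K C) (C'_monster : monster K' C').
Hypotheses (j_elem : elementary j) (C_small : small_model K' C).
Variables (MM : set (ScSc j)) (u : ScSc j).
Hypotheses (MM_min : minimal_left_ideal MM) (u_MM : MM u) (u_idem : ecomp u u = u).

Local Notation AutC := (@AutEL L C C' j).
Local Notation ELC := (@EL L C C' j).
Local Notation S := (ScSc j).
Local Notation G := (uM MM u).
Local Notation tcl := (cl_tau MM u).
Local Notation H := (HuM MM u).
Local Notation AutEL_continuous := (AutEL_continuous C'_monster j_elem C_small).
Local Notation EL_comp := (EL_comp C'_monster j_elem C_small).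

Section IdealGroup.
Implicit Types x y z a b m : S.

Lemma ecompA a b c : ecomp (ecomp a b) c = ecomp a (ecomp b c).
Proof. by []. Qed.

Local Opaque ecomp.

Lemma MM_EL : MM `<=` ELC. Proof. by have [[]] := MM_min. Qed.

Lemma MM_comp x m : ELC x -> MM m -> MM (ecomp x m).
Proof. by have [[_ _ h] _] := MM_min; exact: h. Qed.

Lemma MM_gen m : MM m -> MM = [set ecomp x m | x in ELC].
Proof.
move=> mM; have [_ min] := MM_min; apply/esym/min.
  split=> [_ [x xE <-]| |x _ xE [y yE <-]].
  - by apply: EL_comp => //; exact: MM_EL.
  - by exists (ecomp id m), id => //; apply: AutEL_EL; exact: AutEL_id.
  - by exists (ecomp x y) => //; exact: EL_comp.
by move=> _ [x xE <-]; exact: MM_comp.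
Qed.

Lemma MM_trans m n : MM m -> MM n -> exists2 x, ELC x & ecomp x m = n.
Proof. by move=> /MM_gen -> [x xE <-]; exists x. Qed.

Lemma MM_u m : MM m -> ecomp m u = m.
Proof.
rewrite (MM_gen u_MM) => -[x xE <-].
by rewrite ecompA u_idem.
Qed.

(** The ideal is generated by [u], so it is the image of a compact set under a right
    multiplication. *)
Lemma MM_closed : closed MM.
Proof.
rewrite (MM_gen u_MM); apply: compact_closed.
  exact: ScSc_hausdorff.
apply: continuous_compact.
  by apply: continuous_subspaceT => z; exact: ecomp_continuousr.
exact/(ScSc_closed_compact C'_monster C_small)/EL_closed.
Qed.

Lemma uMP x : G x <-> MM x /\ ecomp u x = x.
Proof.
split=> [[y yM <-]|[xM <-]]; last by exists x.
split; first by apply: MM_comp => //; exact: MM_EL.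
by rewrite -ecompA u_idem.
Qed.

Lemma uM_MM : G `<=` MM. Proof. by move=> x /uMP[]. Qed.
Lemma uM_EL : G `<=` ELC. Proof. by move=> x /uM_MM/MM_EL. Qed.
Lemma uM_ul x : G x -> ecomp u x = x. Proof. by move=> /uMP[]. Qed.
Lemma uM_ur x : G x -> ecomp x u = x. Proof. by move=> /uM_MM/MM_u. Qed.
Lemma uM_u : G u. Proof. by apply/uMP. Qed.

Lemma uM_umul m : MM m -> G (ecomp u m). Proof. by exists m. Qed.

Lemma uM_comp x y : G x -> G y -> G (ecomp x y).
Proof.
move=> xG yG; apply/uMP; split; first exact: MM_comp (uM_EL xG) (uM_MM yG).
by rewrite -ecompA (uM_ul xG).
Qed.

(** By minimality [x] generates the ideal, so some multiple of it is [u]; the multiplier is then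
    compressed to [u y u]. *)
Lemma uM_linv x : G x -> exists2 y, G y & ecomp y x = u.
Proof.
move=> xG; have [y yE yx] := MM_trans (uM_MM xG) u_MM.
exists (ecomp u (ecomp y u)).
  by apply: uM_umul; apply: MM_comp.
by rewrite (ecompA u) (ecompA y) (uM_ul xG) yx.
Qed.

Lemma uM_inv_ex x : exists y, G x -> [/\ G y, ecomp y x = u & ecomp x y = u].
Proof.
have [xG|] := pselect (G x); last by exists u.
have [y yG yx] := uM_linv xG; have [z zG zy] := uM_linv yG.
exists y => _; split=> //.
have -> : x = z; last by [].
by rewrite -(uM_ul xG) -zy ecompA yx (uM_ur zG).
Qed.

Definition uM_inv x : S := sval (cid (uM_inv_ex x)).

Lemma uM_invG x : G x -> G (uM_inv x).
Proof. by move=> xG; rewrite /uM_inv; case: cid => y /= /(_ xG)[]. Qed.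

Lemma uM_mulV x : G x -> ecomp x (uM_inv x) = u.
Proof. by move=> xG; rewrite /uM_inv; case: cid => y /= /(_ xG)[]. Qed.

Lemma uM_mulVr x : G x -> ecomp (uM_inv x) x = u.
Proof. by move=> xG; rewrite /uM_inv; case: cid => y /= /(_ xG)[]. Qed.

Lemma uM_mulKl x y : G x -> G y -> ecomp (uM_inv x) (ecomp x y) = y.
Proof. by move=> xG yG; rewrite -ecompA uM_mulVr // uM_ul. Qed.

Lemma uM_mulKVl x y : G x -> G y -> ecomp x (ecomp (uM_inv x) y) = y.
Proof. by move=> xG yG; rewrite -ecompA uM_mulV // uM_ul. Qed.

Lemma uM_mulKr x y : G x -> G y -> ecomp (ecomp y x) (uM_inv x) = y.
Proof. by move=> xG yG; rewrite ecompA uM_mulV // uM_ur. Qed.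

Lemma uM_mulKVr x y : G x -> G y -> ecomp (ecomp y (uM_inv x)) x = y.
Proof. by move=> xG yG; rewrite ecompA uM_mulVr // uM_ur. Qed.

Lemma uM_inv_uniq x y : G x -> G y -> ecomp y x = u -> y = uM_inv x.
Proof.
move=> xG yG yx; rewrite -(uM_mulKr xG yG) yx.
by rewrite (uM_ul (uM_invG xG)).
Qed.

Lemma uM_invK x : G x -> uM_inv (uM_inv x) = x.
Proof.
move=> xG; apply/esym/uM_inv_uniq => //; [exact: uM_invG|exact: uM_mulV].
Qed.

Lemma uM_invM x y : G x -> G y -> uM_inv (ecomp x y) = ecomp (uM_inv y) (uM_inv x).
Proof.
move=> xG yG; have [xV yV] := (uM_invG xG, uM_invG yG).
apply/esym/uM_inv_uniq; [exact: uM_comp|exact: uM_comp|].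
by rewrite ecompA uM_mulKl // uM_mulVr.
Qed.

(** An index of the net is a pair of neighbourhoods together with a witness for them, ordered by
    shrinking of the neighbourhoods; the net is read off from its indices. *)
Lemma circP p A eta : circ p A eta <-> ELC eta /\
  forall U W, nbhs p U -> nbhs eta W ->
    exists g a, [/\ AutC g, A a, U g & W (ecomp g a)].
Proof.
split=> [[etaE [I [le [a [g [[_ _ le_tr le_dir] aA gA gp gae]]]]]]|[etaE h]].
  split=> // U W /gp[i iU] /gae[k kW].
  by have [l [il kl]] := le_dir i k; exists (g l), (a l); split=> //; [exact: iU|exact: kW].
split=> //.
pose I := {t : (set S * set S) * (S * S) | [/\ nbhs p t.1.1, nbhs eta t.1.2,
  AutC t.2.1 /\ A t.2.2 & t.1.1 t.2.1 /\ t.1.2 (ecomp t.2.1 t.2.2)]}.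
have mk U W : nbhs p U -> nbhs eta W -> exists i : I, (sval i).1 = (U, W).
  move=> Up We; have [g [a [gA aA Ug Wga]]] := h _ _ Up We.
  have P : [/\ nbhs p ((U, W), (g, a)).1.1, nbhs eta ((U, W), (g, a)).1.2,
    AutC ((U, W), (g, a)).2.1 /\ A ((U, W), (g, a)).2.2 &
    ((U, W), (g, a)).1.1 ((U, W), (g, a)).2.1 /\
    ((U, W), (g, a)).1.2 (ecomp ((U, W), (g, a)).2.1 ((U, W), (g, a)).2.2)] by [].
  by exists (exist _ ((U, W), (g, a)) P).
pose le (i k : I) := (sval k).1.1 `<=` (sval i).1.1 /\ (sval k).1.2 `<=` (sval i).1.2.
exists I, le, (fun i => (sval i).2.2), (fun i => (sval i).2.1); split.
- split=> [|i|i k l [ik1 ik2] [kl1 kl2]|i k].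
  + by have [i _] := mk _ _ filterT filterT; exists i.
  + by split; exact: subset_refl.
  + by split; [exact: subset_trans kl1 ik1|exact: subset_trans kl2 ik2].
  + have [ip ie _ _] := svalP i; have [kp ke _ _] := svalP k.
    have [l lE] := mk _ _ (filterI ip kp) (filterI ie ke).
    by exists l; rewrite /le lE /=; split; split; move=> t [].
- by move=> i; have [_ _ []] := svalP i.
- by move=> i; have [_ _ []] := svalP i.
- move=> U Up; have [i iE] := mk _ _ Up filterT; exists i => k [ki _].
  have [_ _ _ [kk _]] := svalP k; have := ki _ kk; by rewrite iE.
- move=> U Ue; have [i iE] := mk _ _ filterT Ue; exists i => k [_ ki].
  have [_ _ _ [_ kk]] := svalP k; have := ki _ kk; by rewrite iE.
Qed.

(* [graph A] is the union of the graphs of the right translations of [MM] by elements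
   of [A]. Inverting a translation swaps the coordinates of its graph. *)
Definition graph (A : set S) : set (S * S) :=
  [set t | exists m a, [/\ MM m, A a & t = (m, ecomp m a)]].

(** Since [u a = a] on [uM], a net as in [circ] yields the points [(g u, g a)] of the graph.
    Conversely, elements of the ideal are limits of automorphisms, and right multiplications are
    continuous. *)
Lemma cl_tauP A x : A `<=` G -> tcl A x <-> G x /\ closure (graph A) (u, x).
Proof.
move=> AG; split=> [[/circP[_ h] xG]|[xG h]].
  split=> // W [[W1 W2] /= [W1u W2x] W12].
  have Uu : nbhs u [set z | W1 (ecomp z u)].
    by apply: (@ecomp_continuousr _ _ _ _ u u); rewrite /= u_idem.
  have [g [a [gA aA Wgu Wga]]] := h _ _ Uu W2x.
  exists (ecomp g u, ecomp g a); split; last exact: W12.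
  exists (ecomp g u), a; split=> //; first by apply: MM_comp => //; exact: AutEL_EL.
  by rewrite ecompA (uM_ul (AG _ aA)).
split=> //; apply/circP; split; first exact: uM_EL.
move=> U W Up Wx.
have [|_ [[m [a [mM aA ->]]] [/= Um Wma]]] := h (U° `*` W°).
  by exists (U°, W°) => //=; split; exact: nbhs_interior.
have : nbhs m [set z | U z /\ W (ecomp z a)].
  by apply: filterI => //; exact: (@ecomp_continuousr _ _ _ _ a m).
move=> /(MM_EL mM)[g [gA [Ug Wga]]].
by exists g, a; split.
Qed.

(** Left multiplication acts diagonally on graphs. This changes the base point [u] in [cl_tauP] to
    any other point of the ideal. *)
Lemma graph_closure_mul A x y z : ELC z ->
  closure (graph A) (x, y) -> closure (graph A) (ecomp z x, ecomp z y).
Proof.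
move=> zE xy.
have zc : continuous (fun z : S => (ecomp z x, ecomp z y) : S * S).
  by apply: pair_continuous; exact: ecomp_continuousr.
apply: (continuous_closure (B := closure (graph A)) zc (@closed_closure _ _) _ zE) => F FA.
have Fc : continuous (fun t : S * S => (ecomp F t.1, ecomp F t.2) : S * S).
  have Fc := ecomp_continuousl (AutEL_continuous FA).
  by apply: pair_continuous; apply: comp_continuous Fc;
    [exact: fst_continuous|exact: snd_continuous].
apply: (continuous_closure (B := closure (graph A)) Fc (@closed_closure _ _) _ xy) => _ [m [a [mM aA ->]]] /=.
apply: subset_closure; exists (ecomp F m), a; split=> //.
by apply: MM_comp => //; exact: AutEL_EL.
Qed.

Lemma graph_closure_at A x m : MM m -> closure (graph A) (u, x) ->
  closure (graph A) (m, ecomp m x).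
Proof. by move=> mM /(graph_closure_mul (MM_EL mM)); rewrite MM_u. Qed.

Lemma cl_tau_sub A : tcl A `<=` G. Proof. by move=> x []. Qed.

Lemma subset_cl_tau A : A `<=` G -> A `<=` tcl A.
Proof.
move=> AG x Ax; apply/cl_tauP => //; split; first exact: AG.
apply: subset_closure; exists u, x; split=> //.
by rewrite uM_ul //; exact: AG.
Qed.

Lemma cl_tauS A B : B `<=` G -> A `<=` B -> tcl A `<=` tcl B.
Proof.
move=> BG AB x /cl_tauP[|xG xA]; first exact: subset_trans BG.
apply/cl_tauP => //; split=> //; apply: closure_subset xA => _ [m [a [mM aA ->]]].
by exists m, a; split=> //; exact: AB.
Qed.

Lemma cl_tau_idem A : A `<=` G -> tcl (tcl A) `<=` tcl A.
Proof.
move=> AG x /(cl_tauP _ (@cl_tau_sub A))[xG xA].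
apply/cl_tauP => //; split=> //.
have := closed_closure (A := graph A); rewrite closure_id => ->.
apply: closure_subset xA => _ [m [a [mM /(cl_tauP _ AG)[aG aA] ->]]].
exact: graph_closure_at.
Qed.

Lemma tau_closedP A : tau_closed MM u A <-> A `<=` G /\ tcl A `<=` A.
Proof.
split=> -[AG h]; split=> //; first by rewrite h.
by apply/seteqP; split=> //; exact: subset_cl_tau.
Qed.

Lemma tau_closed_cl A : A `<=` G -> tau_closed MM u (tcl A).
Proof. by move=> AG; apply/tau_closedP; split; [exact: cl_tau_sub|exact: cl_tau_idem]. Qed.

Lemma cl_tau_min A B : tau_closed MM u B -> A `<=` B -> tcl A `<=` B.
Proof.
move=> /tau_closedP[BG Bc] AB; apply: subset_trans Bc; exact: cl_tauS.
Qed.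

Lemma tau_closed0 : tau_closed MM u set0.
Proof.
apply/tau_closedP; split=> // x /cl_tauP[//|_ h].
by have [t [[m [a []]]]] := h setT filterT.
Qed.

Lemma tau_closedU A B : tau_closed MM u A -> tau_closed MM u B -> tau_closed MM u (A `|` B).
Proof.
move=> /tau_closedP[AG Ac] /tau_closedP[BG Bc].
have ABG : A `|` B `<=` G by move=> x []; [exact: AG|exact: BG].
apply/tau_closedP; split=> // x /(cl_tauP _ ABG)[xG].
have -> : graph (A `|` B) = graph A `|` graph B.
  apply/seteqP; split=> [_ [m [a [mM [aA|aB] ->]]]|_ [[m [a [mM aA ->]]]|[m [a [mM aA ->]]]]].
  - by left; exists m, a.
  - by right; exists m, a.
  - by exists m, a; split=> //; left.
  - by exists m, a; split=> //; right.
rewrite closureU => -[h|h]; [left; apply: Ac|right; apply: Bc];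
  by apply/cl_tauP.
Qed.

(** Intersecting with [uM] covers the case of an empty [D]. *)
Lemma tau_closed_bigcap (I : Type) (D : set I) (F : I -> set S) :
  (forall i, D i -> tau_closed MM u (F i)) ->
  tau_closed MM u (G `&` \bigcap_(i in D) F i).
Proof.
move=> Fc; apply/tau_closedP; split=> [x []//|x xc]; split; first exact: cl_tau_sub xc.
move=> i Di; apply: (cl_tau_min (Fc i Di) _ xc) => y [_]; exact.
Qed.

Lemma tau_closed_bigcup_finite (I : Type) (D : set I) (F : I -> set S) : finite_set D ->
  (forall i, D i -> tau_closed MM u (F i)) -> tau_closed MM u (\bigcup_(i in D) F i).
Proof.
move=> fD; have [s eD] := (@finite_seqP {classic I} D).1 fD.
rewrite {fD}eD; elim: s => [|i s IH] Fc.
  rewrite (_ : \bigcup_(i in _) _ = set0); first exact: tau_closed0.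
  by apply/seteqP; split=> // x [].
rewrite (_ : \bigcup_(i in _) _ = F i `|` \bigcup_(i in [set` s]) F i).
  apply: tau_closedU; first by apply: Fc; rewrite /= inE eqxx.
  by apply: IH => k ks; apply: Fc; rewrite /= inE ks orbT.
apply/seteqP; split=> [x [k]|x [Fx|[k ks Fx]]].
- by rewrite /= inE => /orP[/eqP->|ks Fx]; [left|right; exists k].
- by exists i => //=; rewrite inE eqxx.
- by exists k => //=; rewrite inE ks orbT.
Qed.

Lemma tau_closed_mulr a A : G a -> tau_closed MM u A ->
  tau_closed MM u [set x | G x /\ A (ecomp x a)].
Proof.
move=> aG /tau_closedP[AG Ac]; have BG : [set x | G x /\ A (ecomp x a)] `<=` G by move=> x [].
apply/tau_closedP; split=> // x /(cl_tauP _ BG)[xG h]; split=> //; apply: Ac.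
apply/cl_tauP => //; split; first exact: uM_comp.
have fc : continuous (fun t : S * S => (t.1, ecomp t.2 a) : S * S).
  apply: pair_continuous; first exact: fst_continuous.
  by apply: comp_continuous (@ecomp_continuousr _ _ _ _ a); exact: snd_continuous.
apply: (continuous_closure (B := closure (graph A)) fc (@closed_closure _ _) _ h) => _ [m [b [mM [bG bA] ->]]] /=.
by apply: subset_closure; exists m, (ecomp b a); rewrite ecompA.
Qed.

(** Left multiplication by [a] is turned into right multiplication in the other coordinate:
    [(m, m b)] becomes [(n, n (a b))] with [n] the product of [m] and the inverse of [a]. The base
    point is then brought back to [u] by multiplying by [a]. *)
Lemma tau_closed_mull a A : G a -> tau_closed MM u A ->
  tau_closed MM u [set x | G x /\ A (ecomp a x)].
Proof.
move=> aG /tau_closedP[AG Ac]; have BG : [set x | G x /\ A (ecomp a x)] `<=` G by move=> x [].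
apply/tau_closedP; split=> // x /(cl_tauP _ BG)[xG h]; split=> //; apply: Ac.
apply/cl_tauP => //; split; first exact: uM_comp.
have fc : continuous (fun t : S * S => (ecomp t.1 (uM_inv a), t.2) : S * S).
  apply: pair_continuous; last exact: snd_continuous.
  by apply: comp_continuous (@ecomp_continuousr _ _ _ _ (uM_inv a)); exact: fst_continuous.
have : closure (graph A) (ecomp u (uM_inv a), x).
  apply: (continuous_closure (B := closure (graph A)) fc (@closed_closure _ _) _ h) => _ [m [b [mM [bG bA] ->]]] /=.
  apply: subset_closure; exists (ecomp m (uM_inv a)), (ecomp a b); split=> //.
    by apply: MM_comp; [exact: MM_EL|exact/uM_MM/uM_invG].
  by rewrite ecompA uM_mulKl.
move=> /(graph_closure_mul (uM_EL aG)).
by rewrite (uM_ul (uM_invG aG)) uM_mulV.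
Qed.

Lemma tau_closed_inv A : tau_closed MM u A ->
  tau_closed MM u [set x | G x /\ A (uM_inv x)].
Proof.
move=> /tau_closedP[AG Ac]; have BG : [set x | G x /\ A (uM_inv x)] `<=` G by move=> x [].
apply/tau_closedP; split=> // x /(cl_tauP _ BG)[xG h]; split=> //; apply: Ac.
apply/cl_tauP => //; split; first exact: uM_invG.
have fc : continuous (fun t : S * S => (t.2, t.1) : S * S).
  by apply: pair_continuous; [exact: snd_continuous|exact: fst_continuous].
have : closure (graph A) (x, u).
  apply: (continuous_closure (B := closure (graph A)) fc (@closed_closure _ _) _ h) => _ [m [b [mM [bG bA] ->]]] /=.
  apply: subset_closure; exists (ecomp m b), (uM_inv b); split=> //.
    by apply: MM_comp; [exact: MM_EL|exact: uM_MM].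
  by rewrite ecompA uM_mulV // MM_u.
move=> /(graph_closure_mul (uM_EL (uM_invG xG))).
by rewrite uM_mulVr // (uM_ur (uM_invG xG)).
Qed.

(** The pair [(u, m)] is a limit of points [(u, a)] of the graph, and multiplication by [u]
    preserves the closure. This links product limits with the tau-topology and yields its
    compactness. *)
Lemma closure_cl_tau A m : A `<=` G -> closure A m -> tcl A (ecomp u m).
Proof.
move=> AG Am; have mM : MM m.
  have := MM_closed; rewrite closure_id => ->; apply: closure_subset Am.
  by move=> a /AG/uM_MM.
apply/cl_tauP => //; split; first exact: uM_umul.
rewrite -[X in (X, _)]u_idem; apply: graph_closure_mul; first exact: MM_EL.
have fc : continuous (fun t : S => (u, t) : S * S).
  by apply: pair_continuous => [|t]; [exact: cst_continuous|exact: cvg_id].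
apply: (continuous_closure (B := closure (graph A)) fc (@closed_closure _ _) _ Am) => a aA.
apply: subset_closure; exists u, a; split=> //.
by rewrite uM_ul //; exact: AG.
Qed.

Lemma tau_compact (F : set_system S) : ProperFilter F -> F G ->
  exists x, G x /\ forall A, A `<=` G -> F A -> tcl A x.
Proof.
move=> FF FG; have cM := ScSc_closed_compact C'_monster C_small MM_closed.
have [m [mM mF]] := cM F FF (filterS uM_MM FG).
exists (ecomp u m); split; first exact: uM_umul.
move=> A AG FA; apply: closure_cl_tau => // U Um; have [a [aA aU]] := mF _ _ FA Um.
by exists a.
Qed.

Definition open_nbhs_u (O : set S) := [/\ O `<=` G, O u & tau_closed MM u (G `\` O)].

Lemma HuMP x : H x <-> forall O, open_nbhs_u O -> tcl O x.
Proof.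
split=> [h O [OG Ou Oc]|h V [VG [O [OV Ou Oc]]]].
  by apply: h; split=> //; exists O; split.
have OG : O `<=` G by exact: subset_trans VG.
by apply: (cl_tauS VG OV); apply: h; split.
Qed.

Lemma setDD_G A : A `<=` G -> G `\` (G `\` A) = A.
Proof.
move=> AG; apply/seteqP; split=> [x [xG h]|x Ax].
  by apply: contrapT => nA; apply: h.
by split; [exact: AG|move=> []].
Qed.

Lemma open_nbhs_uT : open_nbhs_u G.
Proof.
by split=> //; [exact: uM_u|rewrite setDv; exact: tau_closed0].
Qed.

Lemma HuM_sub : H `<=` G.
Proof. by move=> x /HuMP/(_ _ open_nbhs_uT)/cl_tau_sub. Qed.

Lemma open_nbhs_preim (f : S -> S) O : (forall x, G x -> G (f x)) -> O (f u) ->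
  (forall A, tau_closed MM u A -> tau_closed MM u [set x | G x /\ A (f x)]) ->
  open_nbhs_u O -> open_nbhs_u [set x | G x /\ O (f x)].
Proof.
move=> fG fu fc [OG Ou Oc]; split=> [x []//| |]; first by split; [exact: uM_u|].
rewrite (_ : _ `\` _ = [set x | G x /\ (G `\` O) (f x)]); first exact: fc.
apply/seteqP; split=> x [xG h]; split=> //.
  by split; [exact: fG|move=> h']; apply: h.
by move=> [_]; exact: h.2.
Qed.

Lemma tau_closed_conj a A : G a -> tau_closed MM u A ->
  tau_closed MM u [set x | G x /\ A (ecomp a (ecomp x (uM_inv a)))].
Proof.
move=> aG Ac; rewrite (_ : mkset _ =
    [set x | G x /\ [set x | G x /\ A (ecomp a x)] (ecomp x (uM_inv a))]).
  by apply: tau_closed_mulr; [exact: uM_invG|exact: tau_closed_mull].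
apply/seteqP; split=> x; last by move=> [xG [_ h]].
by move=> [xG h]; do 2!split=> //; apply: uM_comp => //; exact: uM_invG.
Qed.

(** For [g] in [O] the elements [y] with [y g] in [O] form a tau-neighbourhood of [u], so [x] is in
    its closure and [x g] in that of [O]. Left translation by [x] then extends this to [tcl O].
    Consequently closures of neighbourhoods are unions of cosets. *)
Lemma HuM_cl x O y : H x -> open_nbhs_u O -> tcl O y -> tcl O (ecomp x y).
Proof.
move=> Hx Onb; have [OG Ou Oc] := Onb; have xG := HuM_sub Hx.
have step g : O g -> tcl O (ecomp x g).
  move=> Og; have gG := OG _ Og.
  have nb : open_nbhs_u [set y | G y /\ O (ecomp y g)].
    apply: open_nbhs_preim => // [z zG| |A Ac]; [exact: uM_comp| |].
      by rewrite uM_ul.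
    exact: tau_closed_mulr.
  have := (HuMP x).1 Hx _ nb.
  have cc := tau_closed_mulr gG (tau_closed_cl OG).
  by case/(cl_tau_min cc) => [z [zG Oz]|] //; split=> //; exact: subset_cl_tau.
have cc := tau_closed_mull xG (tau_closed_cl OG).
by case/(cl_tau_min cc) => [z Oz|] //; split; [exact: OG|exact: step].
Qed.

Lemma HuM_u : H u.
Proof. by apply/HuMP => O [OG Ou Oc]; exact: subset_cl_tau. Qed.

Lemma HuM_comp x y : H x -> H y -> H (ecomp x y).
Proof.
by move=> Hx /HuMP Hy; apply/HuMP => O Onb; apply: HuM_cl => //; exact: Hy.
Qed.

Lemma HuM_inv x : H x -> H (uM_inv x).
Proof.
move=> Hx; apply/HuMP => O Onb; have [OG Ou Oc] := Onb.
have nb : open_nbhs_u [set y | G y /\ O (uM_inv y)].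
  apply: open_nbhs_preim => // [z zG| |A Ac]; [exact: uM_invG| |exact: tau_closed_inv].
  by rewrite -(uM_inv_uniq uM_u uM_u).
have cc := tau_closed_inv (tau_closed_cl OG).
have := (HuMP x).1 Hx _ nb.
by case/(cl_tau_min cc) => [z [zG Oz]|] //; split=> //; exact: subset_cl_tau.
Qed.

Lemma HuM_conj a x : G a -> H x -> H (ecomp a (ecomp x (uM_inv a))).
Proof.
move=> aG Hx; apply/HuMP => O Onb; have [OG Ou Oc] := Onb.
have nb : open_nbhs_u [set y | G y /\ O (ecomp a (ecomp y (uM_inv a)))].
  apply: open_nbhs_preim => // [z zG| |A Ac]; last exact: tau_closed_conj.
    by apply: uM_comp => //; apply: uM_comp => //; exact: uM_invG.
  by rewrite (uM_ul (uM_invG aG)) uM_mulV.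
have cc := tau_closed_conj aG (tau_closed_cl OG).
have := (HuMP x).1 Hx _ nb.
by case/(cl_tau_min cc) => [z [zG Oz]|] //; split=> //; exact: subset_cl_tau.
Qed.

(** * The quotient by H(uM) as a compact Hausdorff group *)

Local Notation Q := (uMH MM u).
Local Notation coset := (ecoset MM u).

Lemma coset_mem x y : G x -> coset x y <-> G y /\ H (ecomp (uM_inv x) y).
Proof.
move=> xG; split=> [[k Hk <-]|[yG Hy]].
  have kG := HuM_sub Hk; split; first exact: uM_comp.
  by rewrite uM_mulKl.
by exists (ecomp (uM_inv x) y) => //; rewrite uM_mulKVl.
Qed.

Lemma coset_eqP x y : G x -> G y -> coset x = coset y <-> H (ecomp (uM_inv x) y).
Proof.
move=> xG yG; split=> [e|h].
  have : coset y y by exists u; [exact: HuM_u|rewrite uM_ur].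
  by rewrite -e => /(coset_mem _ xG)[].
have xVy : ecomp y (uM_inv (ecomp (uM_inv x) y)) = x.
  by have xVG := uM_invG xG; rewrite uM_invM // uM_invK // uM_mulKVl.
apply/seteqP; split=> _ [k Hk <-]; have kG := HuM_sub Hk.
  exists (ecomp (uM_inv (ecomp (uM_inv x) y)) k).
    by apply: HuM_comp => //; exact: HuM_inv.
  by rewrite -ecompA xVy.
exists (ecomp (ecomp (uM_inv x) y) k); first exact: HuM_comp.
by rewrite -ecompA uM_mulKVl.
Qed.

Definition cls x : Q :=
  match pselect (G x) with
  | left xG => exist _ (coset x) (ex_intro2 _ _ x xG erefl)
  | right _ => exist _ (coset u) (ex_intro2 _ _ u uM_u erefl)
  end.

Lemma cls_val x : G x -> sval (cls x) = coset x.
Proof. by move=> xG; rewrite /cls; case: pselect. Qed.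

Lemma uMH_ext (X Y : Q) : sval X = sval Y -> X = Y.
Proof.
by case: X Y => [X Xp] [Y Yp] /= e; subst Y; congr exist; exact: Prop_irrelevance.
Qed.

Lemma cls_surj (X : Q) : exists2 x, G x & X = cls x.
Proof.
have [x xG xX] := svalP X; exists x => //.
by apply: uMH_ext; rewrite cls_val.
Qed.

Lemma clsP x y : G x -> G y -> cls x = cls y <-> H (ecomp (uM_inv x) y).
Proof.
move=> xG yG; rewrite -coset_eqP //; split=> [e|e].
  by rewrite -!cls_val // e.
by apply: uMH_ext; rewrite !cls_val.
Qed.

Lemma cls_mulH x k : G x -> H k -> cls (ecomp x k) = cls x.
Proof.
move=> xG Hk; apply/esym/clsP => //; first by apply: uM_comp => //; exact: HuM_sub.
by rewrite uM_mulKl //; exact: HuM_sub.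
Qed.

Lemma cls_Hmul x k : G x -> H k -> cls (ecomp k x) = cls x.
Proof.
move=> xG Hk; have kG := HuM_sub Hk; have xV := uM_invG xG.
have := HuM_conj xV Hk; rewrite uM_invK // => h.
apply/esym/clsP => //; exact: uM_comp.
Qed.

Definition rep (X : Q) : S := sval (cid2 (cls_surj X)).

Lemma repG X : G (rep X). Proof. by rewrite /rep; case: cid2. Qed.
Lemma repK X : cls (rep X) = X. Proof. by rewrite /rep; case: cid2. Qed.

Definition qmul (X Y : Q) : Q := cls (ecomp (rep X) (rep Y)).
Definition qone : Q := cls u.
Definition qinv (X : Q) : Q := cls (uM_inv (rep X)).

Lemma rep_cls x : G x -> exists2 k, H k & rep (cls x) = ecomp x k.
Proof.
move=> xG; have rG := repG (cls x).
have /(clsP xG rG) h : cls x = cls (rep (cls x)) by rewrite repK.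
by exists (ecomp (uM_inv x) (rep (cls x))) => //; rewrite uM_mulKVl.
Qed.

Lemma qmul_cls x y : G x -> G y -> qmul (cls x) (cls y) = cls (ecomp x y).
Proof.
move=> xG yG; rewrite /qmul.
have [k Hk ->] := rep_cls xG; have [l Hl ->] := rep_cls yG.
have [kG lG] := (HuM_sub Hk, HuM_sub Hl).
rewrite -ecompA cls_mulH //; last by apply: uM_comp => //; exact: uM_comp.
have -> : ecomp (ecomp x k) y = ecomp (ecomp x y) (ecomp (uM_inv y) (ecomp k y)).
  by rewrite (ecompA x y) uM_mulKVl //; exact: uM_comp.
apply: cls_mulH; first exact: uM_comp.
by have := HuM_conj (uM_invG yG) Hk; rewrite uM_invK.
Qed.

Lemma qinv_cls x : G x -> qinv (cls x) = cls (uM_inv x).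
Proof.
move=> xG; rewrite /qinv; have [k Hk ->] := rep_cls xG; have kG := HuM_sub Hk.
rewrite uM_invM // cls_Hmul //; [exact: uM_invG|exact: HuM_inv].
Qed.

Lemma qmulA : associative qmul.
Proof.
move=> X Y Z; have [x xG ->] := cls_surj X; have [y yG ->] := cls_surj Y.
have [z zG ->] := cls_surj Z.
by have [yzG xyG] := (uM_comp yG zG, uM_comp xG yG); rewrite !qmul_cls.
Qed.

Lemma qmul1 : left_id qone qmul.
Proof.
by move=> X; have [x xG ->] := cls_surj X; rewrite /qone qmul_cls ?uM_ul //; exact: uM_u.
Qed.

Lemma qmulV : left_inverse qone qinv qmul.
Proof.
move=> X; have [x xG ->] := cls_surj X.
by have xVG := uM_invG xG; rewrite qinv_cls // qmul_cls // uM_mulVr.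
Qed.

Lemma qmul_val X Y : sval (qmul X Y) = [set ecomp a b | a in sval X & b in sval Y].
Proof.
have [x xG ->] := cls_surj X; have [y yG ->] := cls_surj Y.
rewrite qmul_cls // !cls_val //; last exact: uM_comp.
apply/seteqP; split=> [_ [k Hk <-]|_ [_ [k Hk <-] [_ [l Hl <-] <-]]].
  exists x; first by exists u; [exact: HuM_u|exact: uM_ur].
  by exists (ecomp y k); [exists k|].
have [kG lG] := (HuM_sub Hk, HuM_sub Hl).
exists (ecomp (ecomp (uM_inv y) (ecomp k y)) l).
  by apply: HuM_comp => //; have := HuM_conj (uM_invG yG) Hk; rewrite uM_invK.
by rewrite (ecompA x) -(ecompA y) uM_mulKVl //; exact: uM_comp.
Qed.

Definition pre (B : set Q) : set S := [set x | G x /\ B (cls x)].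

(** The topology is given by a subbase, so one direction checks finite intersections of the
    generating open sets; in the other, [B] is replaced by the set of its underlying cosets, which
    is one of the generators. *)
Lemma closed_uMH (B : set Q) : closed B <-> tau_closed MM u (pre B).
Proof.
split=> [Bc|Bc].
  apply/tau_closedP; split=> [x []//|x xc]; have xG := cl_tau_sub xc.
  split=> //; apply: contrapT => nB.
  have : nbhs (cls x) (~` B) by apply: open_nbhs_nbhs; split=> //; rewrite openC.
  move=> /generated_nbhs[W [fW WF Wx WB]].
  have pc A : W A -> tau_closed MM u [set x | G x /\ ~ A (coset x)].
    move=> /WF[A' A'c <-]; rewrite (_ : mkset _ = [set x | uM MM u x /\ A' (coset x)]) //.
    by apply/seteqP; split=> z [zG h]; split=> //; exact: contrapT.
  have := tau_closed_bigcup_finite fW pc => /cl_tau_min cm.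
  have [|A WA [_ nA]] := cm (pre B) _ x xc.
    move=> z [zG Bz]; apply: contrapT => h; apply: (WB (cls z)) => // A WA.
    rewrite cls_val //; apply: contrapT => nA; apply: h; by exists A.
  by apply: nA; rewrite -cls_val //; exact: Wx.
rewrite -openC; pose A := [set X : set S | exists2 Y, B Y & sval Y = X].
rewrite (_ : ~` B = [set t : Q | (~` A) (sval t)]).
  apply: generated_open; exists A => //.
  suff e : [set x | uM MM u x /\ A (coset x)] = pre B by rewrite /= e.
  apply/seteqP; split=> x [xG].
    by move=> [Y BY]; rewrite -cls_val // => /uMH_ext YE; split=> //; rewrite -YE.
  by split=> //; exists (cls x) => //; exact: cls_val.
apply/seteqP; split=> t /= h; first by move=> [Y BY /uMH_ext Yt]; apply: h; rewrite -Yt.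
by move=> Bt; apply: h; exists t.
Qed.

Lemma uMH_compact : compact [set: Q].
Proof.
move=> F FF _.
pose F' : set_system S := filter_from F pre.
have FF' : ProperFilter F'.
  apply: filter_from_proper; first apply: filter_from_filter.
  - by exists setT; exact: filterT.
  - move=> A B FA FB; exists (A `&` B); first exact: filterI.
    by move=> x [xG [Ax Bx]].
  - by move=> A /filter_ex[X AX]; have [x xG Xx] := cls_surj X; exists x; split=> //; rewrite -Xx.
have [|x [xG xF]] := tau_compact FF'.
  by exists setT; [exact: filterT|move=> x []].
exists (cls x); split=> //; rewrite clusterE => B FB.
have Bc := (closed_uMH _).1 (@closed_closure _ B).
have BG : pre B `<=` G by move=> y [].
have FB' : F' (pre B) by exists B.
have BB : pre B `<=` pre (closure B).
  by move=> y [yG By]; split=> //; exact: subset_closure.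
by have [_] := cl_tau_min Bc BB (xF _ BG FB').
Qed.

Lemma qmul_l X : continuous (qmul X).
Proof.
have [a aG ->] := cls_surj X.
apply/continuous_closedP => B Bc; apply/closed_uMH.
rewrite (_ : pre _ = [set x | G x /\ pre B (ecomp a x)]).
  by apply: tau_closed_mull => //; exact/closed_uMH.
apply/seteqP; split=> x [xG] /=; rewrite ?qmul_cls //.
  by move=> h; do 2!split=> //; exact: uM_comp.
by move=> [_ h]; split=> //=; rewrite qmul_cls.
Qed.

Lemma qmul_r X : continuous (qmul^~ X).
Proof.
have [a aG ->] := cls_surj X.
apply/continuous_closedP => B Bc; apply/closed_uMH.
rewrite (_ : pre _ = [set x | G x /\ pre B (ecomp x a)]).
  by apply: tau_closed_mulr => //; exact/closed_uMH.
apply/seteqP; split=> x [xG] /=; rewrite ?qmul_cls //.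
  by move=> h; do 2!split=> //; exact: uM_comp.
by move=> [_ h]; split=> //=; rewrite qmul_cls.
Qed.

(** By translation only the trivial coset and that of some [c] outside [H] have to be separated.
    Some neighbourhood [O] of [u] has [c] outside its closure; the saturation of [O] and the
    complement of the closure separate them. *)
Lemma uMH_hausdorff : hausdorff_space Q.
Proof.
suff sep c : G c -> ~ H c -> exists A B : set Q,
    [/\ open A, open B, A (cls u), B (cls c) & A `&` B = set0].
  rewrite open_hausdorff => X Y; have [x xG ->] := cls_surj X; have [y yG ->] := cls_surj Y.
  move=> /eqP xy; have xVG := uM_invG xG.
  have cG : G (ecomp (uM_inv x) y) by exact: uM_comp.
  have [|A [B [oA oB Au Bc AB]]] := sep _ cG; first by move=> /(clsP xG yG).
  exists (qmul (cls (uM_inv x)) @^-1` A, qmul (cls (uM_inv x)) @^-1` B) => /=.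
    rewrite !inE /=; split; first by rewrite qmul_cls // uM_mulVr.
    by rewrite qmul_cls.
  split; first by apply: open_comp => // t _; exact: qmul_l.
    by apply: open_comp => // t _; exact: qmul_l.
  by rewrite -preimage_setI AB preimage_set0.
move=> cG nHc.
have [O [Onb nOc]] : exists O, open_nbhs_u O /\ ~ tcl O c.
  apply: contrapT => h; apply: nHc; apply/HuMP => O Onb.
  by apply: contrapT => nc; apply: h; exists O.
have [OG Ou Oc] := Onb.
(* By [HuM_cl] the choice of representative does not matter. *)
pose B := [set Z : Q | tcl O (rep Z)].
have BE z : G z -> B (cls z) <-> tcl O z.
  move=> zG; rewrite /B /=; have [k Hk ->] := rep_cls zG; have kG := HuM_sub Hk.
  have Hk' := HuM_conj zG Hk.
  have -> : ecomp z k = ecomp (ecomp z (ecomp k (uM_inv z))) z.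
    by rewrite (ecompA z) uM_mulKVr.
  split; last exact: HuM_cl.
  move=> /(HuM_cl (HuM_inv Hk') Onb); rewrite uM_mulKl //.
  by apply: uM_comp => //; apply: uM_comp => //; exact: uM_invG.
have Bc : closed B.
  apply/closed_uMH; rewrite (_ : pre B = tcl O); first exact: tau_closed_cl.
  apply/seteqP; split=> z; first by move=> [zG /(BE _ zG)].
  by move=> zO; have zG := cl_tau_sub zO; split=> //; apply/BE.
(* [O] itself need not be a union of cosets; its saturation is a union of translates, hence open. *)
pose A := [set Z : Q | exists2 k, H k & O (ecomp k (rep Z))].
have AE z : G z -> A (cls z) <-> exists2 k, H k & O (ecomp k z).
  move=> zG; rewrite /A /=; have [k Hk ->] := rep_cls zG; have kG := HuM_sub Hk.
  have Hk' := HuM_conj zG Hk.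
  have -> : ecomp z k = ecomp (ecomp z (ecomp k (uM_inv z))) z.
    by rewrite (ecompA z) uM_mulKVr.
  have k'G := HuM_sub Hk'.
  split=> -[l Hl Ol]; first by exists (ecomp l (ecomp z (ecomp k (uM_inv z)))) => //; exact: HuM_comp.
  exists (ecomp l (uM_inv (ecomp z (ecomp k (uM_inv z))))).
    by apply: HuM_comp => //; exact: HuM_inv.
  by rewrite (ecompA l) uM_mulKl.
have oA : open A.
  rewrite -closedC; apply/closed_uMH.
  rewrite (_ : pre _ = G `&` \bigcap_(k in H) [set z | G z /\ (G `\` O) (ecomp k z)]).
    by apply: tau_closed_bigcap => k Hk; apply: tau_closed_mull => //; exact: HuM_sub.
  apply/seteqP; split=> z [zG h]; split=> //.
    move=> k Hk; split=> //; split; first by apply: uM_comp => //; exact: HuM_sub.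
    by move=> Ok; apply: h; apply/AE => //; exists k.
  by move=> /(AE _ zG)[k Hk Ok]; have [_ [_]] := h k Hk; apply.
exists A, (~` B); split=> //.
- by rewrite openC.
- by apply/AE; [exact: uM_u|exists u; [exact: HuM_u|rewrite u_idem]].
- by move=> /(BE _ cG).
- apply/seteqP; split=> // Z; have [z zG ->] := cls_surj Z.
  move=> [/(AE _ zG)[k Hk Ok]]; apply; apply/BE => //.
  rewrite -(uM_mulKl (HuM_sub Hk) zG); apply: HuM_cl => //; first exact: HuM_inv.
  exact: subset_cl_tau.
Qed.

Lemma uMH_topological_group : topological_group qmul qone qinv.
Proof.
apply: semitop_topological_group; [exact: qmulA|exact: qmul1|exact: qmulV|exact: qmul_l|
  exact: qmul_r|exact: uMH_hausdorff|exact: uMH_compact].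
Qed.

End IdealGroup.

Local Notation cs := (@csort L C).
Local Notation jc := (jcbar j).
Local Notation fC := (formulaC C cs).
Local Notation p0 := (tp_cbar j).

(** * Lascar equivalence and the ideal group *)

(* Only copies of [C] are used as small submodels, so the transitive closure [lasc]
   of [Theta] is possibly finer than Lascar equivalence. *)
Definition Theta (b d : tup C' cs) :=
  exists n, same_type n jc /\ same_type (tcat b n) (tcat d n).

Fixpoint thetaN k (b d : tup C' cs) :=
  if k is k'.+1 then exists e, Theta b e /\ thetaN k' e d else b = d.

Definition lasc (b d : tup C' cs) := exists k, thetaN k b d.

Lemma Theta_sym (b d : tup C' cs) : Theta b d -> Theta d b.
Proof. by move=> [n [nj bd]]; exists n; split=> // phi; split=> /bd. Qed.

Lemma same_type_tmap (g : smap C' C') I (x : I -> lsort L) (v w : tup C' x) :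
  Aut C' g -> same_type v w -> same_type (tmap g v) (tmap g w).
Proof. by move=> gA vw phi; rewrite -!(Aut_elementary gA). Qed.

Lemma Theta_aut g (b d : tup C' cs) : Aut C' g -> Theta b d -> Theta (tmap g b) (tmap g d).
Proof.
move=> gA [n [nj bd]]; exists (tmap g n); split; first exact: same_type_aut.
by rewrite -!tmap_tcat; exact: same_type_tmap.
Qed.

Lemma Theta_lasc (b d : tup C' cs) : Theta b d -> lasc b d.
Proof. by move=> bd; exists 1; exists d. Qed.

Lemma lasc_refl (b : tup C' cs) : lasc b b.
Proof. by exists 0. Qed.

Lemma lasc_trans (b e d : tup C' cs) : lasc b e -> lasc e d -> lasc b d.
Proof.
move=> [k bk] [l dl]; elim: k b bk => [b ->|k IH b [f [bf fe]]]; first by exists l.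
by have [m fm] := IH _ fe; exists m.+1; exists f.
Qed.

Lemma lasc_sym (b d : tup C' cs) : lasc b d -> lasc d b.
Proof.
move=> [k bk]; elim: k b bk => [b ->|k IH b [f [/Theta_sym bf /IH fe]]]; first exact: lasc_refl.
exact: lasc_trans fe (Theta_lasc bf).
Qed.

Lemma lasc_aut g (b d : tup C' cs) : Aut C' g -> lasc b d -> lasc (tmap g b) (tmap g d).
Proof.
move=> gA [k bk]; elim: k b bk => [b ->|k IH b [f [bf /IH fe]]]; first exact: lasc_refl.
exact: lasc_trans (Theta_lasc (Theta_aut gA bf)) fe.
Qed.

Lemma Theta_tpC (b d : tup C' cs) : tpC j b = tpC j d -> Theta b d.
Proof.
move=> bd; exists jc; split=> // phi.
by have -> : sat phi (tcat b jc) = tpC j b phi by []; rewrite bd.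
Qed.

Lemma cs2_small : small K' [set: {s : lsort L & C s} + {s : lsort L & C s}].
Proof. by have [lim _ _ _] := C'_monster; exact: (small_sum lim C_small C_small). Qed.

Lemma Theta_rep (b d : tup C' cs) : Theta b d ->
  exists t n, [/\ Aut C' t, same_type n jc, tmap t n = n & tmap t b = d].
Proof.
move=> [n [nj bd]]; have [t tA] := extend_tuple_aut C'_monster cs2_small bd.
by rewrite tmap_tcat => /tcat_inj[tb tn]; exists t, n.
Qed.

Lemma fixing_Theta t n (b : tup C' cs) : Aut C' t -> same_type n jc -> tmap t n = n -> Theta b (tmap t b).
Proof.
move=> tA nj tn; exists n; split=> // phi.
by rewrite (Aut_elementary tA) tmap_tcat tn.
Qed.

Lemma tmap_comp (g h : smap C' C') I (x : I -> lsort L) (v : tup C' x) :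
  tmap (scomp g h) v = tmap g (tmap h v).
Proof. by []. Qed.

Lemma Aut_quotient g g' : Aut C' g -> Aut C' g' ->
  exists2 h, Aut C' h & g' = scomp g h.
Proof.
move=> gA g'A; have [k [kA gk kg]] := Aut_inv gA.
exists (scomp k g'); first exact: Aut_comp.
apply: smap_ext => s a; have : scomp g k (g' s a) = g' s a by rewrite gk.
by rewrite /scomp.
Qed.

(* Automorphisms taking [C] to Lascar equivalent copies differ by pointwise
   stabilizers: on the right of [C] itself, on the left of other copies of [C]. *)
Lemma lasc_ind (P : smap C' C' -> smap C' C' -> Prop) :
  (forall g h, Aut C' g -> Aut C' h -> tmap h jc = jc -> P g (scomp g h)) ->
  (forall g t n, Aut C' g -> Aut C' t -> same_type n jc -> tmap t n = n -> P g (scomp t g)) ->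
  (forall g h k, P g h -> P h k -> P g k) ->
  forall g g', Aut C' g -> Aut C' g' -> lasc (tmap g jc) (tmap g' jc) -> P g g'.
Proof.
move=> P1 P2 Ptr g g' + g'A [k]; elim: k g => [|k IH] g gA.
  move=> e; have [h hA g'E] := Aut_quotient gA g'A; rewrite g'E; apply: P1 => //.
  apply: tup_ext => i; apply: (Aut_inj gA).
  by have := congr1 (fun t : tup C' cs => t i) e; rewrite g'E.
move=> [e [/Theta_rep[t [n [tA nj tn te]]] ke]].
apply: (Ptr _ (scomp t g)); first exact: (P2 _ _ n).
by apply: IH; [exact: Aut_comp|rewrite tmap_comp te].
Qed.

(** Automorphisms agreeing on [C] up to Lascar equivalence agree so on every tuple; this makes the
    passage to Lascar classes multiplicative. *)
Lemma lasc_transfer g g' t : Aut C' g -> Aut C' g' ->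
  lasc (tmap g jc) (tmap g' jc) -> lasc (tmap g t) (tmap g' t).
Proof.
move=> gA g'A; move: gA g'A.
apply: (lasc_ind (P := fun g g' => lasc (tmap g t) (tmap g' t))) => {}g.
- move=> h gA hA hj; rewrite tmap_comp; apply: lasc_aut => //.
  by apply: Theta_lasc; exact: fixing_Theta hj.
- move=> h n gA hA nj hn; rewrite tmap_comp; apply: Theta_lasc.
  exact: fixing_Theta nj hn.
- by move=> h k; exact: lasc_trans.
Qed.

Definition Rep (x : S) (g : smap C' C') := Aut C' g /\ sval (x p0) = tpC j (tmap g jc).

Lemma Rep_ex x : exists g, Rep x g.
Proof. by have [g gA e] := Sc_rep_aut C'_monster C_small (x p0); exists g. Qed.

Lemma Rep_lasc x g g' : Rep x g -> Rep x g' -> lasc (tmap g jc) (tmap g' jc).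
Proof. by move=> [_ e] [_ e']; apply/Theta_lasc/Theta_tpC; rewrite -e -e'. Qed.

Lemma Sc_eq_tpC (r : Sc j) (b : tup C' cs) :
  (forall phi, sval r phi -> satC j phi b) -> sval r = tpC j b.
Proof.
move=> h; apply/seteqP; split=> phi; first exact: h.
move=> bphi; apply: contrapT => /Sc_not/h; exact.
Qed.

(** * Realizing limits of types together with relations between their realizations *)

Section RealizeLimit.
Variables (Z : Type) (zc : Z -> lsort L) (Z_small : small K' [set: Z]).

Definition lift_fst (k : {s : lsort L & C s} + {s : lsort L & C s}) :
    term (scat (scat (scat cs cs) zc) cs) (scat cs cs k) :=
  match k return term (scat (scat (scat cs cs) zc) cs) (scat cs cs k) with
  | inl i => tvar (scat (scat (scat cs cs) zc) cs) (inl (inl (inl i)))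
  | inr i => tvar (scat (scat (scat cs cs) zc) cs) (inr i)
  end.

Definition lift_snd (k : {s : lsort L & C s} + {s : lsort L & C s}) :
    term (scat (scat (scat cs cs) zc) cs) (scat cs cs k) :=
  match k return term (scat (scat (scat cs cs) zc) cs) (scat cs cs k) with
  | inl i => tvar (scat (scat (scat cs cs) zc) cs) (inl (inl (inr i)))
  | inr i => tvar (scat (scat (scat cs cs) zc) cs) (inr i)
  end.

Lemma sat_lift_fst (phi : fC) (b d : tup C' cs) (t : tup C' zc) :
  satC j (fsubst lift_fst phi) (tcat (tcat b d) t) <-> satC j phi b.
Proof.
rewrite /satC sat_subst (_ : (fun k => _) = tcat b jc) //.
by apply: tup_ext => -[].
Qed.

Lemma sat_lift_snd (phi : fC) (b d : tup C' cs) (t : tup C' zc) :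
  satC j (fsubst lift_snd phi) (tcat (tcat b d) t) <-> satC j phi d.
Proof.
rewrite /satC sat_subst (_ : (fun k => _) = tcat d jc) //.
by apply: tup_ext => -[].
Qed.

(** Phrased in terms of lifted formulas so that it applies directly to the finite sets produced by
    compactness. *)
Lemma nbhs_lift (X : Type) (f : fC -> X) (r : Sc j) (q : set X) : finite_set q ->
  nbhs r [set r' : Sc j | forall theta, q theta ->
    (exists psi, theta = f psi /\ sval r psi) -> exists psi, theta = f psi /\ sval r' psi].
Proof.
move=> fq; apply: (filter_forall_finite (F := nbhs r) (P := fun theta =>
  [set r' : Sc j | (exists psi, theta = f psi /\ sval r psi) ->
     exists psi, theta = f psi /\ sval r' psi])) => // theta _.
have [[psi [-> rpsi]]|nE] := pselect (exists psi, theta = f psi /\ sval r psi); last first.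
  by apply: filterS filterT => r' _ /nE.
have : nbhs r [set r' : Sc j | sval r' psi].
  by apply: open_nbhs_nbhs; split; [exact: Sc_open|].
by apply: filterS => r' r'psi _; exists psi.
Qed.

(** A relation given by [Xi] and an auxiliary tuple, if it holds finitely often arbitrarily close to
    [r1] and [r2], holds between realizations of [r1] and [r2]: this is saturation of [C'] for the
    two types over [C] together with [Xi]. *)
Lemma realize_limit (r1 r2 : Sc j) (Xi : set (formula (scat (scat cs cs) zc))) :
  (forall U1 U2 Xi0, nbhs r1 U1 -> nbhs r2 U2 -> finite_set Xi0 -> Xi0 `<=` Xi ->
    exists (s1 s2 : Sc j) b d t, [/\ U1 s1 /\ U2 s2, sval s1 = tpC j b, sval s2 = tpC j d &
      forall phi, Xi0 phi -> sat phi (tcat (tcat b d) t)]) ->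
  exists b d t, [/\ sval r1 = tpC j b, sval r2 = tpC j d &
    forall phi, Xi phi -> sat phi (tcat (tcat b d) t)].
Proof.
move=> h; have [lim _ _ _] := C'_monster.
pose P : set (formulaC C (scat (scat cs cs) zc)) := [set theta | (exists psi, theta = fsubst lift_fst psi /\ sval r1 psi) \/
  (exists psi, theta = fsubst lift_snd psi /\ sval r2 psi) \/
  (exists phi, theta = weaken C phi /\ Xi phi)].
have sW := small_sum lim cs2_small Z_small.
have [a aP] : exists a : tup C' (scat (scat cs cs) zc), forall phi, P phi -> satC j phi a.
  apply: (realize_over_C C'_monster C_small sW) => q fq qP.
  have /choice[f fP] theta : exists phi, (exists phi, theta = weaken C phi /\ Xi phi) ->
      theta = weaken C phi /\ Xi phi.
    have [[phi ?]|nE] := pselect (exists phi, theta = weaken C phi /\ Xi phi).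
      by exists phi.
    by exists (fFalse _).
  pose q3 := q `&` [set theta | exists phi, theta = weaken C phi /\ Xi phi].
  have [||s1 [s2 [b [d [t [[U1s1 U2s2] e1 e2 Xt]]]]]] := h _ _ (f @` q3)
    (nbhs_lift (fsubst lift_fst) r1 fq) (nbhs_lift (fsubst lift_snd) r2 fq).
  - by apply: finite_image; exact: finite_setIl.
  - by move=> _ [theta [_ /fP[_ Xf]] <-].
  exists (tcat (tcat b d) t) => theta qt; have [k1|[k2|k3]] := qP _ qt.
  - have [psi [-> s1psi]] := U1s1 _ qt k1; apply/sat_lift_fst.
    by move: s1psi; rewrite e1.
  - have [psi [-> s2psi]] := U2s2 _ qt k2; apply/sat_lift_snd.
    by move: s2psi; rewrite e2.
  - have [te _] := fP _ k3; rewrite te; apply/sat_weaken; apply: Xt.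
    by exists theta.
pose b : tup C' cs := fun i => a (inl (inl i)); pose d : tup C' cs := fun i => a (inl (inr i)).
pose t : tup C' zc := fun i => a (inr i).
have ea : a = tcat (tcat b d) t by apply: tup_ext => -[[]|].
exists b, d, t; split=> [| |phi Xphi].
- apply: Sc_eq_tpC => phi r1phi; apply/(sat_lift_fst _ _ d t); rewrite -ea; apply: aP.
  by left; exists phi.
- apply: Sc_eq_tpC => phi r2phi; apply/(sat_lift_snd _ b _ t); rewrite -ea; apply: aP.
  by right; left; exists phi.
- by rewrite -ea; apply/sat_weaken/aP; right; right; exists phi.
Qed.

(** The extension of [g] to [C'] moves the realization [a], the copy [jcbar] and the witness [t]
    simultaneously. In the limit [a] becomes a realization of [x p0] and [jcbar] one of [p p0]. *)
Lemma circ_limit p A x (Xi : set (formula (scat (scat cs cs) zc))) : circ p A x ->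
  (forall eta, A eta -> exists a t, sval (eta p0) = tpC j a /\
     forall phi, Xi phi -> sat phi (tcat (tcat a jc) t)) ->
  exists b d t, [/\ sval (x p0) = tpC j b, sval (p p0) = tpC j d &
    forall phi, Xi phi -> sat phi (tcat (tcat b d) t)].
Proof.
move=> /circP[_ h] AXi; apply: realize_limit => U1 U2 Xi0 U1x U2p _ Xi0s.
have [g [eta [gA etaA U2g U1g]]] := h _ _ (@ptws_eval_continuous _ _ p0 p _ U2p)
  (@ptws_eval_continuous _ _ p0 x _ U1x).
have [a [t [ea at_]]] := AXi _ etaA.
have [k [k' [_ k'A _ _ gk']]] := AutEL_ext C'_monster j_elem C_small gA.
exists (g (eta p0)), (g p0), (tmap k' a), (tmap k' jc), (tmap k' t); split=> //.
- exact: gk'.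
- exact: gk'.
- by move=> phi /Xi0s/at_; rewrite (Aut_elementary k'A) !tmap_tcat.
Qed.

End RealizeLimit.

(** [x y] is a limit of [g y] with [g] tending to [x], and the type of the pair [(s cbar, cbar)] is
    kept in the limit. The automorphism realizing this pair elsewhere represents [x], and composed
    with [s] it represents [x y]. *)
Lemma Rep_mul x y s : ELC x -> ELC y -> Rep y s ->
  exists2 t, Rep x t & Rep (ecomp x y) (scomp t s).
Proof.
move=> xE yE [sA ys].
have c : circ x [set y] (ecomp x y).
  apply/circP; split; first exact: EL_comp.
  move=> U W Ux Wxy; have Wx := @ecomp_continuousr _ _ _ _ y x _ Wxy.
  by have [g [gA [Ug Wg]]] := xE _ (filterI Ux Wx); exists g, y; split.
pose t0 : tup C' (of_void (lsort L)) := fun v => match v with end.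
have sV : small K' [set: void].
  have [lim _ _ _] := C'_monster; apply: (small_finite lim).
  by rewrite (_ : [set: void] = set0); [exact: finite_set0|apply/seteqP; split=> -[]].
have [|b [d [t [xyb xd Xt]]]] := circ_limit (zc := of_void (lsort L)) sV
    (Xi := [set phi | sat phi (tcat (tcat (tmap s jc) jc) t0)]) c.
  by move=> _ ->; exists (tmap s jc), t0; split.
have st : same_type (tcat (tmap s jc) jc) (tcat b d).
  have key (phi : formula (scat cs cs)) :
      sat phi (tcat (tmap s jc) jc) -> sat phi (tcat b d).
    move=> h.
    have := Xt (fsubst (fun k => tvar (scat (scat cs cs) (of_void (lsort L))) (inl k)) phi).
    by rewrite /= !sat_subst; apply.
  move=> phi; split; first exact: key.
  by move=> h; apply: contrapT => n; apply: (key (fNot phi) n).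
have [k kA] := extend_tuple_aut C'_monster cs2_small st.
rewrite tmap_tcat => /tcat_inj[kb kd].
exists k; split=> //; first by rewrite kd.
  exact: Aut_comp.
by rewrite tmap_comp kb.
Qed.

(** * Lascar equivalence on the Ellis semigroup *)

Definition eqv x y := exists g h, [/\ Rep x g, Rep y h & lasc (tmap g jc) (tmap h jc)].

Lemma eqvP x y g h : eqv x y -> Rep x g -> Rep y h -> lasc (tmap g jc) (tmap h jc).
Proof.
move=> [g' [h' [xg' yh' l]]] xg yh.
exact: lasc_trans (Rep_lasc xg xg') (lasc_trans l (Rep_lasc yh' yh)).
Qed.

Lemma eqv_refl x : eqv x x.
Proof. by have [g xg] := Rep_ex x; exists g, g; split=> //; exact: lasc_refl. Qed.

Lemma eqv_sym x y : eqv x y -> eqv y x.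
Proof. by move=> [g [h [xg yh l]]]; exists h, g; split=> //; exact: lasc_sym. Qed.

Lemma eqv_trans x y z : eqv x y -> eqv y z -> eqv x z.
Proof.
move=> [g [h [xg yh l]]] yz; have [k zk] := Rep_ex z; exists g, k; split=> //.
exact: lasc_trans l (eqvP yz yh zk).
Qed.

Lemma eqv_mul x x' y y' : ELC x -> ELC x' -> ELC y -> ELC y' ->
  eqv x x' -> eqv y y' -> eqv (ecomp x y) (ecomp x' y').
Proof.
move=> xE xE' yE yE' xx yy; have [s ys] := Rep_ex y; have [s' ys'] := Rep_ex y'.
have [t xt xyts] := Rep_mul xE yE ys; have [t' xt' xyts'] := Rep_mul xE' yE' ys'.
exists (scomp t s), (scomp t' s'); split=> //.
rewrite (tmap_comp t s) (tmap_comp t' s').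
apply: lasc_trans (lasc_aut _ (eqvP yy ys ys')) _; first by case: xt.
by apply: lasc_transfer; [case: xt|case: xt'|exact: eqvP xx xt xt'].
Qed.

Lemma Rep_id : Rep id (@sid L C').
Proof. by split; first exact: Aut_id. Qed.

(** The class of [u] is an idempotent, and a representing automorphism can be cancelled. *)
Lemma eqv_u : eqv u id.
Proof.
have uE := MM_EL u_MM; have [s us] := Rep_ex u; have [sA _] := us.
have [t ut uts] := Rep_mul uE uE us; rewrite u_idem in uts.
exists s, (@sid L C'); split=> //; first exact: Rep_id.
have [tA _] := ut.
have l : lasc (tmap s (tmap s jc)) (tmap s jc).
  apply: lasc_trans (lasc_transfer (tmap s jc) sA tA (Rep_lasc us ut)) _.
  exact: Rep_lasc uts us.
have [k [kA sk ks]] := Aut_inv sA; have := lasc_aut kA l.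
have ksE (v : tup C' cs) : tmap k (tmap s v) = v by rewrite -(tmap_comp k s) ks.
by rewrite !ksE.
Qed.

Lemma eqv_um m : ELC m -> eqv (ecomp u m) m.
Proof.
move=> mE; apply: (eqv_mul (MM_EL u_MM) _ mE mE eqv_u (eqv_refl m)).
exact/AutEL_EL/AutEL_id.
Qed.

Lemma eqv_types x y (b d : tup C' cs) : sval (x p0) = tpC j b -> sval (y p0) = tpC j d ->
  lasc b d -> eqv x y.
Proof.
move=> xb yd bd; have [g xg] := Rep_ex x; have [h yh] := Rep_ex y.
exists g, h; split=> //; have [_ gb] := xg; have [_ hd] := yh.
apply: lasc_trans (lasc_trans _ bd) _; apply/Theta_lasc/Theta_tpC.
  by rewrite -gb.
by rewrite -yd.
Qed.

(* All the consequences of the type-definable relation below, so that its defining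
   formulas need not be written explicitly. *)
Definition Theta_formulas : set (formula (scat (scat cs cs) cs)) :=
  [set phi | forall b d n : tup C' cs, same_type n jc -> same_type (tcat b n) (tcat d n) ->
     sat phi (tcat (tcat b d) n)].

(** The consequences include [phi(n)] for every [phi] true of [C], and the implications from
    [phi(b, n)] to [phi(d, n)]. *)
Lemma Theta_formulasP (b d n : tup C' cs) :
  (forall phi, Theta_formulas phi -> sat phi (tcat (tcat b d) n)) -> Theta b d.
Proof.
pose w := scat (scat cs cs) cs.
move=> h; exists n; split.
  have key (phi : formula cs) : sat phi jc -> sat phi n.
    move=> pj; have := h (fsubst (fun i => tvar w (inr i)) phi).
    by rewrite sat_subst; apply=> b' d' n' n'j _; apply/sat_subst/n'j.
  move=> phi; split; last exact: key.
  by move=> nphi; apply: contrapT => nj; apply: (key (fNot phi) nj).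
pose v1 (k : {s & C s} + {s & C s}) : term w (scat cs cs k) :=
  match k return term w (scat cs cs k) with
  | inl i => tvar w (inl (inl i)) | inr i => tvar w (inr i) end.
pose v2 (k : {s & C s} + {s & C s}) : term w (scat cs cs k) :=
  match k return term w (scat cs cs k) with
  | inl i => tvar w (inl (inr i)) | inr i => tvar w (inr i) end.
have v1P (b' d' n' : tup C' cs) phi :
    sat (fsubst v1 phi) (tcat (tcat b' d') n') <-> sat phi (tcat b' n').
  rewrite sat_subst (_ : (fun k => _) = tcat b' n') //.
  by apply: tup_ext => -[].
have v2P (b' d' n' : tup C' cs) phi :
    sat (fsubst v2 phi) (tcat (tcat b' d') n') <-> sat phi (tcat d' n').
  rewrite sat_subst (_ : (fun k => _) = tcat d' n') //.
  by apply: tup_ext => -[].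
have key phi : sat phi (tcat b n) -> sat phi (tcat d n).
  move=> pb; have := h (fImp (fsubst v1 phi) (fsubst v2 phi)).
  rewrite /= v1P v2P; apply=> // b' d' n' _ bd /v1P pb'.
  by apply/v2P/bd.
move=> phi; split; first exact: key.
by move=> pd; apply: contrapT => nb; apply: (key (fNot phi) nb).
Qed.

Definition ThetaR : set (Sc j * Sc j) :=
  [set t | exists b d, [/\ sval t.1 = tpC j b, sval t.2 = tpC j d & Theta b d]].

(** The copy of [C] witnessing [Theta] is the auxiliary tuple of [realize_limit]. *)
Lemma ThetaR_closed : closed ThetaR.
Proof.
move=> [r1 r2] h.
have [U1 U2 Xi0 U1r U2r _ Xi0s|b [d [n [br dr bdn]]]] :=
    @realize_limit _ cs C_small r1 r2 Theta_formulas.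
  have [|[s1 s2] [[b [d [/= s1b s2d [n [nj bd]]]]] [/= U1s U2s]]] := h (U1 `*` U2).
    by exists (U1, U2).
  by exists s1, s2, b, d, n; split=> // phi /Xi0s; apply.
by exists b, d; split=> //; exact: Theta_formulasP bdn.
Qed.

Fixpoint Theta_nbhd k (Qs : set (Sc j)) : set (Sc j) :=
  if k is k'.+1 then [set r | exists2 q, Theta_nbhd k' Qs q & ThetaR (r, q)] else Qs.

(** Each step is the projection of a closed set along a compact space. *)
Lemma Theta_nbhd_closed k Qs : closed Qs -> closed (Theta_nbhd k Qs).
Proof.
move=> Qc; elim: k => [//|k IH] /=.
have Tc : closed (ThetaR `&` [set t | Theta_nbhd k Qs t.2]).
  apply: closedI; first exact: ThetaR_closed.
  rewrite (_ : mkset _ = snd @^-1` Theta_nbhd k Qs) //.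
  by apply: closed_comp => // t _; exact: cvg_snd.
rewrite (_ : mkset _ = fst @` (ThetaR `&` [set t | Theta_nbhd k Qs t.2])).
  apply: compact_closed; first exact: Sc_hausdorff.
  apply: continuous_compact; first by apply: continuous_subspaceT => t; exact: cvg_fst.
  apply: (subclosed_compact Tc _ (@subsetT _ _)).
  have cS : compact [set: Sc j] by exact: (Sc_compact C'_monster C_small).
  by have := compact_setX cS cS; rewrite setXTT.
apply/seteqP; split=> [r [q qQ rq]|_ [[r q] /= [rq qQ] <-]]; last by exists q.
by exists (r, q).
Qed.

Lemma Theta_nbhd_lasc (r : Sc j) Qs :
  (exists k, Theta_nbhd k Qs r) <->
  exists q b d, [/\ Qs q, sval r = tpC j b, sval q = tpC j d & lasc b d].
Proof.
split=> [[k]|[q [b [d [qQ rb qd [k bd]]]]]].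
  elim: k r => [|k IH] r /=.
    move=> rQ; have [b [_ rb]] := Sc_rep r.
    by exists r, b, b; split=> //; exact: lasc_refl.
  move=> [q /IH[q' [b [d [q'Q qb q'd bd]]]] [b' [d' [/= rb' qd' bd']]]].
  exists q', b', d; split=> //; apply: lasc_trans (Theta_lasc bd') _.
  by apply: lasc_trans bd; apply/Theta_lasc/Theta_tpC; rewrite -qd'.
exists k; elim: k r b rb bd => [|k IH] r b rb /=.
  by move=> bd; rewrite (_ : r = q) //; apply: Sc_ext; rewrite rb bd.
move=> [e [be ed]].
(* The next tuple of the chain must again give a point of the type space, so the type of [cbar] has
   to be carried along. *)
have st : same_type e jc.
  have [b' [b'j rb']] := Sc_rep r; have [t [n [tA nj tn te]]] := Theta_rep be.
  rewrite -te; apply: same_type_aut => // phi.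
  rewrite -b'j -!(sat_weaken j).
  have -> : satC j (weaken C phi) b = tpC j b (weaken C phi) by [].
  have -> : satC j (weaken C phi) b' = tpC j b' (weaken C phi) by [].
  by rewrite -rb -rb'.
by exists (Sc_of st); [exact: IH ed|exists b, e; split].
Qed.

(* For a formula [phi] satisfied by all pairs with the same type over [C], the
   elements [x] with [phi(x(tp(C/C)), C)] form a neighborhood [V] of [u]; elements of
   [cl_tau V] then satisfy [phi] with respect to realizations of [u(tp(C/C))]. *)
Lemma HuM_eqv k : H k -> eqv k u.
Proof.
move=> Hk; have uE := MM_EL u_MM.
suff [b [d [n [kb ud h]]]] : exists b d n, [/\ sval (k p0) = tpC j b, sval (u p0) = tpC j d &
    forall phi, Theta_formulas phi -> sat phi (tcat (tcat b d) n)].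
  exact: eqv_types kb ud (Theta_lasc (Theta_formulasP h)).
apply: realize_limit; first exact: C_small.
(* The approximating types are the limits themselves; only the finitely many formulas of [Xi0]
   matter. *)
move=> U1 U2 Xi0 U1k U2u fXi Xis; exists (k p0), (u p0).
suff [b [d [n [kb ud h]]]] : exists b d n, [/\ sval (k p0) = tpC j b, sval (u p0) = tpC j d &
    forall phi, Xi0 phi -> sat phi (tcat (tcat b d) n)].
  by exists b, d, n; split=> //; split; [exact: nbhs_singleton U1k|exact: nbhs_singleton U2u].
have [phi phiP] := formula_conj fXi.
have [rho rhoP] := formula_ex phi (range inr).
have rhoE (b d n : tup C' cs) : sat rho (tcat (tcat b d) n) <->
    exists n', sat phi (tcat (tcat b d) n').
  rewrite rhoP; split=> [[w [wv pw]]|[n' pn']].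
    exists (fun i => w (inr i)); rewrite (_ : tcat _ _ = w) //.
    by apply: tup_ext => -[i|//] /=; rewrite wv // => -[].
  exists (tcat (tcat b d) n'); split=> // -[//|i] [].
  by exists i.
pose V := [set x | G x /\ exists a n, sval (x p0) = tpC j a /\ sat phi (tcat (tcat a jc) n)].
have VG : V `<=` G by move=> x [].
have WG : G `\` V `<=` G by move=> x [].
(* Otherwise [fNot rho] would hold for two realizations of [u p0]. They have the same type over [C],
   so [jcbar] witnesses [rho] for them. *)
have uW : ~ tcl (G `\` V) u.
  move=> [uW _]; have [|b [d [n [ub ud h]]]] :=
      circ_limit (zc := cs) C_small (Xi := [set fNot rho]) uW.
    move=> eta [etaG nV]; have [a [_ ea]] := Sc_rep (eta p0); exists a, jc; split=> // _ ->.
    by move=> /rhoE[n pn]; apply: nV; split=> //; exists a, n.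
  have := h _ erefl; apply; apply/rhoE; exists jc; apply/phiP => psi /Xis; apply=> // chi.
  have -> : sat chi (tcat b jc) = tpC j b chi by [].
  by rewrite -ub ud.
pose O := G `\` tcl (G `\` V).
have OV : O `<=` V.
  move=> x [xG nx]; apply: contrapT => nV; apply: nx.
  by apply: subset_cl_tau => //; split.
have Onb : open_nbhs_u O.
  split; [by move=> x []|by split=> //; exact: uM_u|].
  by rewrite setDD_G; [exact: tau_closed_cl|exact: cl_tau_sub].
have [kO _] := (HuMP k).1 Hk _ Onb.
have [eta /OV[_ [a [n [ea pn]]]]|b [d [n [kb ud h]]]] :=
    circ_limit (zc := cs) C_small (Xi := [set phi]) kO.
  by exists a, n; split=> // _ ->.
by exists b, d, n; split=> //; apply/phiP; exact: h.
Qed.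

(** * Closedness of the fibre over a tau-closed subgroup *)

Section ClosedFiber.
Variable A : set S.
Hypotheses (A_closed : tau_closed MM u A) (A_u : A u).
Hypothesis A_mul : forall x y, A x -> A y -> A (ecomp x y).
Hypothesis A_inv : forall x, A x -> A (uM_inv x).
Hypothesis A_eqv : forall x, G x -> eqv x u -> A x.

Local Notation Q := (uMH MM u).

Let AG : A `<=` G. Proof. by have [] := A_closed. Qed.

Let HA k : H k -> A k.
Proof. by move=> Hk; apply: A_eqv; [exact: HuM_sub|exact: HuM_eqv]. Qed.

Let Abar : set Q := [set X | A (rep X)].

Let AbarP x : G x -> Abar (cls x) <-> A x.
Proof.
move=> xG; rewrite /Abar /=; have [k Hk ->] := rep_cls xG.
split=> h; last by apply: A_mul => //; exact: HA.
by rewrite -(uM_mulKr (HuM_sub Hk) xG); apply: A_mul => //; exact/A_inv/HA.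
Qed.

Let Abar_closed : closed Abar.
Proof.
apply/closed_uMH; rewrite (_ : pre Abar = A) //.
apply/seteqP; split=> x; first by move=> [xG /(AbarP xG)].
by move=> Ax; have xG := AG Ax; split=> //; apply/AbarP.
Qed.

Let Abar_mul X Y : Abar X -> Abar Y -> Abar (qmul X Y).
Proof.
have [x xG ->] := cls_surj X; have [y yG ->] := cls_surj Y.
move=> /(AbarP xG) Ax /(AbarP yG) Ay; rewrite qmul_cls //.
by apply/AbarP; [exact: uM_comp|exact: A_mul].
Qed.

Let Abar_inv X : Abar X -> Abar (qinv X).
Proof.
have [x xG ->] := cls_surj X => /(AbarP xG) Ax; rewrite qinv_cls //.
by apply/AbarP; [exact: uM_invG|exact: A_inv].
Qed.

Let Q_compact_closed (B : set Q) : closed B -> compact B.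
Proof. by move=> Bc; apply: (subclosed_compact Bc uMH_compact); exact: subsetT. Qed.

Let qmulVr X : qmul X (qinv X) = qone.
Proof. exact: (semitop_mulVr qmulA qmul1 qmulV). Qed.

Let qmul1r X : qmul X qone = X.
Proof. exact: (semitop_mul1r qmulA qmul1 qmulV). Qed.

Let qmulK X Y : qmul (qinv X) (qmul X Y) = Y.
Proof. by rewrite qmulA qmulV qmul1. Qed.

Let qmulVK X Y : qmul X (qmul (qinv X) Y) = Y.
Proof. by rewrite qmulA qmulVr qmul1. Qed.

Let qmul_continuous : continuous (fun t : Q * Q => qmul t.1 t.2).
Proof. by have [] := uMH_topological_group. Qed.

Let qinv_continuous : continuous qinv.
Proof. by have [] := uMH_topological_group. Qed.

Let qmul_continuous2 (T : topologicalType) (f g : T -> Q) :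
  continuous f -> continuous g -> continuous (fun t => qmul (f t) (g t)).
Proof.
move=> fc gc; exact: (comp_continuous (pair_continuous fc gc) qmul_continuous).
Qed.

Let image_closed (B1 B2 : set Q) (f : Q * Q -> Q) : closed B1 -> closed B2 ->
  continuous f -> closed (f @` (B1 `*` B2)).
Proof.
move=> c1 c2 fc; apply: compact_closed; first exact: uMH_hausdorff.
apply: continuous_compact; first by apply: continuous_subspaceT => t; exact: fc.
exact: compact_setX (Q_compact_closed c1) (Q_compact_closed c2).
Qed.

(** The elements [qmul (qmul (qinv a) c) (qinv a')] form a compact set, which misses one because [c]
    is outside the subgroup; continuity of the quotient of two elements at one gives [D]. *)
Let small_nbhd c : ~ Abar c -> exists D : set Q, [/\ closed D, nbhs qone D &
  forall a a' d d', Abar a -> Abar a' -> D d -> D d' ->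
    qmul a (qmul (qinv d) (qmul d' a')) <> c].
Proof.
move=> nc; pose f (t : Q * Q) := qmul (qmul (qinv t.1) c) (qinv t.2).
have fc : continuous f.
  apply: qmul_continuous2; last exact: comp_continuous (@snd_continuous _ _) qinv_continuous.
  apply: qmul_continuous2; last exact: cst_continuous.
  exact: comp_continuous (@fst_continuous _ _) qinv_continuous.
have Nc := image_closed Abar_closed Abar_closed fc.
pose N := ~` (f @` (Abar `*` Abar)).
have N1 : nbhs qone N.
  apply: open_nbhs_nbhs; split; first by rewrite openC.
  move=> [[a a'] [/= Aa Aa'] e]; apply: nc.
  have -> : c = qmul a a'; last exact: Abar_mul.
  have := congr1 (fun X => qmul a (qmul X a')) e; rewrite /f /= qmul1.
  by rewrite -(qmulA _ (qinv a')) qmulV qmul1r qmulVK.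
pose g (t : Q * Q) := qmul (qinv t.1) t.2.
have gc : continuous g.
  apply: qmul_continuous2; last exact: snd_continuous.
  exact: comp_continuous (@fst_continuous _ _) qinv_continuous.
have [|[P1 P2] [/= P11 P21] PN] := gc (qone, qone) N.
  by rewrite /g /= qmulV.
have oP := open_interior (P1 `&` P2).
have [D [oD D1 DP]] := semitop_regular uMH_hausdorff uMH_compact oP (filterI P11 P21).
exists (closure D); split; first exact: closed_closure.
  by apply: filterS (open_nbhs_nbhs (conj oD D1)); exact: subset_closure.
move=> a a' d d' Aa Aa' /DP/interior_subset[dP _] /DP/interior_subset[_ dP'] e.
apply: (PN (d, d')) => //; exists (a, a') => //=.
rewrite /f /g /= -e -!qmulA qmulVr qmul1r qmulK.
by [].
Qed.

Let fib (b : Q) (D : set Q) : set S :=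
  pre [set X | exists d a, [/\ D d, Abar a & X = qmul b (qmul d a)]].

Let fib_closed b D : closed D -> tau_closed MM u (fib b D).
Proof.
move=> Dc; apply/closed_uMH.
have fc : continuous (fun t : Q * Q => qmul b (qmul t.1 t.2)).
  by apply: qmul_continuous2; [exact: cst_continuous|exact: qmul_continuous].
have := image_closed Dc Abar_closed fc.
rewrite (_ : _ @` _ = [set X | exists d a, [/\ D d, Abar a & X = qmul b (qmul d a)]]) //.
apply/seteqP; split=> X; first by move=> [[d a] [/= Dd Aa] <-]; exists d, a.
by move=> [d [a [Dd Aa ->]]]; exists (d, a).
Qed.

(** The quotient of Lascar equivalent elements lies in [A], which is absorbed on the right of
    [b D A]. *)
Let fib_eqv b D x y : G x -> G y -> eqv x y -> fib b D x -> fib b D y.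
Proof.
move=> xG yG xy [_ [d [a [Dd Aa xE]]]]; split=> //.
have xVG := uM_invG xG.
have Axy : A (ecomp (uM_inv x) y).
  apply: A_eqv; first exact: uM_comp.
  rewrite -(uM_mulVr xG); apply: eqv_mul; try exact: uM_EL.
    exact: eqv_refl.
  exact: eqv_sym.
exists d, (qmul a (cls (ecomp (uM_inv x) y))); split=> //.
  by apply: Abar_mul => //; apply/AbarP => //; exact: uM_comp.
by rewrite !qmulA -(qmulA b) -xE qmul_cls ?uM_mulKVl //; exact: uM_comp.
Qed.

Let fibM b D := [set m | MM m /\ fib b D (ecomp u m)].

(** The restriction to a fixed number of [Theta]-steps and the product closure of the fibre make
    this a closed condition. *)
Let fib_layer b D k : set S :=
  MM `&` [set m | Theta_nbhd k [set q | exists2 z : S, closure (fib b D) z & z p0 = q] (m p0)].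

Let fib_layer_closed b D k : closed (fib_layer b D k).
Proof.
apply: closedI; first exact: MM_closed.
pose ev (z : S) : Sc j := z p0.
have evc : continuous ev by exact: ptws_eval_continuous.
rewrite (_ : mkset _ = ev @^-1` Theta_nbhd k (ev @` closure (fib b D))) //.
apply: closed_comp; first by move=> t _; exact: evc.
apply: Theta_nbhd_closed; apply: compact_closed; first exact: Sc_hausdorff.
apply: continuous_compact; first by apply: continuous_subspaceT => t; exact: evc.
by apply: (ScSc_closed_compact C'_monster C_small); exact: closed_closure.
Qed.

(** Taking the product closure adds nothing: its points [z] have [u z] in the tau-closed fibre. As
    [u z] and [z] are Lascar equivalent, as are [u m] and [m], a chain of any length between [m] and
    [z] puts [u m] into the fibre. *)
Let fibM_layers b D : closed D -> fibM b D = \bigcup_k fib_layer b D k.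
Proof.
move=> Dc; have FG : fib b D `<=` G by move=> x [].
have Fc := fib_closed b Dc.
apply/seteqP; split=> [m [mM fum]|m [k _ [mM mk]]].
  have [k hk] : exists k, Theta_nbhd k [set q | exists2 z : S, closure (fib b D) z & z p0 = q] (m p0).
    apply/Theta_nbhd_lasc; have [g [h [umg mh l]]] := eqv_um (MM_EL mM).
    exists (ecomp u m p0), (tmap h jc), (tmap g jc); split.
    - by exists (ecomp u m) => //; exact: subset_closure.
    - by have [] := mh.
    - by have [] := umg.
    - exact: lasc_sym.
  by exists k.
split=> //.
have [q [b' [d [[z zF <-] mb zd bd]]]] := (Theta_nbhd_lasc _ _).1 (ex_intro _ k mk).
have uzF : fib b D (ecomp u z).
  have [_ <-] := Fc; exact: closure_cl_tau.
have zM : MM z.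
  have := MM_closed; rewrite closure_id => ->; apply: closure_subset zF.
  by move=> x [/uM_MM].
apply: (fib_eqv (uM_umul zM) (uM_umul mM) _ uzF).
apply: eqv_trans (eqv_um (MM_EL zM)) _.
apply: eqv_trans (eqv_sym (eqv_um (MM_EL mM))).
exact: eqv_sym (eqv_types mb zd bd).
Qed.

(** Finitely many translates of the interior of [D] cover the compact group; the factor from [A] is
    taken to be one. *)
Let fib_cover D : nbhs qone D -> exists s : seq Q,
  forall m, MM m -> exists2 b, b \in s & fibM b D m.
Proof.
move=> D1.
suff [s sT] : exists s : seq Q, forall X, exists2 b, b \in s & D° (qmul (qinv b) X).
  exists s => m mM; have [b bs Db] := sT (cls (ecomp u m)).
  exists b => //; split=> //; split; first exact: uM_umul.
  exists (qmul (qinv b) (cls (ecomp u m))), qone; split.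
  - exact: interior_subset Db.
  - by apply/AbarP => //; exact: uM_u.
  - by rewrite qmul1r qmulVK.
apply: contrapT => nE.
pose F : set_system Q := filter_from [set: seq Q]
  (fun s => [set X | forall b, b \in s -> ~ D° (qmul (qinv b) X)]).
have FF : ProperFilter F.
  apply: filter_from_proper; first apply: filter_from_filter.
  - by exists [::].
  - move=> s s' _ _; exists (s ++ s') => // X h.
    by split=> b bs; apply: h; rewrite mem_cat bs ?orbT.
  - move=> s _; apply: contrapT => h; apply: nE; exists s => X; apply: contrapT => nX.
    by apply: h; exists X => b bs Db; apply: nX; exists b.
have [X [_ XF]] := uMH_compact FF filterT.
have FX : F [set Y | ~ D° (qmul (qinv X) Y)].
  by exists [:: X] => // Y; apply; rewrite inE.
have : nbhs X [set Y | D° (qmul (qinv X) Y)].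
  apply: open_nbhs_nbhs; split; last by rewrite /= qmulV.
  rewrite (_ : mkset _ = qmul (qinv X) @^-1` D°) //.
  by apply: open_comp; [move=> t _; exact: qmul_l|exact: open_interior].
by move=> /(XF _ _ FX)[Y []].
Qed.

Lemma fiber_closed : closed [set m | MM m /\ A (ecomp u m)].
Proof.
move=> m0 m0c; have m0M : MM m0.
  have := MM_closed; rewrite closure_id => ->; apply: closure_subset m0c.
  by move=> m [].
split=> //; have um0G := uM_umul m0M.
apply/AbarP => //; apply: contrapT => /small_nbhd[D [Dc D1 hD]].
have [s sP] := fib_cover D1.
(* One sequence runs through all pairs of a translate in [s] and a number of steps, read as
   remainder and quotient by [size s]. *)
pose Z n := fib_layer (nth qone s (n %% size s)) D (n %/ size s).
have [||||||n [O [oO [m1 [Om1 Mm1]] OZ]]] := @compact_baire S MM Z.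
- exact: ScSc_hausdorff.
- apply: (ScSc_closed_compact C'_monster C_small); exact: closedT.
- exact: MM_closed.
- by exists u.
- by move=> n; exact: fib_layer_closed.
- move=> m mM; have [b bs] := sP _ mM; rewrite fibM_layers // => -[k _ mk].
  have s0 : (0 < size s)%N by case: (s) bs.
  have ls : (index b s < size s)%N by rewrite index_mem.
  exists (k * size s + index b s)%N => //; rewrite /Z modnMDl modn_small // nth_index //.
  by rewrite divnMDl // divn_small // addn0.
set b := nth qone s (n %% size s) in OZ *.
have {}OZ m : MM m -> O m -> fib b D (ecomp u m).
  move=> mM Om; have : fibM b D m; last by case.
  by rewrite fibM_layers //; exists (n %/ size s)%N => //; exact: OZ.
(* Minimality gives [x] with [x m0] in [O]. An automorphism [g] close to [x] still sends [m0] into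
   [O] and, being continuous, also a neighbourhood of [m0]. *)
have [x xE xm] := MM_trans m0M Mm1.
have : nbhs x [set z | O (ecomp z m0)].
  by apply: (@ecomp_continuousr _ _ _ _ m0 x); apply: open_nbhs_nbhs; rewrite /= xm.
move=> /xE[g [gA Ogm0]]; have gE := AutEL_EL gA.
have gc := ecomp_continuousl (AutEL_continuous gA).
have : nbhs m0 [set m | O (ecomp g m)] by apply: (gc m0 O); exact: open_nbhs_nbhs.
move=> /m0c[m [[mM Aum] Ogm]].
have uE := MM_EL u_MM; have ugG : G (ecomp u (ecomp g u)).
  by apply: uM_umul; exact: MM_comp.
(* Up to Lascar equivalence [u (g m')] is the product of [u g u] and [u m'] in the group, and the
   fibre is saturated. *)
have fib_at m' : MM m' -> O (ecomp g m') ->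
    fib b D (ecomp (ecomp u (ecomp g u)) (ecomp u m')).
  move=> m'M Ogm'; have gm'M : MM (ecomp g m') by exact: MM_comp.
  apply: fib_eqv (OZ _ gm'M Ogm').
  - exact: uM_umul.
  - by apply: uM_comp => //; exact: uM_umul.
  have m'E := MM_EL m'M; have guE : ELC (ecomp g u) by exact: EL_comp.
  have um'E : ELC (ecomp u m') by exact: EL_comp.
  have gum'E : ELC (ecomp g (ecomp u m')) by exact: EL_comp.
  have gm'E : ELC (ecomp g m') by exact: EL_comp.
  apply: (@eqv_mul u u (ecomp g m') (ecomp (ecomp g u) (ecomp u m'))) => //.
  + exact: EL_comp.
  + exact: eqv_refl.
  apply: (@eqv_trans _ (ecomp g (ecomp u m'))).
    by apply: eqv_mul => //; [exact: eqv_refl|exact/eqv_sym/eqv_um].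
  apply: (@eqv_mul g g (ecomp u m') (ecomp u (ecomp u m'))) => //.
  + exact: EL_comp.
  + exact: eqv_refl.
  + exact/eqv_sym/eqv_um.
have [_ [d [a [Dd Aa e1]]]] := fib_at _ mM Ogm.
have [_ [d' [a' [Dd' Aa' e2]]]] := fib_at _ m0M Ogm0.
have umG := uM_umul mM.
rewrite -qmul_cls // in e1; rewrite -qmul_cls // in e2.
have Aum' : Abar (cls (ecomp u m)) by apply/AbarP.
set gam := cls (ecomp u (ecomp g u)) in e1 e2.
(* In the quotient, [gam] times the class of [u m] is [b d a], and [gam] times that of [u m0] is
   [b d' a']. Eliminating [gam] and [b] expresses the class of [u m0] in the form excluded by
   [hD]. *)
apply: (hD (qmul (cls (ecomp u m)) (qinv a)) a' d d') => //.
  by apply: Abar_mul => //; exact: Abar_inv.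
have gb : qmul (qinv gam) b = qmul (qmul (cls (ecomp u m)) (qinv a)) (qinv d).
  rewrite -[cls (ecomp u m)](qmulK gam) e1.
  by rewrite -!qmulA; congr qmul; rewrite (qmulA a) qmulVr qmul1 qmulVr qmul1r.
rewrite -[cls (ecomp u m0)](qmulK gam) e2 [RHS]qmulA gb.
by rewrite -!qmulA.
Qed.

End ClosedFiber.

(** * The orbit map *)

Section OrbitMap.
Variables (J : Type) (y : J -> lsort L) (J_small : small K' [set: J]).
Variables (D : set (tup C' y)) (E : tup C' y -> set (tup C' y)).
Hypotheses (E_equiv : invariant_equivalence D E) (E_bounded : bounded K' D E).
Variables (alpha : tup C' y) (D_alpha : D alpha).

Local Notation Q := (uMH MM u).

Lemma E_class (a b : tup C' y) : E a b -> E a = E b.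
Proof.
have [_ [_ Es Et] _ _] := E_equiv => ab; apply/seteqP; split=> c ac.
  by apply: Et ac; exact: Es.
exact: Et ac.
Qed.

Lemma E_classP (a b : tup C' y) : D a -> E a = E b -> E a b.
Proof. by have [_ [Er Es _] _ _] := E_equiv => Da ab; apply: Es; rewrite -ab; exact: Er. Qed.

(** A tuple with the type of [cbar] enumerates an automorphic copy of [C], hence a small elementary
    submodel. *)
Lemma E_fix_model t n (a : tup C' y) : Aut C' t -> same_type n jc -> tmap t n = n -> D a ->
  E a (tmap t a).
Proof.
move=> tA nj tn Da; have [lim _ satC' hom] := C'_monster.
have st : same_type jc n by move=> phi; split=> /nj.
have [v vA vn] := extend_tuple_aut C'_monster C_small st.
pose e : smap C C' := fun s c => v s (j c).
have eE : elementary e.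
  move=> I x phi w; rewrite (_ : tmap e w = tmap v (tmap j w)) //.
  by rewrite -(Aut_elementary vA); exact: j_elem.
apply: (E_over_model lim satC' hom J_small E_equiv E_bounded eE C_small) => // phi.
have -> : param e = n by rewrite -vn.
by rewrite (Aut_elementary tA) tmap_tcat tn.
Qed.

Lemma E_transfer g g' (a : tup C' y) : Aut C' g -> Aut C' g' ->
  lasc (tmap g jc) (tmap g' jc) -> D a -> E (tmap g a) (tmap g' a).
Proof.
have [_ [_ _ Et] Dinv Einv] := E_equiv; move=> gA g'A l Da; move: g g' gA g'A l.
apply: (lasc_ind (P := fun g g' => E (tmap g a) (tmap g' a))).
- by move=> g h gA hA hj; apply: Einv => //; exact: E_fix_model hj Da.
- by move=> g t n gA tA nj tn; apply: (E_fix_model tA nj tn); exact: Dinv.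
- by move=> g h k; exact: Et.
Qed.

(** A version of the orbit map on the whole semigroup, free of cosets; [hbar_cls] identifies it with
    [hbar]. *)
Definition hE (x : S) : set (tup C' y) := E (tmap (sval (cid (Rep_ex x))) alpha).

Lemma hE_Rep x g : Rep x g -> hE x = E (tmap g alpha).
Proof.
move=> xg; rewrite /hE; case: cid => g' /= xg'; apply: E_class.
by apply: E_transfer => //; [case: xg'|case: xg|exact: Rep_lasc xg' xg].
Qed.

Lemma hE_eqv x x' : eqv x x' -> hE x = hE x'.
Proof.
move=> [g [h [xg xh l]]]; rewrite (hE_Rep xg) (hE_Rep xh); apply: E_class.
by apply: E_transfer => //; [case: xg|case: xh].
Qed.

(** The representatives [t] and [t'] of [a] act alike on classes, and automorphisms preserve [E]. *)
Lemma hE_mul a x x' : ELC a -> ELC x -> ELC x' -> hE x = hE x' ->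
  hE (ecomp a x) = hE (ecomp a x').
Proof.
have [_ _ Dinv Einv] := E_equiv; move=> aE xE xE' xx.
have [g xg] := Rep_ex x; have [g' xg'] := Rep_ex x'.
have [t at_ axt] := Rep_mul aE xE xg; have [t' at' axt'] := Rep_mul aE xE' xg'.
have [[tA _] [t'A _]] := (at_, at'); have [[gA _] [g'A _]] := (xg, xg').
have e : hE (ecomp a x') = E (tmap t (tmap g' alpha)).
  rewrite (hE_Rep axt') (tmap_comp t' g'); apply: E_class; apply: E_transfer => //.
    exact: Rep_lasc at' at_.
  exact: Dinv.
rewrite e (hE_Rep axt) (tmap_comp t g); apply: E_class; apply: Einv => //.
apply: E_classP; first exact: Dinv.
by rewrite -(hE_Rep xg) -(hE_Rep xg').
Qed.

Lemma hE_u : hE u = E alpha.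
Proof. by rewrite (hE_eqv eqv_u) (hE_Rep Rep_id). Qed.

(** All values in the nested unions agree: members of a coset are Lascar equivalent by [HuM_eqv],
    and [AutfL] preserves every class. *)
Lemma hbar_cls x : G x -> hbar K' E alpha (cls x : Q) = hE x.
Proof.
have [lim _ satC' hom] := C'_monster; have [_ _ Dinv Einv] := E_equiv.
move=> xG; have coset_hE x' : ecoset MM u x x' -> hE x' = hE x.
  move=> [k Hk <-]; apply: hE_eqv; rewrite -[X in eqv _ X](uM_ur xG).
  apply: eqv_mul; try exact: uM_EL; [exact/uM_EL/HuM_sub|exact/uM_EL/uM_u|exact: eqv_refl|].
  exact: HuM_eqv.
have RepE x' g : (Aut C' g /\ forall phi, sval (x' p0) phi -> satC j phi (tmap g jc)) -> Rep x' g.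
  by move=> [gA h]; split=> //; exact: Sc_eq_tpC.
apply/seteqP; split=> b.
  move=> [_ [x' + [g /RepE xg [h hL <-]]]]; rewrite cls_val // => /coset_hE <-.
  rewrite (hE_Rep xg) => hb; have [gA _] := xg.
  have [_ hE_] := AutfL_E_fixing lim satC' hom J_small E_equiv E_bounded hL.
  by rewrite (E_class (Einv _ _ _ gA (hE_ _ D_alpha))).
have [g xg] := Rep_ex x; have [gA gx] := xg.
rewrite (hE_Rep xg) => gb; exists g => //; exists x.
  by rewrite cls_val //; exists u; [exact: HuM_u|exact: uM_ur].
exists g; first by split=> // phi; rewrite gx.
by exists (@sid L C') => // X [[_ X1 _ _] _].
Qed.

Let kerS : set S := [set x | G x /\ hE x = E alpha].

Lemma hE_eq_ker x x' : G x -> G x' -> hE x = hE x' <-> kerS (ecomp (uM_inv x) x').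
Proof.
move=> xG x'G; have xVG := uM_invG xG; have e := uM_EL.
split=> [h|[_ h]].
  split; first exact: uM_comp.
  by rewrite -(hE_mul _ _ _ h) ?uM_mulVr ?hE_u //; exact: uM_EL.
have : hE (ecomp x (ecomp (uM_inv x) x')) = hE (ecomp x u).
  by apply: hE_mul; rewrite ?hE_u //; apply: uM_EL => //; [exact: uM_comp|exact: uM_u].
by rewrite uM_mulKVl // uM_ur.
Qed.

(* A limit of [g_i eta_i] with [g_i] tending to [u] moves the parameters of the
   type-definable set by an automorphism which preserves every [E]-class. *)
Lemma hE_closed (F : set (set (tup C' y))) :
  type_definable K' [set b | same_type alpha b /\ F (E b)] ->
  tau_closed MM u [set x | G x /\ F (hE x)].
Proof.
move=> [I [xI [m [p [I_small pE]]]]]; have [lim _ _ _] := C'_monster.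
have [_ [_ Es _] Dinv _] := E_equiv.
pose P := [set b | same_type alpha b /\ F (E b)].
pose w := scat (scat cs cs) (scat y xI).
pose Xi : set (formula w) := [set phi | forall a b,
  same_type (tcat a b) (tcat jc alpha) -> P b -> sat phi (tcat (tcat a jc) (tcat b m))].
apply/tau_closedP; split=> [x []//|x [xA xG]]; split=> //.
have [eta [etaG Fh]|b [d [t [xb ud Xt]]]] :=
    circ_limit (zc := scat y xI) (small_sum lim J_small I_small) (Xi := Xi) xA.
  have [g eg] := Rep_ex eta; have [gA eg'] := eg.
  exists (tmap g jc), (tcat (tmap g alpha) m); split=> // phi; apply.
    by rewrite -tmap_tcat => psi; rewrite -(Aut_elementary gA).
  split; last by rewrite -(hE_Rep eg).
  by move=> psi; exact: Aut_elementary.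
pose be : tup C' y := fun i => t (inl i); pose e : tup C' xI := fun i => t (inr i).
have tE : t = tcat be e by apply: tup_ext => -[].
have st1 : same_type (tcat jc alpha) (tcat b be).
  pose v (k : {s & C s} + J) : term w (scat cs y k) :=
    match k return term w (scat cs y k) with
    | inl i => tvar w (inl (inl i)) | inr i => tvar w (inr (inl i)) end.
  have vP (a' d' : tup C' cs) b' e' phi :
      sat (fsubst v phi) (tcat (tcat a' d') (tcat b' e')) <-> sat phi (tcat a' b').
    rewrite sat_subst (_ : (fun k => _) = tcat a' b') //.
    by apply: tup_ext => -[].
  have key phi : sat phi (tcat jc alpha) -> sat phi (tcat b be).
    move=> h; apply/(vP b d be e); rewrite -tE; apply: Xt => a' b' ab _.
    by apply/vP/ab.
  move=> phi; split; first exact: key.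
  by move=> h; apply: contrapT => n; apply: (key (fNot phi) n).
have st2 : same_type (tcat jc m) (tcat d e).
  pose v (k : {s & C s} + I) : term w (scat cs xI k) :=
    match k return term w (scat cs xI k) with
    | inl i => tvar w (inl (inr i)) | inr i => tvar w (inr (inr i)) end.
  have vP (a' d' : tup C' cs) b' e' phi :
      sat (fsubst v phi) (tcat (tcat a' d') (tcat b' e')) <-> sat phi (tcat d' e').
    rewrite sat_subst (_ : (fun k => _) = tcat d' e') //.
    by apply: tup_ext => -[].
  have key phi : sat phi (tcat jc m) -> sat phi (tcat d e).
    move=> h; apply/(vP b d be e); rewrite -tE; apply: Xt => a' b' _ _.
    by apply/vP.
  move=> phi; split; first exact: key.
  by move=> h; apply: contrapT => n; apply: (key (fNot phi) n).
have pbe phi : p phi -> sat phi (tcat be e).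
  pose v (k : J + I) : term w (scat y xI k) :=
    match k return term w (scat y xI k) with
    | inl i => tvar w (inr (inl i)) | inr i => tvar w (inr (inr i)) end.
  have vP (a' d' : tup C' cs) b' e' :
      sat (fsubst v phi) (tcat (tcat a' d') (tcat b' e')) <-> sat phi (tcat b' e').
    rewrite sat_subst (_ : (fun k => _) = tcat b' e') //.
    by apply: tup_ext => -[].
  move=> pphi; apply/(vP b d be e); rewrite -tE; apply: Xt => a' b' _ Pb'.
  by apply/vP; have : [set b | same_type alpha b /\ F (E b)] b' by []; rewrite pE; apply.
have [g gA] := extend_tuple_aut C'_monster (small_sum lim C_small J_small) st1.
rewrite tmap_tcat => /tcat_inj[gb gbe].
have [s sA] := extend_tuple_aut C'_monster (small_sum lim C_small I_small) st2.
rewrite tmap_tcat => /tcat_inj[sd se].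
have xg : Rep x g by split=> //; rewrite gb.
have us : Rep u s by split=> //; rewrite sd.
have [k [kA sk ks]] := Aut_inv sA.
have skE : tmap s (tmap k be) = be by rewrite -(tmap_comp s k) sk.
have Pk : P (tmap k be).
  have : [set b | same_type alpha b /\ F (E b)] (tmap k be); last by [].
  rewrite pE => phi /pbe; rewrite -skE -se -tmap_tcat.
  by rewrite -(Aut_elementary sA) skE.
have [ak Fk] := Pk.
have Dk : D (tmap k be).
  by have [h hA <-] := extend_tuple_aut C'_monster J_small ak; exact: Dinv.
rewrite (hE_Rep xg) gbe -skE.
suff <- : E (tmap k be) = E (tmap s (tmap k be)) by [].
apply/esym/E_class; apply: (E_transfer sA (@Aut_id L C') _ Dk).
exact: eqvP eqv_u us Rep_id.
Qed.

(** * The stabilizer, its closure and its image *)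

Local Notation ker := (@ker_hbar _ _ _ j K' MM u _ y E alpha).

Lemma kerP x : G x -> ker (cls x) <-> hE x = E alpha.
Proof. by move=> xG; rewrite /ker_hbar /= hbar_cls. Qed.

Lemma ker_subgroup : subgroup qmul qone qinv ker.
Proof.
split.
- by apply/kerP; [exact: uM_u|exact: hE_u].
- move=> X Y; have [x xG ->] := cls_surj X; have [z zG ->] := cls_surj Y.
  move=> /(kerP xG) hx /(kerP zG) hz; rewrite qmul_cls //.
  apply/kerP; first exact: uM_comp.
  rewrite -hE_u in hz; rewrite (hE_mul (uM_EL xG) (uM_EL zG) (MM_EL u_MM) hz).
  by rewrite uM_ur.
- move=> X; have [x xG ->] := cls_surj X; move=> /(kerP xG) hx; rewrite qinv_cls //.
  have xVG := uM_invG xG; apply/kerP => //.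
  rewrite -hE_u in hx; rewrite -[uM_inv x]uM_ur //.
  by rewrite -(hE_mul (uM_EL xVG) (uM_EL xG) (MM_EL u_MM) hx) uM_mulVr // hE_u.
Qed.

(** Closure under products follows from separate continuity, one factor at a time. *)
Lemma closure_ker_subgroup : subgroup qmul qone qinv (closure ker).
Proof.
have [k1 kM kV] := ker_subgroup; split; first exact: subset_closure.
- move=> X Y Xk Yk.
  apply: (continuous_closure (@qmul_r Y) (@closed_closure _ ker) _ Xk) => Z Zk.
  apply: (continuous_closure (@qmul_l Z) (@closed_closure _ ker) _ Yk) => W Wk.
  by apply: subset_closure; exact: kM.
- move=> X Xk; have [_ _ _ _ ic] := uMH_topological_group.
  apply: (continuous_closure ic (@closed_closure _ ker) _ Xk) => Z Zk.
  by apply: subset_closure; exact: kV.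
Qed.

Let A : set S := pre (closure ker).

Let AG x : A x -> G x. Proof. by case. Qed.

Let A_closed : tau_closed MM u A.
Proof. by apply/closed_uMH; exact: closed_closure. Qed.

Let A_u : A u.
Proof. by split; [exact: uM_u|have [] := closure_ker_subgroup]. Qed.

Let A_mul x x' : A x -> A x' -> A (ecomp x x').
Proof.
have [_ kM _] := closure_ker_subgroup.
move=> [xG xk] [x'G x'k]; split; first exact: uM_comp.
by rewrite -qmul_cls //; exact: kM.
Qed.

Let A_inv x : A x -> A (uM_inv x).
Proof.
have [_ _ kV] := closure_ker_subgroup.
move=> [xG xk]; split; first exact: uM_invG.
by rewrite -qinv_cls //; exact: kV.
Qed.

Let A_ker x : kerS x -> A x.
Proof. by move=> [xG hx]; split=> //; apply: subset_closure; exact/kerP. Qed.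

Let A_eqv x : G x -> eqv x u -> A x.
Proof. by move=> xG xu; apply: A_ker; split=> //; rewrite (hE_eqv xu) hE_u. Qed.

(** Membership of [b] means that some [z] forms with [b] a pair of the type of [(cbar, alpha)] and
    has its type over [C] in a closed set supplied by [fiber_closed]; projecting away [z] preserves
    type-definability by saturation. *)
Lemma image_type_definable :
  type_definable K' [set b | same_type alpha b /\ (hbar K' E alpha @` closure ker) (E b)].
Proof.
have [lim _ satC' _] := C'_monster; have [_ _ Dinv _] := E_equiv.
have Bc : closed [set z : S | MM (ecomp z u) /\ A (ecomp u (ecomp z u))].
  have := fiber_closed A_closed A_u A_mul A_inv A_eqv.
  move=> /(closed_comp (f := fun z : S => ecomp z u)); apply=> z _.
  exact: ecomp_continuousr.
(* Any [z] in [EL] is Lascar equivalent to [u z u], an element of the group. The condition is closed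
   because [z] enters through the right translate [z u]. *)
pose Bs := ELC `&` [set z : S | MM (ecomp z u) /\ A (ecomp u (ecomp z u))].
pose ev (z : S) : Sc j := z p0.
have Qc : closed (ev @` Bs).
  apply: compact_closed; first exact: Sc_hausdorff.
  apply: continuous_compact.
    by apply: continuous_subspaceT => t; exact: ptws_eval_continuous.
  by apply: (ScSc_closed_compact C'_monster C_small); apply: closedI => //; exact: EL_closed.
pose good (b : tup C' y) (z : tup C' cs) := same_type (tcat jc alpha) (tcat z b) /\
  exists2 q, (ev @` Bs) q & sval q = tpC j z.
have XP b : same_type alpha b /\ (hbar K' E alpha @` closure ker) (E b) <-> exists z, good b z.
  split=> [[ab [X Xk XE]]|[z [st [_ [w [wE [wuM wuA]] <-] wz]]]].
    have [x xG Xx] := cls_surj X; rewrite Xx hbar_cls // in XE.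
    have [g gA gb] := extend_tuple_aut C'_monster J_small ab.
    have st : same_type (tmap g jc) jc by move=> phi; rewrite -(Aut_elementary gA).
    have [w wE wg] := EL_transitive C_monster C'_monster j_elem C_small (Sc_of st).
    have Rwg : Rep w g by split=> //; rewrite wg.
    exists (tmap g jc); split; first by rewrite -gb -tmap_tcat => phi; exact: Aut_elementary.
    exists (Sc_of st) => //; exists w => //; split=> //.
    have wuM : MM (ecomp w u) by exact: MM_comp.
    have vG : G (ecomp u (ecomp w u)) by exact: uM_umul.
    split=> //; have hv : hE x = hE (ecomp u (ecomp w u)).
      rewrite XE -gb -(hE_Rep Rwg); apply/esym/hE_eqv.
      apply: eqv_trans (eqv_um (MM_EL wuM)) _.
      have idE : ELC id by apply: AutEL_EL; exact: AutEL_id.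
      exact: (@eqv_mul w w u id wE wE (MM_EL u_MM) idE (eqv_refl w) eqv_u).
    rewrite -(uM_mulKVl xG vG); apply: A_mul.
      by split=> //; rewrite -Xx.
    by apply: A_ker; apply/hE_eq_ker.
  have [k kA] := extend_tuple_aut C'_monster (small_sum lim C_small J_small) st.
  rewrite tmap_tcat => /tcat_inj[kz kb]; split.
    by rewrite -kb => phi; exact: Aut_elementary.
  have Rwk : Rep w k by split=> //; rewrite kz -wz.
  exists (cls (ecomp u (ecomp w u))); first by case: wuA.
  rewrite hbar_cls; last exact: uM_umul.
  rewrite -kb -(hE_Rep Rwk); apply: hE_eqv.
  apply: eqv_trans (eqv_um (MM_EL wuM)) _.
  have idE : ELC id by apply: AutEL_EL; exact: AutEL_id.
  exact: (@eqv_mul w w u id wE wE (MM_EL u_MM) idE (eqv_refl w) eqv_u).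
(* All formulas over [C] implied by the existence of [z]; the rest of the proof recovers [z] from
   them. *)
pose p := [set phi : formula (scat y cs) | forall b z, good b z -> sat phi (tcat b jc)].
exists {s & C s}, cs, jc, p; split; first exact: C_small.
apply/seteqP; split=> [b /XP[z gz] phi pphi|b pb]; first exact: pphi gz.
pose w := scat (scat y cs) cs.
pose p' : set (formula w) := [set phi | forall b' z', good b' z' ->
  sat phi (tcat (tcat b' jc) z')].
have sW := small_sum lim (small_sum lim J_small C_small) C_small.
have [v [vv vp]] : exists v : tup C' w,
    (forall i, ~ range inr i -> v i = tcat (tcat b jc) jc i) /\
    forall phi, p' phi -> sat phi v.
  apply: (realize satC' sW) => q fq qp'.
  have [chi chiP] := formula_conj fq; have [rho rhoP] := formula_ex chi (range inr).
  (* The truth of [rho] does not depend on the last block of variables, which can therefore be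
     filled with the parameters. *)
  pose h (k : J + {s & C s} + {s & C s}) : term (scat y cs) (w k) :=
    match k return term (scat y cs) (w k) with
    | inl i => tvar (scat y cs) i | inr i => tvar (scat y cs) (inr i) end.
  have hP b' phi : sat (fsubst h phi) (tcat b' jc) <-> sat phi (tcat (tcat b' jc) jc).
    rewrite sat_subst (_ : (fun k => _) = tcat (tcat b' jc) jc) //.
    by apply: tup_ext => -[].
  have : p (fsubst h rho).
    move=> b' z' gb; apply/hP/rhoP; exists (tcat (tcat b' jc) z'); split.
      by move=> [//|i] []; exists i.
    by apply/chiP => phi /qp'; apply.
  by move=> /pb/hP/rhoP[v [vv vchi]]; exists v; split=> //; exact/chiP.
apply/XP; pose z : tup C' cs := fun i => v (inr i); exists z.
have ve : v = tcat (tcat b jc) z by apply: tup_ext => -[i|//] /=; rewrite vv // => -[].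
have st : same_type (tcat jc alpha) (tcat z b).
  pose h (k : {s & C s} + J) : term w (scat cs y k) :=
    match k return term w (scat cs y k) with
    | inl i => tvar w (inr i) | inr i => tvar w (inl (inl i)) end.
  have hP (b' : tup C' y) (c' z' : tup C' cs) phi :
      sat (fsubst h phi) (tcat (tcat b' c') z') <-> sat phi (tcat z' b').
    rewrite sat_subst (_ : (fun k => _) = tcat z' b') //.
    by apply: tup_ext => -[].
  have key phi : sat phi (tcat jc alpha) -> sat phi (tcat z b).
    move=> hphi; apply/(hP b jc z); rewrite -ve; apply: vp => b' z' [st _].
    by apply/hP/st.
  move=> phi; split; first exact: key.
  by move=> hphi; apply: contrapT => n; apply: (key (fNot phi) n).
have zj : same_type z jc.
  move=> phi; have := st (fsubst (fun i => tvar (scat cs y) (inl i)) phi).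
  by rewrite !sat_subst => h; split=> /h.
split=> //; exists (Sc_of zj) => //.
(* If a neighbourhood given by [phi] missed the closed set, the negation of [phi] would be among the
   formulas satisfied by [z]. *)
have := Qc (Sc_of zj); apply=> U /Sc_nbhs[phi [zphi phiU]].
apply: contrapT => nE.
pose h (k : {s & C s} + {s & C s}) : term w (scat cs cs k) :=
  match k return term w (scat cs cs k) with
  | inl i => tvar w (inr i) | inr i => tvar w (inl (inr i)) end.
have hP (b' : tup C' y) (z' : tup C' cs) psi : sat (fsubst h psi) (tcat (tcat b' jc) z') <-> satC j psi z'.
  rewrite /satC sat_subst (_ : (fun k => _) = tcat z' jc) //.
  by apply: tup_ext => -[].
have /vp : p' (fsubst h (fNot phi)).
  move=> b' z' [_ [q qB qz]]; apply/hP => z'phi; apply: nE; exists q; split=> //.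
  by apply: phiU; rewrite qz.
by rewrite ve => /hP; apply.
Qed.

Lemma hbar_class (X : Q) : [set E b | b in same_type alpha] (hbar K' E alpha X).
Proof.
have [x xG ->] := cls_surj X; rewrite hbar_cls //; have [g xg] := Rep_ex x.
have [gA _] := xg; exists (tmap g alpha); last by rewrite (hE_Rep xg).
by move=> phi; exact: Aut_elementary.
Qed.

(** One inclusion is continuity of the orbit map. For the other, the image is closed in the logic
    topology and contains the class of [alpha]. *)
Lemma image_closure : hbar K' E alpha @` closure ker =
  sval @` closure [set X : logic_space K' E alpha | sval X = E alpha].
Proof.
apply/seteqP; split=> [_ [X Xk <-]|_ [t tc <-]].
  pose hL (X : Q) : logic_space K' E alpha := exist _ _ (hbar_class X).
  have hLc : continuous hL.
    apply: generated_continuous => _ [F FP <-].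
    rewrite -[X in open X]setCK openC; apply/closed_uMH.
    rewrite (_ : pre _ = [set x | G x /\ F (hE x)]); first exact: hE_closed.
    apply/seteqP; split=> x [xG h]; split=> //.
      by rewrite -hbar_cls //; apply: contrapT => nF; apply: h.
    by move=> nF; apply: nF; rewrite /= hbar_cls //; exact: h.
  exists (hL X) => //.
  apply: (continuous_closure hLc (@closed_closure _ _) _ Xk) => Z Zk.
  exact: subset_closure.
pose F : set (logic_space K' E alpha) :=
  [set s | (hbar K' E alpha @` closure ker) (sval s)].
have Fc : closed F.
  rewrite -openC.
  have -> : ~` F = [set s : logic_space K' E alpha |
    (~` (hbar K' E alpha @` closure ker)) (sval s)] by [].
  apply: generated_open; exists (hbar K' E alpha @` closure ker) => //.
  exact: image_type_definable.
have : closure F t.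
  apply: closure_subset tc => s /= se; exists qone.
    by have [] := closure_ker_subgroup.
  by rewrite se /qone hbar_cls ?hE_u //; exact: uM_u.
by rewrite -((closure_id F).1 Fc).
Qed.

Lemma left_coset_eq (B : set Q) X Y : subgroup qmul qone qinv B ->
  B (qmul (qinv X) Y) -> left_coset qmul B X = left_coset qmul B Y.
Proof.
have VV Z : qmul Z (qinv Z) = qone by exact: (semitop_mulVr qmulA qmul1 qmulV).
move=> [_ BM BV] BXY; apply/seteqP; split=> _ [Z BZ <-].
  exists (qmul (qinv (qmul (qinv X) Y)) Z); first by apply: BM => //; exact: BV.
  have YE : Y = qmul X (qmul (qinv X) Y) by rewrite qmulA VV qmul1.
  by rewrite qmulA {1}YE -(qmulA X) VV (semitop_mul1r qmulA qmul1 qmulV).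
by exists (qmul (qmul (qinv X) Y) Z); [exact: BM|rewrite !qmulA VV qmul1].
Qed.

Lemma hbar_coset X Y : ker Y -> hbar K' E alpha (qmul X Y) = hbar K' E alpha X.
Proof.
have [x xG ->] := cls_surj X; have [z zG ->] := cls_surj Y.
move=> /(kerP zG) hz; rewrite qmul_cls // !hbar_cls //; last exact: uM_comp.
rewrite -hE_u in hz; rewrite (hE_mul (uM_EL xG) (uM_EL zG) (MM_EL u_MM) hz).
by rewrite uM_ur.
Qed.

(** The map on cosets is well defined by [hbar_coset]; it is injective because elements with equal
    values differ by an element of the stabilizer, and surjective by [image_closure]. *)
Lemma coset_bijection (cl_alpha := sval @` closure
    [set X : logic_space K' E alpha | sval X = E alpha]) :
  exists hq : set Q -> set (tup C' y),
    (forall X, closure ker X -> hq (left_coset qmul ker X) = hbar K' E alpha X) /\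
    set_bij [set left_coset qmul ker X | X in closure ker] cl_alpha hq.
Proof.
pose hq (B : set Q) := \bigcup_(X in B) hbar K' E alpha X.
have hqE X : hq (left_coset qmul ker X) = hbar K' E alpha X.
  apply/seteqP; split=> b; first by move=> [_ [Y Yk <-]]; rewrite hbar_coset.
  move=> Xb; exists (qmul X qone); last by rewrite hbar_coset //; have [] := ker_subgroup.
  by exists qone => //; have [] := ker_subgroup.
exists hq; split=> // ; split.
- move=> _ [X Xk <-]; rewrite hqE /cl_alpha -image_closure; by exists X.
- move=> _ _ /set_mem[X Xk <-] /set_mem[Y Yk <-]; rewrite !hqE => XY.
  apply: left_coset_eq; first exact: ker_subgroup.
  move: XY {Xk Yk}; have [x xG ->] := cls_surj X; have [z zG ->] := cls_surj Y.
  rewrite !hbar_cls // => /(hE_eq_ker xG zG)[vG h].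
  by rewrite qinv_cls // qmul_cls //; [apply/kerP|exact: uM_invG].
- move=> B; rewrite /cl_alpha -image_closure => -[X Xk <-].
  by exists (left_coset qmul ker X); [exists X|exact: hqE].
Qed.

Lemma orbit_map_theorem (cl_alpha := sval @` closure
    [set X : logic_space K' E alpha | sval X = E alpha]) :
  hbar K' E alpha @` closure ker = cl_alpha /\
  exists (mul : Q -> Q -> Q) (one : Q) (inv : Q -> Q),
    [/\ forall X Y, sval (mul X Y) = [set ecomp a b | a in sval X & b in sval Y],
        topological_group mul one inv /\ hausdorff_space Q,
        subgroup mul one inv (closure ker) /\ compact (closure ker),
        subgroup mul one inv ker /\ dense_in ker (closure ker) &
        exists hq : set Q -> set (tup C' y),
          (forall X, closure ker X -> hq (left_coset mul ker X) = hbar K' E alpha X) /\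
          set_bij [set left_coset mul ker X | X in closure ker] cl_alpha hq].
Proof.
split; first exact: image_closure.
exists qmul, qone, qinv; split.
- exact: qmul_val.
- by split; [exact: uMH_topological_group|exact: uMH_hausdorff].
- split; first exact: closure_ker_subgroup.
  by apply: (subclosed_compact _ uMH_compact (@subsetT _ _)); exact: closed_closure.
- by split; [exact: ker_subgroup|split=> //; exact: subset_closure].
- exact: coset_bijection.
Qed.

End OrbitMap.

End EllisGroup.

Theorem theorem3p15
  (L : language) (T : set (sentence L)) (T_complete : complete_theory T)
  (* the monster model C, of degree of saturation K *)
  (K : Type) (C : structure L) (C_T : models C T) (C_monster : monster K C)
  (* the bigger monster model C' >= C, of degree of saturation K' *)
  (K' : Type) (C' : structure L) (C'_monster : monster K' C')
  (j : smap C C') (j_elem : elementary j) (C_small : small_model K' C)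
  (MM : set (ScSc j)) (MM_min : minimal_left_ideal MM)
  (u : ScSc j) (u_MM : MM u) (u_idem : ecomp u u = u)
  (J : Type) (J_small : small K' [set: J]) (y : J -> lsort L)
  (D : set (tup C' y)) (E : tup C' y -> set (tup C' y))
  (E_equiv : invariant_equivalence D E) (E_bounded : bounded K' D E)
  (E_refines : forall a b, E a b -> same_type a b)
  (alpha : tup C' y) (D_alpha : D alpha) :
  let h : uMH MM u -> set (tup C' y) := hbar K' E alpha in
  let ker : set (uMH MM u) := ker_hbar K' E alpha in
  let cl_alpha : set (set (tup C' y)) :=
    sval @` closure [set X : logic_space K' E alpha | sval X = E alpha] in
  h @` closure ker = cl_alpha /\
  exists (mul : uMH MM u -> uMH MM u -> uMH MM u) (one : uMH MM u)
      (inv : uMH MM u -> uMH MM u),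
    [/\ (* mul is the multiplication of cosets *)
        forall X Y, sval (mul X Y) = [set ecomp a b | a in sval X & b in sval Y],
        (* uM / H(uM) is a Hausdorff topological group, and the closure of
           ker is a compact subgroup in which ker is a dense subgroup *)
        topological_group mul one inv /\ hausdorff_space (uMH MM u),
        subgroup mul one inv (closure ker) /\ compact (closure ker),
        subgroup mul one inv ker /\ dense_in ker (closure ker) &
        (* h induces a bijection on the left cosets of ker in its closure *)
        exists hq : set (uMH MM u) -> set (tup C' y),
          (forall X, closure ker X -> hq (left_coset mul ker X) = h X) /\
          set_bij [set left_coset mul ker X | X in closure ker] cl_alpha hq].
Proof.
exact: (orbit_map_theorem C_monster C'_monster j_elem C_small MM_min u_MM u_idem
  J_small E_equiv E_bounded D_alpha).
Qed.
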